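(* Let $l\ge2$, $\omega\in\mathbb R^l$, and let $\mathcal V:\mathbb R\times\mathbb T^l\to\mathbb R$ be smooth with zero Fourier coefficient $\mathcal V_0=0$. Assume that there are $\gamma>0$, $\tau\ge l$ with $|\langle\omega,q\rangle|^{-1}\le\gamma|q|^\tau$ for all $q\in\mathbb Z^l\setminus\{0\}$, that $\gamma\tau^\tau(\tau+2)^{4(\tau+2)}<\tfrac12$, and that $\|\mathcal V_\omega\|_\rho<\infty$ for some $\rho>2$. On the phase space away from the origin (the image of the map $\mathcal T$ defined in the context) consider the holomorphic Hamiltonian family $P_\varepsilon(\eta,y)=\mathcal P_0(\eta,y)+\varepsilon\mathcal P_1(\eta,y)$, $\varepsilon\in\mathbb R$, where $$\mathcal P_0(\eta,y)=\sum_{s=1}^l\omega_s(\eta_s^2+y_s^2),\qquad \mathcal P_1=\mathcal V_\omega\circ\mathcal T^{-1}.$$ Then the Birkhoff normal form of $P_\varepsilon$ is uniformly convergent on any compact subset of this domain if $$|\varepsilon|<\varepsilon^\ast:=\frac{1}{2^{2\tau}e^{24(2+\tau)}\|\mathcal V_\omega\|_\rho}.$$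
   Context: $\mathbb T^l=\mathbb R^l/2\pi\mathbb Z^l$; $|\cdot|$ is the Euclidean norm; $\mathcal V_\omega(\xi,x)=\mathcal V(\langle\omega,\xi\rangle,x)$. Fourier representation: $\mathcal V(t,x)=\sum_{q\in\mathbb Z^l}\mathcal V_q(t)e^{i\langle q,x\rangle}$, $\mathcal V_q(t)=\int_{\mathbb R}\widehat{\mathcal V}_q(p)e^{ipt}dp$; norm $\|\mathcal V_\omega\|_\rho=\sum_qe^{\rho|q|}\int_{\mathbb R}|\widehat{\mathcal V}_q(p)|e^{\rho|p|}dp$. Action-angle map: $\mathcal T(\xi,x)=(\eta,y)$ with $\eta_i=-\sqrt{\xi_i}\sin x_i$, $y_i=\sqrt{\xi_i}\cos x_i$, $i=1,\dots,l$, for $(\xi,x)\in(0,\infty)^l\times\mathbb T^l$; it is a real-analytic bijection onto $(\mathbb R^2\setminus\{(0,0)\})^l$ (pairs $(\eta_s,y_s)$), the set denoted $\mathbb R^{2l}\setminus\{0,0\}$ in the paper; note $\xi_s=\eta_s^2+y_s^2$ and $\mathcal P_0\circ\mathcal T=\langle\omega,\xi\rangle$. Birkhoff normal form of $P_\varepsilon$: the power series $\mathcal P_0+\sum_{k\ge1}\mathcal B_k\varepsilon^k$, with each $\mathcal B_k$ a function of $(\xi_1,\dots,\xi_l)$, $\xi_s=\eta_s^2+y_s^2$, only, produced by canonical perturbation theory: for each $N$ there is a canonical transformation $\mathcal C_{\varepsilon,N}$ close to the identity with $P_\varepsilon\circ\mathcal C_{\varepsilon,N}=\mathcal P_0+\sum_{k=1}^N\mathcal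 B_k\varepsilon^k+O(\varepsilon^{N+1})$. *)

(* Defs.v *)
From HB Require Import structures.
From mathcomp Require Import all_boot all_order all_algebra.
From mathcomp Require Import all_classical all_reals all_analysis.
From mathcomp Require summability.
From mathcomp Require Import complex.

Set Implicit Arguments.
Unset Strict Implicit.
Unset Printing Implicit Defensive.

Import Order.TTheory GRing.Theory Num.Theory.
Import numFieldNormedType.Exports.

Local Open Scope classical_set_scope.
Local Open Scope ring_scope.

Section VectorsAndSmoothness.
Context {R : realType}.

Definition dot {l : nat} (u v : 'rV[R]_l) : R := \sum_i u 0 i * v 0 i.

(* The library norm on row vectors is the sup norm. *)
Definition enorm {l : nat} (u : 'rV[R]_l) : R := Num.sqrt (dot u u).

Definition zvec {l : nat} (q : 'rV[int]_l) : 'rV[R]_l := map_mx intr q.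

Fixpoint Ck {E F : normedModType R} (n : nat) (U : set E) (f : E -> F) : Prop :=
  if n is m.+1 then
    (forall x, U x -> differentiable f x) /\
    (forall v : E, Ck m U (fun x => 'D_v f x))
  else forall x, U x -> {for x, continuous f}.

Definition smooth {E F : normedModType R} (U : set E) (f : E -> F) : Prop :=
  forall n, Ck n U f.

End VectorsAndSmoothness.

Section Fourier.
Context {R : realType} {l : nat}.

(* Functions on the torus R^l / 2 pi Z^l are 2 pi-periodic functions on R^l. *)
Definition torus_function (f : 'rV[R]_l -> R) : Prop :=
  forall (x : 'rV[R]_l) (k : 'rV[int]_l), f (x + (2 * pi) *: zvec k) = f x.

Definition expi (a : R) : R[i] := (cos a +i* sin a)%C.

Definition cmodulus (z : R[i]) : R := ComplexField.Normc.normc z.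

(* V_q(t), the integral of Vhat_q(p) e^{ipt} over p, taken componentwise. *)
Definition fourier_coef (Vhat : 'rV[int]_l -> R -> R[i]) (q : 'rV[int]_l)
    (t : R) : R[i] :=
  ((\int[lebesgue_measure]_p complex.Re (Vhat q p * expi (p * t)))%R +i*
   (\int[lebesgue_measure]_p complex.Im (Vhat q p * expi (p * t)))%R)%C.

(* Unordered sum, taken componentwise over the finite subsets of I. *)
Definition has_csum {I : choiceType} (f : I -> R[i]) (s : R[i]) : Prop :=
  (summability.partial_sum (fun i => complex.Re (f i)) @ summability.totally --> complex.Re s) /\
  (summability.partial_sum (fun i => complex.Im (f i)) @ summability.totally --> complex.Im s).

Definition fourier_representation (V : R -> 'rV[R]_l -> R)
    (Vhat : 'rV[int]_l -> R -> R[i]) : Prop :=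
  (forall q, measurable_fun setT (fun p => complex.Re (Vhat q p)) /\
             measurable_fun setT (fun p => complex.Im (Vhat q p))) /\
  (forall t x, has_csum
     (fun q => fourier_coef Vhat q t * expi (dot (zvec q) x)) (V t x)%:C%C).

Definition fnorm (rho : R) (Vhat : 'rV[int]_l -> R -> R[i]) : \bar R :=
  \esum_(q in [set: 'rV[int]_l])
    ((expR (rho * enorm (@zvec R l q)))%:E *
     \int[lebesgue_measure]_p (cmodulus (Vhat q p) * expR (rho * `|p|))%:E)%E.

End Fourier.

(* Used both for Cartesian points (eta, y) and for action-angle points (xi, x). *)
Notation phase R l := ('rV[R]_l * 'rV[R]_l)%type.

Section PhaseSpace.
Context {R : realType} {l : nat}.

Definition action_angle (p : phase R l) : phase R l :=
  (\row_i (- (Num.sqrt (p.1 0 i) * sin (p.2 0 i))),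
   \row_i (Num.sqrt (p.1 0 i) * cos (p.2 0 i))).

(* (0, oo)^l x T^l, the torus being represented by the cube [0, 2 pi)^l, on
   which action_angle is injective. *)
Definition action_angle_domain : set (phase R l) :=
  [set p : phase R l | forall i : 'I_l, 0 < p.1 0 i /\ 0 <= p.2 0 i < 2 * pi].

Definition phase_space : set (phase R l) := action_angle @` action_angle_domain.

Definition action_angle_inv : phase R l -> phase R l :=
  pinv_ (fun=> (0, 0)) action_angle_domain action_angle.

Definition actions (z : phase R l) : 'rV[R]_l :=
  \row_i (z.1 0 i ^+ 2 + z.2 0 i ^+ 2).

Definition hamiltonian0 (omega : 'rV[R]_l) (z : phase R l) : R :=
  \sum_s omega 0 s * (z.1 0 s ^+ 2 + z.2 0 s ^+ 2).

Definition subst_omega (omega : 'rV[R]_l) (V : R -> 'rV[R]_l -> R)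
    (p : phase R l) : R := V (dot omega p.1) p.2.

Definition hamiltonian1 (omega : 'rV[R]_l) (V : R -> 'rV[R]_l -> R)
    (z : phase R l) : R := subst_omega omega V (action_angle_inv z).

(* The Liouville one-form sum_s y_s d(eta_s) at z, applied to v. *)
Definition liouville (z v : phase R l) : R := dot z.2 v.1.

(* A smooth family C_e of canonical transformations with C_0 = id, defined at
   (e, z) in an open neighbourhood U of {0} x phase_space (how large e may be
   depends on z).  Canonical is meant in the sense of perturbation theory,
   where transformations are obtained from generating functions: the pullback
   of the Liouville form differs from it by the differential of a
   single-valued function S_e, which implies that C_e is symplectic.
   Symplecticity alone would not be enough: on this multiply connected domain
   it also allows the action shifts xi |-> xi + e c, for which normal forms
   are not unique. *)
Definition canonical_near_id (U : set (R^o * phase R l))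
    (C : R -> phase R l -> phase R l) : Prop :=
  [/\ open U /\ (forall z, phase_space z -> U (0, z)),
      smooth U (fun w : R^o * phase R l => C w.1 w.2),
      forall z, phase_space z -> C 0 z = z,
      forall e z, U (e, z) -> phase_space z /\ phase_space (C e z) &
      exists S : R -> phase R l -> R, forall e z v, U (e, z) ->
        is_derive z v (S e : phase R l -> R^o)
          (liouville (C e z) ('D_v (C e) z) - liouville z v)].

(* B k is the coefficient of e ^ k as a function of the actions; only the
   indices k >= 1 are used. *)
Definition birkhoff_partial_sum (P0 : phase R l -> R)
    (B : nat -> 'rV[R]_l -> R) (e : R) (N : nat) (z : phase R l) : R :=
  P0 z + \sum_(1 <= k < N.+1) B k (actions z) * e ^+ k.

(* The remainder O(e ^ (N + 1)) is locally uniform on the phase space. *)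
Definition birkhoff_normal_form (P0 P1 : phase R l -> R)
    (B : nat -> 'rV[R]_l -> R) : Prop :=
  forall N : nat, exists U C, canonical_near_id U C /\
    forall K : set (phase R l), compact K -> K `<=` phase_space ->
      exists M : R, \forall e \near (0 : R), forall z, K z ->
        `|P0 (C e z) + e * P1 (C e z) - birkhoff_partial_sum P0 B e N z|
          <= M * `|e| ^+ N.+1.

End PhaseSpace.

(* Main.v *)
(* Write s = <omega, I>.  The Hamiltonian is <omega, xi> + e V(<omega, xi>, x),
   so it depends on the actions only through s, and a generating function
   S(s, x, e) = sum_k e^k S_k(s, x) with xi = I + grad_x S reduces the normal
   form to the scalar equation  s + D + e V(s + D, x) = s + sum_k b_k(s) e^k,
   D = sum_k e^k <omega, grad_x S_k>.  At order e^(k+1) it reads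
   <omega, grad_x S_(k+1)> = b_(k+1)(s) - [e^k] V(s + D, x), a cohomological
   equation solved with the diophantine condition, b_(k+1)(s) being the mean of
   the last term.  Truncating S gives the transformations C_e.

   Uniqueness: for any other normal form, a maximum over the torus
   {actions = I} of a function whose derivative combines the exactness primitive
   of C_e with the truncated S yields a point where the two normal forms of
   order N agree up to O(e^(N+1)).

   Convergence: the solution loses no regularity in the bounds that matter.  A
   mean is at most a supremum, so D_(k+1) := <omega, grad_x S_(k+1)> is bounded
   by twice the sup of [e^k] V(s + D, x), which involves D_1, ..., D_k only and
   derivatives of V in time; these are at most 2 ||V|| j! rho^-j.  The majorant
   recursion gives the geometric bound |b_k| d^k <= B as soon as
   16 ||V|| d <= rho, and the threshold of the theorem is far below that. *)
Require Import Defs.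
From HB Require Import structures.
From mathcomp Require Import all_boot all_order all_algebra.
From mathcomp Require Import all_classical all_reals all_analysis.
From mathcomp Require Import complex.
From mathcomp Require finmap.
From mathcomp Require Import measurable_realfun zify ring lra.

Set Implicit Arguments.
Unset Strict Implicit.
Unset Printing Implicit Defensive.

Import Order.TTheory GRing.Theory Num.Theory.
Import numFieldNormedType.Exports.

Local Open Scope classical_set_scope.
Local Open Scope ring_scope.

(** * Superpositions of waves *)

Section Littleo.
Context {R : realType}.

(** Small divisors enter only qualitatively. All functions live in an algebra of wave integrals with
    finite moments; dividing an amplitude by [<omega, q>] costs a fixed number of moments, so every
    [S k] stays in the algebra, with bounds that do not influence the radius. The constants that
    decide the radius are suprema of the [D_k] and [b_k], and these never see a divisor. Two
    obstacles shape the rest. The angles are not single-valued on the phase space, while smoothness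
    and exactness are statements in Cartesian coordinates; derivatives are therefore expressed by
    the single-valued [angle_form] and by local lifts of the angles. And the transformation of a
    competing normal form is an arbitrary exact family close to the identity: inverting it or
    composing it with another one would require control of domains. Since both normal forms depend
    on the actions only, one point per torus suffices to compare them, and an extremum provides it.
    Existence and uniqueness then rest on the same residual estimate, applied at points where
    [<omega, xi>] equals [s + D]. *)

Lemma is_diff_bound (V W : normedModType R) (f : V -> W) (L : {linear V -> W}) (x : V) :
  continuous L ->
  (forall e, 0 < e -> \forall h \near (0 : V), `|f (x + h) - f x - L h| <= e * `|h|) ->
  is_diff x f L.
Proof.
move=> cL H.
have eqo : f \o shift x = cst (f x) + L +o_ 0 id.
  apply/eqaddoP => _/posnumP[e]; have /= := H e%:num [gt0 of e%:num].
  apply: filterS => h.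
  by rewrite !fctE /= [h + x]addrC opprD addrA.
have dE := diff_unique cL eqo.
split; last by rewrite dE.
by apply/diff_locallyP; rewrite dE.
Qed.

Lemma diff_bound (V W : normedModType R) (f : V -> W) (x : V) :
  differentiable f x ->
  forall e, 0 < e -> \forall h \near (0 : V), `|f (x + h) - f x - 'd f x h| <= e * `|h|.
Proof.
move=> /diff_locallyP [_ /eqaddoP H] e e0; have := H _ e0.
by apply: filterS => h; rewrite !fctE /= [h + x]addrC opprD addrA.
Qed.

End Littleo.

Section Cosine.
Context {R : realType}.

Lemma sin_lipschitz (x y : R) : `|sin y - sin x| <= `|y - x|.
Proof.
wlog xy : x y / x <= y.
  move=> H; case: (leP x y) => [|/ltW] ?; first exact: H.
  by rewrite distrC [X in _ <= X]distrC; exact: H.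
have [c _ ->] := @MVT_segment R sin cos x y xy
  (fun z _ => is_derive_sin z) (continuous_subspaceT (@continuous_sin R)).
by rewrite normrM ler_piMl // cos_max.
Qed.

(** The bound is uniform in [a], so that it can be integrated over all frequencies at once. *)
Lemma cos_quadratic (a h : R) :
  `|cos (a + h) - cos a + h * sin a| <= h ^+ 2.
Proof.
have ineq c : `|a - c| <= `|h| -> `|- sin c * h + h * sin a| <= h ^+ 2.
  move=> ca; rewrite (_ : _ + _ = h * (sin a - sin c)); last by ring.
  rewrite normrM -real_normK ?num_real // expr2 ler_wpM2l //.
  exact: le_trans (sin_lipschitz _ _) _.
have mvt (x y : R) : x <= y -> exists2 c, c \in `[x, y] & cos y - cos x = - sin c * (y - x).
  move=> xy; have [|c ci E] := @MVT_segment R cos (fun x => - sin x) x y xy.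
    exact: (continuous_subspaceT (@continuous_cos R)).
  by exists c.
have [h0|h0] := leP 0 h.
  have [|c ci ->] := mvt a (a + h); first by lra.
  rewrite (_ : a + h - a = h); last by ring.
  apply: ineq; move: ci; rewrite in_itv /= => /andP[? ?].
  by rewrite ler0_norm ?ger0_norm; lra.
have [|c ci E] := mvt (a + h) a; first by lra.
rewrite (_ : cos _ - _ = - sin c * h); last first.
  by rewrite -opprB E; ring.
apply: ineq; move: ci; rewrite in_itv /= => /andP[? ?].
by rewrite ger0_norm ?ler0_norm; lra.
Qed.

Lemma measurable_fun_cos d (T : measurableType d) (f : T -> R) :
  measurable_fun setT f -> measurable_fun setT (fun x => cos (f x)).
Proof. by apply: measurableT_comp; exact: continuous_measurable_fun (@continuous_cos R). Qed.

Lemma measurable_fun_sin d (T : measurableType d) (f : T -> R) :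
  measurable_fun setT f -> measurable_fun setT (fun x => sin (f x)).
Proof. by apply: measurableT_comp; exact: continuous_measurable_fun (@continuous_sin R). Qed.

End Cosine.

(** * Integrals of waves and their derivatives *)

Section TrigIntegral.
Context {R : realType} {l : nat}.
Local Notation E := (R^o * 'rV[R]_l)%type.

Lemma coord_le_norm (v : 'rV[R]_l) i : `|v 0 i| <= `|v|.
Proof.
rewrite [leRHS]mx_normrE.
exact: (le_bigmax _ (fun ij : 'I_1 * 'I_l => `|v ij.1 ij.2|) (0, i)).
Qed.

Lemma ler_norm_sum_rV (u v : 'rV[R]_l) : `|dot u v| <= (\sum_i `|u 0 i|) * `|v|.
Proof.
rewrite /dot (le_trans (ler_norm_sum _ _ _)) // mulr_suml ler_sum // => i _.
rewrite normrM ler_wpM2l //.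
exact: coord_le_norm.
Qed.

(** The summand 1 makes the size at least 1, so that its powers increase, and submultiplicative
    under sums of frequencies, so that moments of a product are dominated by products of moments. *)
Definition freq_size (p : R) (q : 'rV[int]_l) : R :=
  1 + `|p| + \sum_i `|zvec q 0 i|.

Lemma freq_size_ge1 p q : 1 <= freq_size p q.
Proof. by rewrite /freq_size -addrA lerDl addr_ge0 // sumr_ge0. Qed.

Lemma freq_size_ge0 p q : 0 <= freq_size p q.
Proof. exact: le_trans ler01 (freq_size_ge1 _ _). Qed.
Hint Resolve freq_size_ge0 : core.

(* Functions are represented as integrals of waves over an arbitrary measure
   space of frequencies rather than as Fourier series, so that products of
   functions are integrals over product spaces; all moments are finite, which
   gives smoothness in (t, x). *)
Record spectrum := Spectrum {
  sp_disp : measure_display;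
  sp_index : measurableType sp_disp;
  sp_measure : {sigma_finite_measure set sp_index -> \bar R};
  amplitude : sp_index -> R;
  time_freq : sp_index -> R;
  space_freq : sp_index -> 'rV[int]_l;
  measurable_amplitude : measurable_fun setT amplitude;
  measurable_time_freq : measurable_fun setT time_freq;
  measurable_space_freq : forall i, measurable_fun setT (fun j => (zvec (space_freq j) 0 i : R));
  integrable_moment : forall m, sp_measure.-integrable setT
    (EFin \o (fun j => amplitude j * freq_size (time_freq j) (space_freq j) ^+ m)) }.

Definition sp_size X (j : sp_index X) := freq_size (time_freq j) (space_freq j).

Lemma sp_size_ge0 X (j : sp_index X) : 0 <= sp_size j.
Proof. exact: freq_size_ge0. Qed.
Hint Resolve sp_size_ge0 : core.

Definition phase_at X (w : E) (j : sp_index X) : R :=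
  time_freq j * w.1 + dot (zvec (space_freq j)) w.2.

(** With the phase [th] cosines and sines need no separate treatment: a derivative is again an
    [osc], with [th] advanced by [pi / 2]. *)
Definition osc X (th : R) (w : E) : R^o :=
  \int[sp_measure X]_j (amplitude j * cos (phase_at w j + th)).

Lemma phase_atD X w v (j : sp_index X) : phase_at (w + v) j = phase_at w j + phase_at v j.
Proof.
rewrite /phase_at /dot /= mulrDr addrACA -big_split /=; congr (_ + _).
by apply: eq_bigr => i _; rewrite !mxE mulrDr.
Qed.

Lemma phase_atZ X (a : R) w (j : sp_index X) : phase_at (a *: w) j = a * phase_at w j.
Proof.
rewrite /phase_at /dot /= mulrDr mulr_sumr; congr (_ + _); first by rewrite mulrCA.
by apply: eq_bigr => i _; rewrite !mxE mulrCA.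
Qed.

Lemma phase_at_le X w (j : sp_index X) : `|phase_at w j| <= sp_size j * `|w|.
Proof.
rewrite /phase_at (le_trans (ler_normD _ _)) // /sp_size /freq_size mulrDl lerD //.
  rewrite normrM mulrDl mul1r ler_wpDl // ler_wpM2l // prod_normE.
  by rewrite le_max lexx.
rewrite (le_trans (ler_norm_sum_rV _ _)) // ler_wpM2l ?sumr_ge0 // prod_normE.
by rewrite le_max lexx orbT.
Qed.

Lemma measurable_phase_at X w : measurable_fun setT (@phase_at X w).
Proof.
apply: measurable_funD.
  by apply: measurable_funM => //; exact: measurable_time_freq.
apply: measurable_sum => i.
by apply: measurable_funM => //; exact: measurable_space_freq.
Qed.

Lemma measurable_sp_size X : measurable_fun setT (@sp_size X).
Proof.
apply: measurable_funD; first apply: measurable_funD => //.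
  by apply: measurableT_comp => //; exact: measurable_time_freq.
by apply: measurable_sum => i; apply: measurableT_comp => //; exact: measurable_space_freq.
Qed.

Lemma integrable_amplitude X (g : sp_index X -> R) (C : R) m :
  measurable_fun setT g -> (forall j, `|g j| <= C * sp_size j ^+ m) ->
  (sp_measure X).-integrable setT (EFin \o (fun j => amplitude j * g j)).
Proof.
move=> mg gC.
apply: (@le_integrable _ _ _ _ _ measurableT _
  (EFin \o (fun j => C * (amplitude j * sp_size j ^+ m)))).
- by apply/measurable_EFinP/measurable_funM => //; exact: measurable_amplitude.
- move=> j _ /=; rewrite lee_fin normrM mulrCA normrM ler_wpM2l //.
  exact: le_trans (gC j) (ler_norm _).
- exact: (integrableZl measurableT C (integrable_moment X m)).
Qed.

Lemma integrable_cos X th w :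
  (sp_measure X).-integrable setT
    (EFin \o (fun j => amplitude j * cos (phase_at w j + th))).
Proof.
apply: (@integrable_amplitude _ _ 1 0); last by move=> j; rewrite expr0 mulr1 cos_max.
by apply: measurable_fun_cos; apply: measurable_funD => //; exact: measurable_phase_at.
Qed.

Lemma osc_le X th w : `|osc X th w| <= \int[sp_measure X]_j `|amplitude j|.
Proof.
have iA : (sp_measure X).-integrable setT (EFin \o (fun j => `|amplitude j|)).
  have := integrable_moment X 0; rewrite (_ : EFin \o _ = EFin \o amplitude (s := X)); last first.
    by apply/funext => j /=; rewrite expr0 mulr1.
  exact: integrable_norm.
rewrite (le_trans (le_normr_Rintegral _ _)) //; first exact: integrable_cos.
apply: le_Rintegral => //; first exact/integrable_norm/integrable_cos.
by move=> j _; rewrite normrM ler_piMr // cos_max.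
Qed.

Lemma osc_periodic X th s x (k : 'rV[int]_l) :
  osc X th (s, x + (2 * pi) *: zvec k) = osc X th (s, x).
Proof.
congr fine; apply: eq_integral => j _; congr (_ * _)%:E.
have cosZ (a : R) (n : int) : cos (a + 2 * pi * n%:~R) = cos a.
  have cosn (m : nat) b : cos (b + 2 * pi * m%:R) = cos b :> R.
    by rewrite mulr_natr mulrC mulr_natr; exact: (periodicn (@cosD2pi R)).
  case: n => m; first exact: cosn.
  by rewrite NegzE mulrNz mulrN -(cosn m.+1 (a - _)) subrK.
rewrite /phase_at /=.
pose n : int := \sum_i space_freq j 0 i * k 0 i.
rewrite -[RHS](cosZ _ n); congr cos.
rewrite (_ : dot _ (_ + _) = dot (zvec (space_freq j)) x + 2 * pi * n%:~R); first by ring.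
rewrite /dot /n raddf_sum /= mulr_sumr -big_split; apply: eq_bigr => i _ /=.
by rewrite !mxE intrM; ring.
Qed.

Definition deriv_spectrum_proof X v m :
  (sp_measure X).-integrable setT (EFin \o (fun j =>
    amplitude j * phase_at v j * freq_size (time_freq j) (space_freq j) ^+ m)).
Proof.
rewrite (_ : (fun _ => _) = fun j => amplitude (s := X) j *
   (phase_at v j * freq_size (time_freq j) (space_freq j) ^+ m)); last first.
  by apply/funext => j; rewrite mulrA.
apply: (@integrable_amplitude _ _ `|v| m.+1).
  apply: measurable_funM; first exact: measurable_phase_at.
  exact/measurable_funX/measurable_sp_size.
move=> j; rewrite exprSr mulrCA normrM [X in _ * X]ger0_norm ?exprn_ge0 //.
by rewrite mulrC ler_wpM2l ?exprn_ge0 // mulrC phase_at_le.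
Qed.

Definition deriv_spectrum X v : spectrum :=
  @Spectrum _ _ (sp_measure X) (fun j => amplitude j * phase_at v j)
    (@time_freq X) (@space_freq X)
    (measurable_funM (@measurable_amplitude X) (@measurable_phase_at X v))
    (@measurable_time_freq X) (@measurable_space_freq X) (deriv_spectrum_proof X v).

Definition osc_deriv X th w v : R := osc (deriv_spectrum X v) (th + pi / 2) w.

Lemma osc_derivE X th w v : osc_deriv X th w v =
  \int[sp_measure X]_j (amplitude j * (phase_at v j * - sin (phase_at w j + th))).
Proof.
congr fine; apply: eq_integral => j _; congr (_ %:E) => /=.
by rewrite addrA cosDpihalf mulrA.
Qed.

Lemma measurable_sin_phase X th w :
  measurable_fun setT (fun j : sp_index X => - sin (phase_at w j + th)).
Proof.
by apply: measurable_funN; apply: measurable_fun_sin; apply: measurable_funD => //; exact: measurable_phase_at.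
Qed.

Lemma integrable_osc_deriv X th w v : (sp_measure X).-integrable setT
  (EFin \o (fun j => amplitude j * (phase_at v j * - sin (phase_at w j + th)))).
Proof.
apply: (@integrable_amplitude _ _ `|v| 1).
  by apply: measurable_funM; [exact: measurable_phase_at|exact: measurable_sin_phase].
move=> j; rewrite normrM normrN expr1 mulrC -[leRHS]mul1r ler_pM ?sin_max //.
by rewrite mulrC phase_at_le.
Qed.

Lemma osc_deriv_linear X th w : linear (osc_deriv X th w : E -> R^o).
Proof.
move=> a u v; rewrite /GRing.scale /= !osc_derivE -RintegralZl //; last exact: integrable_osc_deriv.
rewrite -RintegralD //; last exact: integrable_osc_deriv.
  congr fine; apply: eq_integral => j _; congr (_ %:E) => /=.
  by rewrite phase_atD phase_atZ; ring.
exact: (integrableZl measurableT a (integrable_osc_deriv _ _ _ _)).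
Qed.

HB.instance Definition _ X th w := GRing.isLinear.Build R E R^o *:%R
  (osc_deriv X th w : E -> R^o) (osc_deriv_linear X th w).

Definition osc_lin X th w : {linear E -> R^o} := osc_deriv X th w : E -> R^o.

Lemma integrable_moment_abs X m : (sp_measure X).-integrable setT
  (EFin \o (fun j => `|amplitude (s := X) j| * sp_size j ^+ m)).
Proof.
have := integrable_norm (integrable_moment X m).
apply: eq_integrable => // j _ /=; congr (_%:E).
by rewrite normrM [X in _ * X]ger0_norm // exprn_ge0.
Qed.

(** By [cos_quadratic] under the integral, the remainder is at most the second moment times the
    square of the increment; the first moment bounds the differential. *)
Lemma osc_is_diff X th w : is_diff w (osc X th) (osc_lin X th w).
Proof.
apply: is_diff_bound.
  apply: bounded_linear_continuous.
  apply/linear_boundedP.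
  pose M := \int[sp_measure X]_j (`|amplitude j| * sp_size j ^+ 1).
  exists M; split; first exact: num_real.
  move=> r Mr v; rewrite (@le_trans _ _ (M * `|v|)) //; last by rewrite ler_wpM2r // ltW.
  rewrite [_ v]osc_derivE (le_trans (le_normr_Rintegral _ _)) //.
    exact: integrable_osc_deriv.
  rewrite /M -RintegralZr //; last exact: integrable_moment_abs.
  apply: le_Rintegral => //; first exact/integrable_norm/integrable_osc_deriv.
    exact: (integrableZr measurableT _ (integrable_moment_abs _ _)).
  move=> j _; rewrite normrM -mulrA ler_wpM2l // normrM normrN expr1.
  by rewrite -[leRHS]mulr1 ler_pM ?sin_max // phase_at_le.
move=> e e0.
pose M := \int[sp_measure X]_j (`|amplitude j| * sp_size j ^+ 2).
have M0 : 0 <= M.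
  by apply: Rintegral_ge0 => j _; rewrite mulr_ge0 // exprn_ge0.
have e'0 : 0 < e / (M + 1) by rewrite divr_gt0 // ltr_wpDl.
near=> h.
rewrite (@le_trans _ _ (M * `|h| ^+ 2)) //; last first.
  have he : `|h| <= e / (M + 1) by near: h; exact: (@nbhs0_le R E).
  rewrite expr2 mulrA ler_wpM2r // (le_trans (ler_wpM2l M0 he)) //.
  rewrite mulrCA; apply: ler_piMr; first exact: ltW.
  by rewrite ler_pdivrMr ?ltr_wpDl // mul1r lerDl.
rewrite [X in _ - X]osc_derivE /osc.
have i1 := integrable_cos X th (w + h); have i2 := integrable_cos X th w.
have i3 := integrable_osc_deriv X th w h.
have i12 := integrableB measurableT i1 i2.
have i123 := integrableB measurableT i12 i3.
rewrite -RintegralB // -RintegralB // (le_trans (le_normr_Rintegral _ _)) //.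
rewrite /M -RintegralZr //; last exact: integrable_moment_abs.
apply: le_Rintegral => //; first exact/integrable_norm.
  exact: (integrableZr measurableT _ (integrable_moment_abs _ _)).
move=> j _; rewrite -mulrBr -mulrBr normrM -mulrA ler_wpM2l //.
rewrite phase_atD (addrAC (phase_at w j)) mulrN opprK.
rewrite (le_trans (cos_quadratic _ _)) // -exprMn -real_normK ?num_real //.
by rewrite ler_pXn2r ?nnegrE ?mulr_ge0 // phase_at_le.
Unshelve. all: by end_near. Qed.

End TrigIntegral.

(** * Products of wave integrals *)

Section ProductIntegral.
Context {R : realType} d1 d2 (T1 : measurableType d1) (T2 : measurableType d2).
Variables (m1 : {sigma_finite_measure set T1 -> \bar R}).
Variables (m2 : {sigma_finite_measure set T2 -> \bar R}).
Variables (f : T1 -> R) (g : T2 -> R).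
Hypotheses (intf : m1.-integrable setT (EFin \o f)) (intg : m2.-integrable setT (EFin \o g)).

Let measurable_f : measurable_fun setT f.
Proof. by apply/measurable_EFinP; exact: measurable_int intf. Qed.

Let measurable_g : measurable_fun setT g.
Proof. by apply/measurable_EFinP; exact: measurable_int intg. Qed.

Lemma integrable_tensor :
  (m1 \x m2)%E.-integrable setT (EFin \o (fun z : T1 * T2 => f z.1 * g z.2)).
Proof.
have mfg : measurable_fun setT (EFin \o (fun z : T1 * T2 => f z.1 * g z.2)).
  apply/measurable_EFinP/measurable_funM.
    exact: measurableT_comp measurable_f measurable_fst.
  exact: measurableT_comp measurable_g measurable_snd.
apply/integrable12ltyP => //=.
rewrite (_ : (fun x => _) = (fun x => `|f x|%:E * \int[m2]_y `|g y|%:E)%E); last first.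
  apply/funext => x; rewrite -ge0_integralZl //=.
  - by apply: eq_integral => y _; rewrite normrM EFinM.
  - exact/measurable_EFinP/measurableT_comp.
have /integrableP[_] := intg; have /integrableP[_] := intf => /= fI gI.
rewrite ge0_integralZr //=; last 2 first.
  exact/measurable_EFinP/measurableT_comp.
  exact: integral_ge0.
by rewrite lte_mul_pinfty // ?integral_ge0 // ge0_fin_numE // integral_ge0.
Qed.

Lemma Rintegral_tensor :
  \int[(m1 \x m2)%E]_z (f z.1 * g z.2) = (\int[m1]_x f x) * (\int[m2]_y g y).
Proof.
rewrite -RintegralZr // /Rintegral; congr fine.
rewrite -[LHS](integral12_prod_meas1 integrable_tensor).
apply: eq_integral => x _; rewrite /fubini_F /= EFinM fineK; last exact: integrable_fin_num.
rewrite -integralZl //; apply: eq_integral => y _.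
Qed.

End ProductIntegral.

Section SigmaFinite.
Local Open Scope ereal_scope.
Context {R : realType}.

Section Pack.
Context d (T : measurableType d) (mu : {measure set T -> \bar R}).

(** An alias of the measure that carries the proof of sigma-finiteness, so that products of the
    measures of two spectra can serve as [sp_measure] again. *)
Definition sigma_finite_pack & sigma_finite setT mu : set T -> \bar R := mu.

Variable h : sigma_finite setT mu.
HB.instance Definition _ := Measure.copy (sigma_finite_pack h) mu.
HB.instance Definition _ := Measure_isSigmaFinite.Build _ _ _ (sigma_finite_pack h) h.

End Pack.

Lemma sigma_finite_product d1 d2 (T1 : measurableType d1) (T2 : measurableType d2)
  (m1 : {sigma_finite_measure set T1 -> \bar R})
  (m2 : {sigma_finite_measure set T2 -> \bar R}) : sigma_finite setT (m1 \x m2).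
Proof.
have /sigma_finiteP[F [TF ndF Foo]] := sigma_finiteT m1.
have /sigma_finiteP[G [TG ndG Goo]] := sigma_finiteT m2.
(* Both exhaustions are nondecreasing, so the diagonal rectangles already cover the product. *)
exists (fun n => F n `*` G n) => [|k].
  apply/esym/seteqP; split=> // -[x y] _.
  have [[n _ Fx] [k _ Gy]] : (\bigcup_n F n) x /\ (\bigcup_n G n) y by rewrite -TF -TG.
  exists (maxn n k) => //; split=> /=.
    by apply: subsetPset Fx; apply: ndF; exact: leq_maxl.
  by apply: subsetPset Gy; apply: ndG; exact: leq_maxr.
have [mF Fk] := Foo k; have [mG Gk] := Goo k; split; first exact: measurableX.
by rewrite product_measure1E // lte_mul_pinfty // ge0_fin_numE.
Qed.

End SigmaFinite.

Section TrigAlgebra.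
Context {R : realType} {l : nat}.
Local Notation E := (R^o * 'rV[R]_l)%type.
Local Notation spectrum := (@spectrum R l).
Local Notation zv q := (@zvec R l q).

Lemma measurable_invr (S : set R) : measurable S -> measurable_fun S (@GRing.inv R).
Proof.
move=> mS; apply: (@measurable_funS _ _ _ _ setT) => //.
rewrite -(setUv [set (0 : R)]); apply/measurable_funU => //; [exact: measurableC|split].
  move=> _ Y _; have [Y0|Y0] := pselect (Y 0).
    rewrite (_ : _ `&` _ = [set 0]) //; apply/seteqP; split=> [x []//|x /= ->].
    by split=> //=; rewrite invr0.
  rewrite (_ : _ `&` _ = set0) //; apply/seteqP; split=> x //= [->].
  by rewrite invr0.
apply: open_continuous_measurable_fun.
  exact/closed_openC/accessible_closed_set1/hausdorff_accessible/Rhausdorff.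
by move=> x; rewrite inE /= => /eqP x0; exact: inv_continuous.
Qed.

Section Tensor.
(* The two terms of 2 cos a cos b = cos (a + b) + cos (a - b); s selects the difference. *)
Variables (X Y : spectrum) (s : bool).
Local Notation J := (sp_index X * sp_index Y)%type.

Definition sum_freq (q q' : 'rV[int]_l) : 'rV[int]_l := if s then q - q' else q + q'.
Definition sum_time (p p' : R) : R := if s then p - p' else p + p'.

Lemma zvec_sum_freq q q' i :
  zv (sum_freq q q') 0 i = sum_time (zv q 0 i) (zv q' 0 i).
Proof. by rewrite /sum_freq /sum_time; case: s; rewrite !mxE ?intrD ?mulrNz ?intrB. Qed.

Lemma norm_sum_time p p' : `|sum_time p p'| <= `|p| + `|p'|.
Proof. by rewrite /sum_time; case: s; [exact: ler_normB|exact: ler_normD]. Qed.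

Lemma freq_size_sum p p' q q' :
  freq_size (sum_time p p') (sum_freq q q') <= freq_size p q * freq_size p' q'.
Proof.
rewrite /freq_size.
have : \sum_i `|zv (sum_freq q q') 0 i| <= \sum_i `|zv q 0 i| + \sum_i `|zv q' 0 i|.
  rewrite -big_split /=; apply: ler_sum => i _.
  by rewrite zvec_sum_freq norm_sum_time.
have := norm_sum_time p p'.
have Q : 0 <= \sum_i `|zv q 0 i| by rewrite sumr_ge0.
have Q' : 0 <= \sum_i `|zv q' 0 i| by rewrite sumr_ge0.
have := normr_ge0 p; have := normr_ge0 p'; move: Q Q'.
move: (\sum_i `|zv q 0 i|) (\sum_i `|zv q' 0 i|) (\sum_i `|zv _ 0 i|) => a b c.
by move: `|p| `|p'| `|_| => x y z; nra.
Qed.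

Definition tensor_amplitude (j : J) := amplitude j.1 * amplitude j.2 / 2.
Definition tensor_time (j : J) := sum_time (time_freq j.1) (time_freq j.2).
Definition tensor_freq (j : J) := sum_freq (space_freq j.1) (space_freq j.2).

Lemma measurable_pair_fun (f : sp_index X -> R) (g : sp_index Y -> R) :
  measurable_fun setT f -> measurable_fun setT g ->
  (measurable_fun setT (fun j : J => f j.1)) * (measurable_fun setT (fun j : J => g j.2)).
Proof.
move=> mf mg; split; first exact: measurableT_comp mf measurable_fst.
exact: measurableT_comp mg measurable_snd.
Qed.

Lemma measurable_sum_time (f : sp_index X -> R) (g : sp_index Y -> R) :
  measurable_fun setT f -> measurable_fun setT g ->
  measurable_fun setT (fun j : J => sum_time (f j.1) (g j.2)).
Proof.
move=> mf mg; have [m1 m2] := measurable_pair_fun mf mg.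
by rewrite /sum_time; case: s; [exact: measurable_funB|exact: measurable_funD].
Qed.

Lemma measurable_tensor_amplitude : measurable_fun setT tensor_amplitude.
Proof.
have [m1 m2] := measurable_pair_fun (@measurable_amplitude _ _ X) (@measurable_amplitude _ _ Y).
by apply: measurable_funM => //; exact: measurable_funM.
Qed.

Lemma measurable_tensor_time : measurable_fun setT tensor_time.
Proof. by apply: measurable_sum_time; exact: measurable_time_freq. Qed.

Lemma measurable_tensor_freq i : measurable_fun setT (fun j => zv (tensor_freq j) 0 i).
Proof.
rewrite (_ : (fun _ => _) = fun j : J =>
    sum_time (zv (space_freq j.1) 0 i) (zv (space_freq j.2) 0 i)).
  by apply: (measurable_sum_time (f := fun j => zv (space_freq j) 0 i)
    (g := fun j => zv (space_freq j) 0 i)); exact: measurable_space_freq.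
by apply/funext => j; rewrite /tensor_freq zvec_sum_freq.
Qed.

Lemma integrable_tensor_moment m :
  (sp_measure X \x sp_measure Y)%E.-integrable setT (EFin \o (fun j : J =>
    tensor_amplitude j * freq_size (tensor_time j) (tensor_freq j) ^+ m)).
Proof.
apply: (@le_integrable _ _ _ _ _ measurableT _ (EFin \o (fun j : J =>
  (amplitude j.1 * sp_size j.1 ^+ m) * (amplitude j.2 * sp_size j.2 ^+ m)))).
- apply/measurable_EFinP/measurable_funM; first exact: measurable_tensor_amplitude.
  apply: measurable_funX;  apply: measurable_funD; first apply: measurable_funD => //.
    by apply: measurableT_comp => //; exact: measurable_tensor_time.
  by apply: measurable_sum => i; apply: measurableT_comp => //; exact: measurable_tensor_freq.
- move=> j _ /=; rewrite lee_fin /tensor_amplitude mulrACA -exprMn normrM [leRHS]normrM.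
  apply: ler_pM => //.
    by rewrite normrM ler_piMr // ger0_norm // invf_le1 // ler1n.
  rewrite !normrX lerXn2r ?nnegrE // !ger0_norm ?mulr_ge0 ?freq_size_ge0 //.
  exact: freq_size_sum.
- exact: (integrable_tensor (integrable_moment X m) (integrable_moment Y m)).
Qed.

Definition tensor_spectrum : spectrum :=
  @Spectrum R l _ (sp_index X * sp_index Y)%type
    (sigma_finite_pack (sigma_finite_product (sp_measure X) (sp_measure Y))) tensor_amplitude tensor_time tensor_freq
    measurable_tensor_amplitude measurable_tensor_time measurable_tensor_freq
    integrable_tensor_moment.

Lemma phase_at_tensor w (j : sp_index tensor_spectrum) :
  phase_at w j = sum_time (phase_at w j.1) (phase_at w j.2).
Proof.
rewrite /phase_at /dot /= /tensor_time /tensor_freq.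
under eq_bigr do rewrite zvec_sum_freq.
rewrite /sum_time; case: s.
  by under eq_bigr do rewrite mulrBl; rewrite sumrB; ring.
by under eq_bigr do rewrite mulrDl; rewrite big_split /=; ring.
Qed.

End Tensor.

Lemma osc_mul X Y th th' w :
  osc X th w * osc Y th' w =
  osc (tensor_spectrum X Y false) (th + th') w + osc (tensor_spectrum X Y true) (th - th') w.
Proof.
rewrite /osc -RintegralD //; last exact: (@integrable_cos _ _ (tensor_spectrum X Y true)).
  2: exact: (@integrable_cos _ _ (tensor_spectrum X Y false)).
rewrite -Rintegral_tensor; try exact: integrable_cos.
congr fine; apply: eq_integral => j _; congr (_ %:E).
rewrite !phase_at_tensor /= /tensor_amplitude /sum_time.
set a := phase_at w j.1; set b := phase_at w j.2.
rewrite (_ : a + b + _ = (a + th) + (b + th')); last by ring.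
rewrite (_ : a - b + _ = (a + th) - (b + th')); last by ring.
move: (a + th) (b + th') => a' b'.
by rewrite cosD cosB; field.
Qed.

(** Finite sums are needed because a product of two waves has two terms. The closure properties
    below make this an algebra of bounded smooth functions, periodic in the angles and stable under
    directional derivatives. *)
Definition in_span (h : E -> R^o) : Prop :=
  exists s : seq (spectrum * R), h = fun w => \sum_(i <- s) osc i.1 i.2 w.

Lemma in_span_osc X th : in_span (osc X th).
Proof. by exists [:: (X, th)]; apply/funext => w; rewrite big_seq1. Qed.

Lemma in_spanD h k : in_span h -> in_span k -> in_span (fun w => h w + k w).
Proof.
by move=> [s ->] [t ->]; exists (s ++ t); apply/funext => w; rewrite big_cat.
Qed.

Lemma in_span0 : in_span (fun=> 0).
Proof. by exists [::]; apply/funext => w; rewrite big_nil. Qed.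

Lemma in_span_sum I (s : seq I) (P : pred I) (h : I -> E -> R^o) :
  (forall i, P i -> in_span (h i)) -> in_span (fun w => \sum_(i <- s | P i) h i w).
Proof.
move=> H; elim: s => [|i s IH].
  have -> : (fun w => \sum_(i <- [::] | P i) h i w) = fun=> 0.
    by apply/funext => w; rewrite big_nil.
  exact: in_span0.
have -> : (fun w => \sum_(j <- i :: s | P j) h j w) =
    fun w => (if P i then h i w else 0) + \sum_(j <- s | P j) h j w.
  by apply/funext => w; rewrite big_cons; case: ifP; rewrite ?add0r.
by apply: in_spanD => //; case Pi: (P i); [exact: H|exact: in_span0].
Qed.

Lemma in_spanM h k : in_span h -> in_span k -> in_span (fun w => h w * k w).
Proof.
move=> [s ->] [t ->].
rewrite (_ : (fun w => _ * _) = fun w =>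
    \sum_(i <- s) \sum_(j <- t) (osc i.1 i.2 w * osc j.1 j.2 w)); last first.
  by apply/funext => w; rewrite mulr_suml; apply: eq_bigr => i _; rewrite mulr_sumr.
apply: in_span_sum => i _; apply: in_span_sum => j _.
rewrite (_ : (fun w => _) = fun w => osc (tensor_spectrum i.1 j.1 false) (i.2 + j.2) w +
    osc (tensor_spectrum i.1 j.1 true) (i.2 - j.2) w); last first.
  by apply/funext => w; exact: osc_mul.
by apply: in_spanD; exact: in_span_osc.
Qed.

Lemma in_span_bounded h : in_span h -> exists C, forall w, `|h w| <= C.
Proof.
move=> [s ->]; elim: s => [|i s [C IH]].
  by exists 0 => w; rewrite big_nil normr0.
exists (\int[sp_measure i.1]_j `|amplitude j| + C) => w; rewrite big_cons.
by rewrite (le_trans (ler_normD _ _)) // lerD // osc_le.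
Qed.

Lemma in_span_periodic h : in_span h ->
  forall s x (k : 'rV[int]_l), h (s, x + (2 * pi) *: zv k) = h (s, x).
Proof. by move=> [t ->] s x k; apply: eq_bigr => i _; rewrite osc_periodic. Qed.

Lemma in_span_is_diff (s : seq (spectrum * R)) w :
  is_diff w (fun w => \sum_(i <- s) osc i.1 i.2 w : R^o)
    (fun v => \sum_(i <- s) osc_deriv i.1 i.2 w v).
Proof.
elim: s => [|i s IH].
  have -> : (fun w => \sum_(i <- [::]) osc i.1 i.2 w) = (cst 0 : E -> R^o).
    by apply/funext => u; rewrite big_nil.
  have -> : (fun v => \sum_(i <- [::]) osc_deriv i.1 i.2 w v) = (0 : E -> R^o).
    by apply/funext => u; rewrite big_nil.
  exact: is_diff_cst.
have -> : (fun w => \sum_(j <- i :: s) osc j.1 j.2 w) =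
    (osc i.1 i.2 : E -> R^o) + (fun w => \sum_(j <- s) osc j.1 j.2 w).
  by apply/funext => u; rewrite big_cons.
have -> : (fun v => \sum_(j <- i :: s) osc_deriv j.1 j.2 w v) =
    (osc_lin i.1 i.2 w : E -> R^o) + (fun v => \sum_(j <- s) osc_deriv j.1 j.2 w v).
  by apply/funext => u; rewrite big_cons.
have H := osc_is_diff i.1 i.2 w.
exact: is_diffD.
Qed.

Lemma in_span_differentiable h : in_span h -> forall w, differentiable h w.
Proof. by move=> [s ->] w; have [] := in_span_is_diff s w. Qed.

Lemma in_span_derive h v : in_span h -> in_span (fun w => 'D_v h w : R^o).
Proof.
move=> [s ->].
rewrite (_ : (fun w => _) = fun w =>
    \sum_(i <- s) osc (deriv_spectrum i.1 v) (i.2 + pi / 2) w); last first.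
  apply/funext => w; have [df dE] := in_span_is_diff s w.
  by rewrite deriveE // dE.
by apply: in_span_sum => i _; exact: in_span_osc.
Qed.

Section Dirac.
Variables (q : 'rV[int]_l) (c : R).

Lemma integrable_dirac m : (\d_tt : {measure set unit -> \bar R}).-integrable setT
  (EFin \o (fun j : unit => c * freq_size 0 q ^+ m)).
Proof.
apply: (@finite_measure_integrable_cst _ _ _ \d_tt) => //.
Qed.

Lemma sigma_finite_dirac_unit : sigma_finite setT (\d_tt : {measure set unit -> \bar R}).
Proof. exact: sigma_finiteT. Qed.

Definition dirac_spectrum : spectrum :=
  @Spectrum R l _ unit (sigma_finite_pack sigma_finite_dirac_unit)
    (fun=> c) (fun=> 0) (fun=> q) (measurable_cst _) (measurable_cst _)
    (fun i => measurable_cst _) integrable_dirac.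

Lemma osc_dirac th w : osc dirac_spectrum th w = c * cos (dot (zv q) w.2 + th).
Proof.
rewrite /osc /Rintegral /= [X in fine X](@integral_dirac _ unit tt R setT) //=.
by rewrite indicT mul1r /phase_at /= mul0r add0r.
Qed.

End Dirac.

Lemma in_span_cst c : in_span (fun=> c).
Proof.
have -> : (fun=> c) = (osc (dirac_spectrum 0 c) 0 : E -> R^o).
  apply/funext => w; rewrite osc_dirac addr0 /dot big1 ?cos0 ?mulr1 // => i _.
  by rewrite !mxE mul0r.
exact: in_span_osc.
Qed.

(** Serves for the Cartesian coordinates of the transformation: an angle is not a periodic function,
    but its cosine is, and the phase [pi / 2] yields the sine. *)
Lemma in_span_cos_angle i th : in_span (fun w : E => cos (w.2 0 i + th)).
Proof.
have -> : (fun w : E => cos (w.2 0 i + th)) =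
    (osc (dirac_spectrum (delta_mx 0 i) 1) th : E -> R^o).
  apply/funext => w; rewrite osc_dirac mul1r /dot (bigD1 i) //= big1 ?addr0.
    by rewrite !mxE !eqxx mul1r.
  by move=> k ki; rewrite !mxE (negbTE ki) andbF mul0r.
exact: in_span_osc.
Qed.

(** * The cohomological equation with small divisors *)

Section SmallDivisors.
Variables (omega : 'rV[R]_l) (C : R) (n : nat).
Hypothesis small_divisors : forall q : 'rV[int]_l, q != 0 ->
  dot omega (zv q) != 0 /\ `|dot omega (zv q)|^-1 <= C * freq_size 0 q ^+ n.

Variable X : spectrum.
Local Notation den j := (dot omega (zv (space_freq j))).

Lemma measurable_den : measurable_fun setT (fun j : sp_index X => den j).
Proof.
apply: measurable_sum => i; apply: measurable_funM => //.
exact: measurable_space_freq.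
Qed.

Lemma measurable_den_neq0 : measurable_fun setT (fun j : sp_index X => (den j != 0)%:R : R).
Proof.
have -> : (fun j : sp_index X => (den j != 0)%:R : R) = fun j => if den j == 0 then 0 else 1.
  by apply/funext => j; case: eqP.
by apply: measurable_fun_ifT => //; apply: measurable_fun_eqr => //; exact: measurable_den.
Qed.

Lemma den_eq0 (j : sp_index X) : (den j == 0) = (space_freq j == 0).
Proof.
apply/eqP/eqP => [d0|->]; last first.
  by rewrite /dot big1 // => i _; rewrite !mxE mulr0.
by apply/eqP; apply/negPn/negP => /small_divisors [/eqP].
Qed.

(* The mean keeps the waves with space frequency 0, the primitive divides the
   amplitude of the others by <omega, q>, integrating cos being a shift of
   the phase by - pi / 2. *)
Definition mean_amplitude (j : sp_index X) := amplitude j * (1 - (den j != 0)%:R).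
Definition prim_amplitude (j : sp_index X) := amplitude j * ((den j != 0)%:R * (den j)^-1).

Lemma measurable_prim_factor :
  measurable_fun setT (fun j : sp_index X => (den j != 0)%:R * (den j)^-1 : R).
Proof.
apply: measurable_funM; first exact: measurable_den_neq0.
apply: measurableT_comp; last exact: measurable_den.
exact: measurable_invr.
Qed.

Lemma measurable_mean_factor :
  measurable_fun setT (fun j : sp_index X => 1 - (den j != 0)%:R : R).
Proof. by apply: measurable_funB => //; exact: measurable_den_neq0. Qed.

Lemma integrable_mean m : (sp_measure X).-integrable setT
  (EFin \o (fun j => mean_amplitude j * freq_size (time_freq j) (0 : 'rV[int]_l) ^+ m)).
Proof.
rewrite (_ : (fun _ => _) = fun j => amplitude (s := X) j *
  ((1 - (den j != 0)%:R) * freq_size (time_freq j) (0 : 'rV[int]_l) ^+ m)); last first.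
  by apply/funext => j; rewrite mulrA.
apply: (@integrable_amplitude _ _ _ _ 1 m).
  apply: measurable_funM; first exact: measurable_mean_factor.
  apply: measurable_funX; apply: measurable_funD => //; apply: measurable_funD => //.
  by apply: measurableT_comp => //; exact: measurable_time_freq.
move=> j; rewrite normrM ler_pM //.
  by case: (_ != _); rewrite ?subrr ?subr0 ?normr0 ?normr1.
rewrite normrX lerXn2r ?nnegrE ?freq_size_ge0 // ger0_norm ?freq_size_ge0 //.
rewrite /sp_size /freq_size lerD2l big1 ?sumr_ge0 // => i _.
by rewrite !mxE normr0.
Qed.

(** The space frequency is set to 0 at every index, also where the amplitude vanishes, so that
    independence of the angles can be read off. *)
Definition mean_spectrum : spectrum :=
  @Spectrum R l _ _ (sp_measure X) mean_amplitude (@time_freq _ _ X) (fun=> 0)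
    (measurable_funM (@measurable_amplitude _ _ X) measurable_mean_factor)
    (@measurable_time_freq _ _ X) (fun=> measurable_cst _) integrable_mean.

(** Division by [<omega, q>] raises the order of the moment by [n], which is harmless since all
    moments are finite. *)
Lemma integrable_prim m : (sp_measure X).-integrable setT
  (EFin \o (fun j => prim_amplitude j * freq_size (time_freq j) (space_freq j) ^+ m)).
Proof.
rewrite (_ : (fun _ => _) = fun j => amplitude (s := X) j *
  ((den j != 0)%:R * (den j)^-1 * sp_size j ^+ m)); last first.
  by apply/funext => j; rewrite mulrA.
apply: (@integrable_amplitude _ _ _ _ `|C| (n + m)).
  apply: measurable_funM; first exact: measurable_prim_factor.
  exact/measurable_funX/measurable_sp_size.
move=> j; rewrite exprD mulrA normrM [X in _ * X]ger0_norm ?exprn_ge0 ?sp_size_ge0 //.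
rewrite ler_wpM2r ?exprn_ge0 ?sp_size_ge0 //.
have [d0|d0] := boolP (den j == 0).
  by rewrite mul0r normr0 mulr_ge0 ?exprn_ge0 ?sp_size_ge0.
rewrite mul1r normfV; have := d0; rewrite den_eq0 => /small_divisors [_ /le_trans]; apply.
rewrite (le_trans (ler_wpM2r _ (ler_norm C))) ?exprn_ge0 ?freq_size_ge0 //.
rewrite ler_wpM2l // lerXn2r ?nnegrE ?freq_size_ge0 ?sp_size_ge0 //.
by rewrite /sp_size /freq_size normr0 addr0 -addrA lerD2l lerDr.
Qed.

Definition prim_spectrum : spectrum :=
  @Spectrum R l _ _ (sp_measure X) prim_amplitude (@time_freq _ _ X) (@space_freq _ _ X)
    (measurable_funM (@measurable_amplitude _ _ X) measurable_prim_factor)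
    (@measurable_time_freq _ _ X) (@measurable_space_freq _ _ X) integrable_prim.

Lemma osc_cohomological th w :
  osc_deriv prim_spectrum (th - pi / 2) w (0, omega) = osc X th w - osc mean_spectrum th w.
Proof.
rewrite osc_derivE /osc -RintegralB //; last 2 first.
  exact: integrable_cos.
  exact: (@integrable_cos _ _ mean_spectrum).
congr fine; apply: eq_integral => j _; congr (_ %:E) => /=.
rewrite /phase_at /= /prim_amplitude /mean_amplitude mulr0 add0r.
rewrite addrA sinBpihalf opprK.
rewrite (_ : dot (zv (space_freq j)) omega = den j); last first.
  by apply: eq_bigr => i _; rewrite mulrC.
have [d0|d0] := boolP (den j == 0).
  have q0 : space_freq (j : sp_index X) = 0 by apply/eqP; rewrite -den_eq0.
  rewrite /= mul0r mulr0 mul0r subr0 mulr1 (_ : zv (space_freq _) = zv 0); last by rewrite -q0.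
  by rewrite subrr.
by rewrite subrr mulr0 mul0r subr0 mul1r -mulrA mulKf.
Qed.

End SmallDivisors.

(** A solution of the cohomological equation for [h]. The torus mean [b] enters through the equation
    and is not defined as an integral. *)
Definition mean_free_primitive (omega : 'rV[R]_l) (h : E -> R^o) (b : R -> R) (G : E -> R^o) :=
  [/\ in_span G, in_span (fun w => b w.1) &
      forall w, 'D_((0, omega) : E) G w = h w - b w.1].

Lemma in_span_cohomological omega C n h :
  (forall q : 'rV[int]_l, q != 0 ->
    dot omega (zv q) != 0 /\ `|dot omega (zv q)|^-1 <= C * freq_size 0 q ^+ n) ->
  in_span h -> exists b G, mean_free_primitive omega h b G.
Proof.
move=> sd [s ->].
exists (fun t => \sum_(i <- s) osc (mean_spectrum omega i.1) i.2 (t, 0)).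
exists (fun w => \sum_(i <- [seq (prim_spectrum sd i.1, i.2 - pi / 2) | i <- s]) osc i.1 i.2 w).
split; first by exists [seq (prim_spectrum sd i.1, i.2 - pi / 2) | i <- s].
- have -> : (fun w : E => \sum_(i <- s) osc (mean_spectrum omega i.1) i.2 (w.1, 0)) =
    (fun w => \sum_(i <- s) osc (mean_spectrum omega i.1) i.2 w).
    apply/funext => w; apply: eq_bigr => i _; congr fine; apply: eq_integral => j _.
    congr (_ * cos (_ + _))%:E; rewrite /phase_at /dot /= !big1 // => k _; rewrite !mxE ?mul0r //.
  by apply: in_span_sum => i _; exact: in_span_osc.
- move=> w; set t := [seq _ | _ <- s].
  have [df dE] := in_span_is_diff t w.
  rewrite deriveE // dE /t big_map -sumrB; apply: eq_bigr => i _ /=.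
  rewrite osc_cohomological; congr (_ - _).
  congr fine; apply: eq_integral => j _.
  congr (_ * cos (_ + _))%:E; rewrite /phase_at /dot /= !big1 // => k _; rewrite !mxE ?mul0r //.
Qed.

End TrigAlgebra.

(** * Formal solution of the homological equations *)

Section PeriodicMaximum.
Context {R : realType} {l : nat}.
Variable g : 'rV[R]_l -> R^o.
Hypothesis g_diff : forall x, differentiable g x.
Hypothesis g_per : forall x (k : 'rV[int]_l), g (x + (2 * pi) *: zvec k) = g x.

Lemma cube_compact : compact [set v : 'rV[R]_l | forall i, 0 <= v 0 i <= 2 * pi].
Proof.
have := @rV_compact R l (fun=> `[0, 2 * pi]%classic) (fun=> @segment_compact R 0 (2 * pi)).
by congr compact; apply/seteqP; split=> v /= H i; have := H i; rewrite in_itv.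
Qed.

Lemma mod_cube (x : 'rV[R]_l) : exists k : 'rV[int]_l,
  forall i, 0 <= (x + (2 * pi) *: zvec k) 0 i < 2 * pi.
Proof.
have p0 : 0 < 2 * pi :> R by rewrite mulr_gt0 // pi_gt0.
exists (\row_i - Num.floor (x 0 i / (2 * pi))) => i; rewrite !mxE.
have xE : x 0 i = 2 * pi * (x 0 i / (2 * pi)) by rewrite mulrC divfK // gt_eqF.
rewrite [X in X + _]xE -mulrDr intrN; apply/andP; split.
  by apply: mulr_ge0; [exact: ltW|rewrite subr_ge0 floor_le].
by rewrite gtr_pMr // ltrBlDr addrC; have := floorD1_gt (x 0 i / (2 * pi)); rewrite intrD.
Qed.

(** A maximum over one cube of periods is global by periodicity, hence a critical point even if it
    lies on a face of the cube. *)
Lemma periodic_max : exists c, (forall x, g x <= g c) /\ forall v, 'D_v g c = 0.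
Proof.
have [||c _ cmax] := @EVT_max_rV R l g _ _ cube_compact.
- by exists 0 => i /=; rewrite mxE lexx mulr_ge0 // pi_ge0.
- by apply: continuous_subspaceT => x; exact: differentiable_continuous.
have {}cmax x : g x <= g c.
  have [k xk] := mod_cube x; rewrite -(g_per x k); apply: cmax.
  by rewrite inE /= => i; have /andP[-> /ltW ->] := xk i.
exists c; split=> // v.
have dg t : derivable (fun h : R => g (h *: v + c)) t 1.
  apply/derivable1_diffP; apply: (@differentiable_comp _ _ _ _ (fun h : R^o => h *: v + c) g) => //.
have [_ E] : is_derive (0 : R) 1 (fun h : R => g (h *: v + c) : R) 0.
  apply: (@derive1_at_max R _ (-1) 1) => [|t _||t _]; [lra|by []|rewrite in_itv /=; lra|].
  by rewrite scale0r add0r; have := cmax (t *: v + c).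
rewrite -E /derive; set g1 := fun h => h^-1 *: _; set g2 := fun h => h^-1 *: _.
suff -> : g1 = g2 by [].
apply/funext => h; rewrite /g1 /g2 /=.
by rewrite addr0 scale0r add0r [_%:A]mulr1.
Qed.

End PeriodicMaximum.

Section CourseOfValues.
Variables (T : Type) (x0 : T) (F : nat -> (nat -> T) -> T).
Hypothesis F_local : forall k u v, (forall i, (i <= k)%N -> u i = v i) -> F k u = F k v.

(** Recursion in which step [k] may read [u 0] to [u k]. The auxiliary [g n] is a sequence that is
    correct up to [n]; [F_local] makes its later entries irrelevant. *)
Lemma course_of_values : exists u, u 0%N = x0 /\ forall k, u k.+1 = F k u.
Proof.
pose g := fix g n : nat -> T := if n is m.+1 then
  fun i => if (i <= m)%N then g m i else F m (g m) else fun=> x0.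
have gS n i : (i <= n)%N -> g n.+1 i = g n i by move=> /= ->.
have gg n i : (i <= n)%N -> g n i = g i i.
  elim: n => [|n IH]; first by rewrite leqn0 => /eqP ->.
  rewrite leq_eqVlt ltnS => /predU1P[->//|lin].
  by rewrite gS // IH.
exists (fun k => g k k); split=> // k /=; rewrite ltnn.
by apply: F_local => i ik; rewrite gg.
Qed.

End CourseOfValues.

(** * Coefficients of powers of formal series *)

Section TruncatedPowers.
Context {R : realType}.
Implicit Types (u v : nat -> R) (p q : {poly R}).

(** The coefficient of degree [n] in the [j]-th power of the formal series of [u]. Entries beyond
    [n] do not contribute, so a polynomial stands in for the series. *)
Definition pow_coef u n j : R := ((\poly_(i < n.+1) u i) ^+ j)`_n.

Lemma coef_exp_local p q j n : (forall i, (i <= n)%N -> p`_i = q`_i) ->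
  (p ^+ j)`_n = (q ^+ j)`_n.
Proof.
elim: j n => [|j IH] n H; first by rewrite !expr0.
rewrite !exprS !coefM; apply: eq_bigr => -[i /=]; rewrite ltnS => lin _.
by rewrite H // IH // => k kn; rewrite H // (leq_trans kn) // leq_subr.
Qed.

Lemma pow_coef_local u v n j : (forall i, (i <= n)%N -> u i = v i) ->
  pow_coef u n j = pow_coef v n j.
Proof.
move=> H; apply: coef_exp_local => i lin.
by rewrite !coef_poly ltnS lin H.
Qed.

Lemma pow_coefE u n N j : (n <= N)%N -> pow_coef u n j = ((\poly_(i < N.+1) u i) ^+ j)`_n.
Proof.
move=> nN; apply: coef_exp_local => i lin.
by rewrite !coef_poly !ltnS lin (leq_trans lin).
Qed.

Lemma coef_exp_small p j n : p`_0 = 0 -> (n < j)%N -> (p ^+ j)`_n = 0.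
Proof.
move=> p0; elim: j n => // j IH n nj.
rewrite exprS coefM big1 // => -[[|i] /= lin] _; first by rewrite p0 mul0r.
rewrite IH ?mulr0 //; lia.
Qed.

Lemma coef_exp_le p q j n : (forall i, `|p`_i| <= q`_i) -> `|(p ^+ j)`_n| <= (q ^+ j)`_n.
Proof.
move=> H; elim: j n => [|j IH] n; first by rewrite !expr0 coef1; case: eqP; rewrite ?normr1 ?normr0.
rewrite !exprS !coefM (le_trans (ler_norm_sum _ _ _)) // ler_sum // => i _.
by rewrite normrM ler_pM.
Qed.

Lemma pow_coef_le u v n j : (forall i, (i <= n)%N -> `|u i| <= v i) ->
  `|pow_coef u n j| <= pow_coef v n j.
Proof.
move=> H; apply: coef_exp_le => i; rewrite !coef_poly.
by case: ltnP => [/H//|_]; rewrite normr0.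
Qed.

Lemma horner_high p m e : (forall i, (i < m)%N -> p`_i = 0) -> `|e| <= 1 ->
  `|p.[e]| <= `|e| ^+ m * \sum_(i < size p) `|p`_i|.
Proof.
move=> p0 e1; rewrite horner_coef (le_trans (ler_norm_sum _ _ _)) // mulr_sumr.
apply: ler_sum => i _; rewrite normrM normrX mulrC.
have [im|mi] := ltnP i m; first by rewrite p0 // normr0 !mulr0.
by rewrite ler_wpM2r // -(subnKC mi) exprD ler_piMr ?exprn_ge0 // exprn_ile1.
Qed.

End TruncatedPowers.

Section MeanValueBound.
Context {R : realType}.

Lemma mean_value_bound (g dg : R -> R) (t B : R) :
  (forall c, `|c| <= `|t| -> is_derive (c : R) 1 (g : R -> R) (dg c)) ->
  (forall c, `|c| <= `|t| -> `|dg c| <= B) -> `|g t - g 0| <= B * `|t|.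
Proof.
move=> dgP dgB.
have [t0|t0] := leP 0 t.
  have inct c : c \in `[0, t] -> `|c| <= `|t|.
    by rewrite in_itv /= => /andP[c0 ct]; rewrite !ger0_norm.
  have [c /subset_itv_oo_cc/inct/dgP//||c ci ->] := @MVT_segment R g dg 0 t t0.
    by apply: derivable_within_continuous => c /inct/dgP [].
  by rewrite subr0 normrM ler_wpM2r // dgB // inct.
have inct c : c \in `[t, 0] -> `|c| <= `|t|.
  by rewrite in_itv /= => /andP[c0 ct]; rewrite !ler0_norm ?lerN2 // ltW.
have [c /subset_itv_oo_cc/inct/dgP//||c ci E] := @MVT_segment R g dg t 0 (ltW t0).
  by apply: derivable_within_continuous => c /inct/dgP [].
by rewrite distrC E sub0r normrM normrN ler_wpM2r // dgB // inct.
Qed.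

End MeanValueBound.

Lemma derive_slice (R : realType) (A B W : normedModType R) (f : A * B -> W) s x v :
  'D_v (fun x => f (s, x)) x = 'D_(0, v) f (s, x).
Proof.
rewrite /derive; set g1 := fun a => a^-1 *: _; set g2 := fun a => a^-1 *: _.
suff -> : g1 = g2 by [].
apply/funext => a; rewrite /g1 /g2 /=; congr (_ *: (f (_, _) - _)).
by rewrite /= scaler0 add0r.
Qed.

(** * The recursion at all orders *)

Section FormalSolution.
Context {R : realType} {l : nat}.
Local Notation E := (R^o * 'rV[R]_l)%type.
Implicit Types (h G : E -> R^o).

(* At a maximum of G (s, .) the derivative along omega vanishes, so b s is a value of h. *)
Lemma mean_bound omega h b G c : mean_free_primitive omega h b G ->
  (forall w, `|h w| <= c) -> forall s, `|b s| <= c.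
Proof.
move=> [spG _ DG] hc s.
have [x|x k|x [_ xmax]] := @periodic_max R l (fun x => G (s, x)).
- apply: (@differentiable_comp _ _ _ _ (fun x => (s, x) : E)).
    by apply: differentiable_pair => //; exact: differentiable_cst.
  exact: in_span_differentiable.
- exact: in_span_periodic.
have /eqP := xmax omega; rewrite derive_slice DG subr_eq0 => /eqP /= <-.
exact: hc.
Qed.

Definition dtime h : E -> R^o := fun w => 'D_((1, 0) : E) h w.

Definition taylor_coef h (j : nat) (w : E) : R := (j`!%:R)^-1 * iter j dtime h w.

Lemma in_span_iter h j : in_span h -> in_span (iter j dtime h).
Proof. by move=> hh; elim: j => // j IH; exact: in_span_derive. Qed.

Lemma in_spanZ c h : in_span h -> in_span (fun w => c * h w).
Proof. by move=> hh; apply: in_spanM => //; exact: in_span_cst. Qed.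

Lemma in_spanN h : in_span h -> in_span (fun w => - h w).
Proof.
move=> hh; have -> : (fun w => - h w) = fun w => -1 * h w.
  by apply/funext => w; rewrite mulN1r.
exact: in_spanZ.
Qed.

Lemma in_span_taylor_coef h j : in_span h -> in_span (taylor_coef h j).
Proof. by move=> hh; apply: in_spanZ; exact: in_span_iter. Qed.

Lemma is_derive_time h s x : in_span h ->
  is_derive (s : R) 1 (fun t : R => h (t, x) : R) (dtime h (s, x)).
Proof.
move=> hh; have dh := in_span_differentiable hh (s, x).
have /derivableP dv : derivable h (s, x) ((1, 0) : E) by exact: diff_derivable.
have shiftE : (fun a : R => a^-1 *: (((fun t : R => h (t, x) : R) \o shift s) (a *: 1) - h (s, x)))
   = fun a => a^-1 *: ((h \o shift (s, x)) (a *: ((1, 0) : E)) - h (s, x)).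
  by apply/funext => a; congr (_ *: (h (_, _) - _)); rewrite /= scaler0 add0r.
split; first by rewrite /derivable shiftE; exact: ex_derive.
by rewrite /derive shiftE.
Qed.

(** The constant is uniform in time, increment and angles. Induction on [n]: the derivative in [t]
    of the remainder of order [n + 1] of [h] is the remainder of order [n] of [dtime h], and the
    mean value theorem adds one power of [t]. *)
Lemma taylor_span h n : in_span h -> exists C, 0 <= C /\ forall s t x,
  `|h (s + t, x) - \sum_(j < n) taylor_coef h j (s, x) * t ^+ j| <= C * `|t| ^+ n.
Proof.
elim: n h => [|n IH] h hh.
  have [C HC] := in_span_bounded hh; exists C; split; first exact: le_trans (HC 0).
  by move=> s t x; rewrite big_ord0 subr0 expr0 mulr1.
have [C [C0 HC]] := IH _ (in_span_derive ((1, 0) : E) hh).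
exists C; split=> // s t x.
pose p : {poly R} := \poly_(j < n.+1) taylor_coef h j (s, x).
pose g u := h (s + u, x) - p.[u].
have g0 : g 0 = 0.
  rewrite /g addr0 horner_coef0 coef_poly /= /taylor_coef fact0 invr1 mul1r /=.
  by rewrite subrr.
pose dg u := dtime h (s + u, x) - p^`().[u].
have dgP u : is_derive (u : R) 1 (g : R -> R) (dg u).
  apply: is_deriveB.
  have := @is_derive1_comp R (fun t => h (t, x)) (fun u => s + u) u (dtime h (s + u, x)) 1.
  rewrite mulr1; apply; first exact: is_derive_time.
  by rewrite -[X in is_derive _ _ _ X]add0r; apply: is_deriveD.
have := @mean_value_bound R g dg t (C * `|t| ^+ n) (fun u _ => dgP u).
rewrite g0 subr0 exprSr mulrA /g horner_poly; apply => c ct.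
apply: (@le_trans _ _ (C * `|c| ^+ n)); last by rewrite ler_wpM2l // lerXn2r ?nnegrE.
apply: le_trans (HC s c x); rewrite /dg le_eqVlt; apply/orP; left; apply/eqP.
congr (`| _ - _|).
have -> : p^`() = \poly_(j < n) taylor_coef (dtime h) j (s, x).
  apply/polyP => j; rewrite coef_deriv !coef_poly ltnS; case: ltnP => // _; last by rewrite mul0rn.
  rewrite /taylor_coef -iterSr factS; move: (iter _ _ _ _) => y.
  rewrite -mulrnAl -mulr_natl natrM invfM mulrA mulfV ?mul1r //.
by rewrite horner_poly.
Qed.

Lemma in_span_poly_exp (u : nat -> E -> R^o) m j n : (forall i, in_span (u i)) ->
  in_span (fun w => ((\poly_(i < m) u i w) ^+ j)`_n).
Proof.
move=> hu; elim: j n => [|j IH] n.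
  by under eq_fun do rewrite expr0; exact: in_span_cst.
have -> : (fun w => ((\poly_(i < m) u i w) ^+ j.+1)`_n) =
    fun w => \sum_(k < n.+1) (\poly_(i < m) u i w)`_k * ((\poly_(i < m) u i w) ^+ j)`_(n - k).
  by apply/funext => w; rewrite exprS coefM.
apply: in_span_sum => k _; apply: in_spanM => //.
under eq_fun do rewrite coef_poly.
by case: ltnP => _; [exact: hu|exact: in_span_cst].
Qed.

Variable omega : 'rV[R]_l.
Local Notation dw := ((0, omega) : E).

(* [e^k] of the Taylor expansion of h (w.1 + sum_i u_i e^i, w.2). *)
Definition recursion_coef h (u : nat -> R) k w : R :=
  \sum_(j < k.+1) taylor_coef h j w * pow_coef u k j.

(** The last clause is the bound of a mean by a supremum, in the form used by the majorant; it is
    the only quantitative information that is recorded. *)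
Definition formal_solution h (b : nat -> R -> R) (S : nat -> E -> R^o) :=
  [/\ forall k, in_span (S k), forall k, in_span (fun w : E => b k w.1), S 0%N = (fun=> 0 : R^o),
    forall k w, 'D_dw (S k.+1) w =
      b k.+1 w.1 - recursion_coef h (fun i => 'D_dw (S i) w) k w &
    forall k c, (forall w, `|recursion_coef h (fun i => 'D_dw (S i) w) k w| <= c) ->
      forall s, `|b k.+1 s| <= c].

Lemma in_span_recursion_coef h S k : in_span h -> (forall i, in_span (S i)) ->
  in_span (fun w => recursion_coef h (fun i => 'D_dw (S i) w) k w).
Proof.
move=> hh hS; apply: in_span_sum => j _; apply: in_spanM; first exact: in_span_taylor_coef.
by apply: in_span_poly_exp => i; exact: in_span_derive.
Qed.

Lemma recursion_coef_local h u v k w : (forall i, (i <= k)%N -> u i = v i) ->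
  recursion_coef h u k w = recursion_coef h v k w.
Proof. by move=> uv; apply: eq_bigr => j _; rewrite (pow_coef_local _ uv). Qed.

Lemma formal_solution_exists C n h :
  (forall q : 'rV[int]_l, q != 0 -> dot omega (@zvec R l q) != 0 /\
     `|dot omega (@zvec R l q)|^-1 <= C * freq_size 0 q ^+ n) ->
  in_span h -> exists b S, formal_solution h b S.
Proof.
move=> sd hh.
pose T := ((R -> R) * {G : E -> R^o | in_span G})%type.
pose z0 : T := (fun=> 0, exist _ (fun=> 0) (in_span_cst 0)).
pose rhs k (u : nat -> T) w := - recursion_coef h (fun i => 'D_dw (sval (u i).2) w) k w.
have ex k (u : nat -> T) : exists p : T, mean_free_primitive omega (rhs k u) p.1 (sval p.2).
  have [] := @in_span_cohomological R l omega C n (rhs k u) sd.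
    apply: in_spanN; apply: (@in_span_recursion_coef h (fun i => sval (u i).2)) => // i.
    exact: svalP.
  move=> b [G H]; have [spG _ _] := H.
  by exists (b, exist _ G spG).
(* The choice depends on the right-hand side alone; two histories that agree up to [k] give equal
   right-hand sides, hence equal choices. *)
pose ch f : T := if pselect (exists p : T, mean_free_primitive omega f p.1 (sval p.2))
  is left H then projT1 (cid H) else z0.
have chP k u : mean_free_primitive omega (rhs k u) (ch (rhs k u)).1 (sval (ch (rhs k u)).2).
  by rewrite /ch; case: pselect => [H|/(_ (ex k u))//]; case: cid.
have [|u [u0 uS]] := @course_of_values T z0 (fun k u => ch (rhs k u)).
  move=> k u v uv; congr ch; apply/funext => w; congr (- _).
  by apply: recursion_coef_local => i ik; rewrite uv.
(* [rhs] carries a minus sign, so its mean is minus the coefficient of the normal form. *)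
exists (fun k s => - (u k).1 s), (fun k => sval (u k).2).
split=> [k|k||k w|k c kc s].
- exact: svalP.
- apply: in_spanN; case: k => [|k]; first by rewrite u0; exact: in_span_cst.
  by rewrite uS; have [_] := chP k u.
- by rewrite u0.
- by rewrite uS; have [_ _ ->] := chP k u; rewrite addrC.
- rewrite normrN uS; apply: (mean_bound (chP k u)) => w; rewrite normrN; exact: kc.
Qed.

(** * The error of the truncated solution *)

Section Residual.
Variables (h : E -> R^o) (b : nat -> R -> R) (S : nat -> E -> R^o).
Hypotheses (hh : in_span h) (sol : formal_solution h b S).

Let sigma k w : R := 'D_dw (S k) w.
Definition truncated_slope N e w : R := \sum_(k < N.+1) e ^+ k * 'D_dw (S k) w.

Let sigma_span k : in_span (sigma k).
Proof. by have [spS _ _ _ _] := sol; exact: in_span_derive. Qed.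

Let sigma0 w : sigma 0 w = 0.
Proof.
have [_ _ S0 _ _] := sol; rewrite /sigma S0; exact: derive_cst.
Qed.

Lemma truncated_slope_small N : exists C, 0 <= C /\ forall e w, `|e| <= 1 ->
  `|truncated_slope N e w| <= C * `|e|.
Proof.
have bd k : exists C, forall w, `|sigma k w| <= C by exact: in_span_bounded.
pose c k := sval (cid (bd k)).
have cP k w : `|sigma k w| <= c k by exact: (svalP (cid (bd k))).
have c0 k : 0 <= c k by exact: le_trans (cP k 0).
exists (\sum_(k < N.+1) c k); split; first by rewrite sumr_ge0.
move=> e w e1; rewrite mulr_suml (le_trans (ler_norm_sum _ _ _)) // ler_sum // => -[[|k] /= kN] _.
  by rewrite [X in _ * X]sigma0 mulr0 normr0 mulr_ge0.
rewrite normrM mulrC ler_pM //; first exact: cP.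
by rewrite normrX exprS ler_piMr // exprn_ile1.
Qed.

(** The difference splits into a polynomial in [e], whose coefficients up to degree [N] vanish by
    the homological equations, and [e] times a Taylor remainder of order [N + 1] in the slope, which
    is itself of order [e]. *)
Lemma residual_bound N : exists C, forall e w, `|e| <= 1 ->
  `|w.1 + truncated_slope N e w + e * h (w.1 + truncated_slope N e w, w.2)
    - (w.1 + \sum_(1 <= k < N.+1) b k w.1 * e ^+ k)| <= C * `|e| ^+ N.+1.
Proof.
have [spS spb S0 Seq _] := sol.
have [C1 [C10 HC1]] := truncated_slope_small N.
have [C2 [C20 HC2]] := taylor_span N.+1 hh.
(* As polynomials in [e]: [P] is the truncation of [D], [W] the Taylor polynomial of the potential
   at [s + D], and [Q] the residual. *)
pose P w := \poly_(i < N.+1) sigma i w.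
pose W w := \sum_(j < N.+1) taylor_coef h j w *: P w ^+ j.
pose Q w := P w + 'X * W w - \poly_(k < N.+1) (if k == 0%N then 0 else b k w.1).
have QE e w : (Q w).[e] = truncated_slope N e w
   + e * (\sum_(j < N.+1) taylor_coef h j w * truncated_slope N e w ^+ j)
   - \sum_(1 <= k < N.+1) b k w.1 * e ^+ k.
  have PE : (P w).[e] = truncated_slope N e w.
    by rewrite horner_poly; apply: eq_bigr => i _; rewrite mulrC.
  rewrite /Q !hornerE PE horner_poly big_ord_recl /= mul0r add0r.
  rewrite big_add1 /= big_mkord; congr (_ + _ * _ - _).
  by rewrite horner_sum; apply: eq_bigr => j _; rewrite !hornerE PE.
have Qlow w i : (i < N.+1)%N -> (Q w)`_i = 0.
  move=> iN; have iN' := iN; rewrite /Q coefB coefD coefXM !coef_poly iN.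
  case: i iN iN' => [|i] iN iN' /=; first by rewrite sigma0 !addr0 subrr.
  rewrite [sigma _ _]Seq (_ : (W w)`_i = recursion_coef h (sigma ^~ w) i w); first by rewrite subrK subrr.
  rewrite coef_sum /recursion_coef.
  (* [recursion_coef] stops at [j = i]; the higher powers present in [W] do not reach degree [i]
     because [D] has no constant term. *)
  rewrite (big_ord_widen N.+1 (fun j => taylor_coef h j w * pow_coef (sigma ^~ w) i j)); last exact: ltnW.
  rewrite [RHS]big_mkcond; apply: eq_bigr => j _ /=.
  rewrite coefZ; case: ltnP => [_|ij]; first by rewrite (pow_coefE _ _ (N := N)) // ltnW.
  by rewrite coef_exp_small ?mulr0 // coef_poly /= sigma0.
(* A degree bound that does not depend on [w], so that finitely many bounds of coefficients add up
   to one constant. *)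
have [m Qsize] : exists m, forall w, (size (Q w) <= m)%N.
  exists ((N * N).+2 + N.+1)%N => w.
  have sP j : (size (P w ^+ j) <= (N * j).+1)%N.
    rewrite (leq_trans (size_poly_exp_leq _ _)) // ltnS leq_mul2r.
    by have := size_poly N.+1 (sigma ^~ w); rewrite -/(P w); lia.
  have sW : (size (W w) <= (N * N).+1)%N.
    rewrite (leq_trans (size_sum _ _ _)) //; apply/bigmax_leqP => j _.
    rewrite (leq_trans (size_scale_leq _ _)) // (leq_trans (sP _)) // ltnS leq_mul2l.
    by rewrite -ltnS ltn_ord orbT.
  have sX : (size ('X * W w)%R <= (N * N).+2)%N.
    rewrite (leq_trans (size_polyMleq _ _)) // size_polyX; lia.
  rewrite /Q (leq_trans (size_polyD _ _)) // size_polyN geq_max.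
  rewrite !(leq_trans (size_poly _ _)) ?leq_addl // andbT.
  rewrite (leq_trans (size_polyD _ _)) // geq_max !(leq_trans (size_poly _ _)) ?leq_addl //=.
  exact: leq_trans sX (leq_addr _ _).
have Qspan i : in_span (fun w => (Q w)`_i).
  have -> : (fun w => (Q w)`_i) = fun w => (P w)`_i + (if i == 0%N then 0 else (W w)`_i.-1)
     + - (\poly_(k < N.+1) (if k == 0%N then 0 else b k w.1))`_i.
    by apply/funext => w; rewrite /Q coefB coefD coefXM.
  apply: in_spanD; first apply: in_spanD.
  - under eq_fun do rewrite coef_poly.
    by case: ltnP => _; [exact: sigma_span|exact: in_span_cst].
  - case: eqP => _; first exact: in_span_cst.
    have -> : (fun w => (W w)`_i.-1) =
        fun w => \sum_(j < N.+1) taylor_coef h j w * (P w ^+ j)`_i.-1.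
      by apply/funext => w; rewrite coef_sum; apply: eq_bigr => j _; rewrite coefZ.
    apply: in_span_sum => j _; apply: in_spanM; first exact: in_span_taylor_coef.
    exact: in_span_poly_exp.
  - apply: in_spanN; under eq_fun do rewrite coef_poly.
    case: ltnP => _; last exact: in_span_cst.
    by case: eqP => _; [exact: in_span_cst|exact: spb].
pose c i := sval (cid (in_span_bounded (Qspan i))).
have cP i w : `|(Q w)`_i| <= c i by exact: (svalP (cid (in_span_bounded (Qspan i)))).
exists (\sum_(i < m) c i + C2 * C1 ^+ N.+1) => e w e1.
set t := truncated_slope N e w.
rewrite (_ : _ - _ = (Q w).[e] + e * (h (w.1 + t, w.2) -
    \sum_(j < N.+1) taylor_coef h j (w.1, w.2) * t ^+ j)); last first.
  by rewrite QE -/t -surjective_pairing; ring.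
rewrite (le_trans (ler_normD _ _)) // mulrDl lerD //.
  rewrite (le_trans (horner_high (Qlow w) e1)) // mulrC ler_wpM2r ?exprn_ge0 //.
  rewrite (big_ord_widen m (fun i => `|(Q w)`_i|) (Qsize w)) big_mkcond ler_sum // => i _.
  by case: ifP => _; [exact: cP|exact: le_trans (cP _ w)].
rewrite normrM (le_trans (ler_wpM2l _ (HC2 _ _ _))) //.
rewrite (@le_trans _ _ (C2 * `|t| ^+ N.+1)) //.
  by rewrite ler_piMl // mulr_ge0 // exprn_ge0.
rewrite -mulrA -exprMn ler_wpM2l // lerXn2r ?nnegrE ?mulr_ge0 //.
exact: HC1.
Qed.

(** * Geometric bounds by a majorant recursion *)

Section Majorant.
Variables (K r d : R).
Hypotheses (K0 : 0 <= K) (r0 : 0 < r) (d0 : 0 <= d) (Krd : 8 * K * d * r <= 1).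
Hypothesis h_le : forall j w, `|taylor_coef h j w| <= K * r ^+ j.

Let rec_le (beta : nat -> R) k := \sum_(j < k.+1) K * r ^+ j * pow_coef beta k j.

Let geometric_le2 n (y : R) : 0 <= y -> y <= 2^-1 -> \sum_(j < n) y ^+ j <= 2.
Proof.
move=> y0 y1; elim: n => [|n IH]; first by rewrite big_ord0.
rewrite big_ord_recl expr0; under eq_bigr do rewrite exprS.
rewrite -mulr_sumr; have : y * (\sum_(i < n) y ^+ i) <= 2^-1 * 2.
  by apply: ler_pM => //; apply: sumr_ge0 => i _; rewrite exprn_ge0.
lra.
Qed.

Let horner_partial (p : {poly R}) m (x : R) : (forall i, 0 <= p`_i) -> 0 <= x ->
  \sum_(k < m) p`_k * x ^+ k <= p.[x].
Proof.
move=> p0 x0; rewrite (@horner_coef_wide _ (m + size p)) ?leq_addl //.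
rewrite (big_ord_widen (m + size p) (fun k => p`_k * x ^+ k)) ?leq_addr //.
rewrite big_mkcond ler_sum // => i _; case: ifP => _ //.
by rewrite mulr_ge0 // exprn_ge0.
Qed.

(** Let [X N] be the partial sum at [d] of the majorant [beta]. It satisfies
    [X (N+1) <= 2 K d sum_j (r X N)^j]. The bound [r X <= 1/2] is invariant: the geometric sum is
    then at most 2, and [4 K d r <= 1/2] is the hypothesis [Krd]. *)
Lemma formal_bound : exists B, forall k s, `|b k.+1 s| * d ^+ k.+1 <= B.
Proof.
have [_ _ _ Seq bP] := sol.
have [beta [beta0 betaS]] : exists beta : nat -> R, beta 0%N = 0 /\
    forall k, beta k.+1 = 2 * rec_le beta k.
  apply: (@course_of_values _ _ (fun k u => 2 * rec_le u k)) => k u v uv; congr (_ * _).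
  by apply: eq_bigr => j _; rewrite (pow_coef_local _ uv).
have rec_bound k u w : (forall i, (i <= k)%N -> `|u i| <= beta i) ->
    `|recursion_coef h u k w| <= rec_le beta k.
  move=> ub; rewrite (le_trans (ler_norm_sum _ _ _)) // ler_sum // => j _.
  by rewrite normrM ler_pM // pow_coef_le.
have sigma_le k w : `|sigma k w| <= beta k.
  elim/ltn_ind: k w => -[|k] IH w; first by rewrite sigma0 normr0 beta0.
  have recw v : `|recursion_coef h (fun i => 'D_dw (S i) v) k v| <= rec_le beta k.
    by apply: rec_bound => i ik; exact: IH.
  rewrite /sigma Seq betaS (le_trans (ler_normB _ _)) // mulr_natl mulr2n lerD //.
  exact: bP.
have b_le k s : `|b k.+1 s| <= rec_le beta k.
  by apply: bP => w; apply: rec_bound => i _; exact: sigma_le.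
have beta_ge0 k : 0 <= beta k by exact: le_trans (sigma_le k 0).
pose X N := \sum_(i < N.+1) beta i * d ^+ i.
have X0 N : 0 <= X N by rewrite sumr_ge0 // => i _; rewrite mulr_ge0 // exprn_ge0.
have pow_ge0 N j i : 0 <= ((\poly_(i < N.+1) beta i) ^+ j)`_i.
  elim: j i => [|j IH] i; first by rewrite expr0 coef1; case: eqP.
  rewrite exprS coefM sumr_ge0 // => k _; rewrite mulr_ge0 // coef_poly.
  by case: ltnP.
have XS N : X N.+1 <= 2 * K * d * \sum_(j < N.+1) (r * X N) ^+ j.
  rewrite /X big_ord_recl beta0 mul0r add0r.
  have -> : \sum_(i < N.+1) beta (bump 0 i) * d ^+ bump 0 i =
      2 * K * d * \sum_(i < N.+1) \sum_(j < i.+1) r ^+ j * pow_coef beta i j * d ^+ i.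
    rewrite mulr_sumr; apply: eq_bigr => i _; rewrite /bump /= add1n betaS /rec_le.
    rewrite -mulr_suml exprS.
    have -> : \sum_(j < i.+1) K * r ^+ j * pow_coef beta i j =
        K * \sum_(j < i.+1) r ^+ j * pow_coef beta i j.
      by rewrite mulr_sumr; apply: eq_bigr => j _; rewrite mulrA.
    by ring.
  rewrite ler_wpM2l ?mulr_ge0 //.
  apply: (@le_trans _ _ (\sum_(i < N.+1) \sum_(j < N.+1)
      r ^+ j * ((\poly_(i < N.+1) beta i) ^+ j)`_i * d ^+ i)).
    apply: ler_sum => i _.
    rewrite (big_ord_widen N.+1 (fun j => r ^+ j * pow_coef beta i j * d ^+ i)) // big_mkcond.
    apply: ler_sum => j _; case: ifP => _.
      by rewrite (pow_coefE _ _ (N := N)) // -ltnS.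
    by rewrite mulr_ge0 ?exprn_ge0 // mulr_ge0 ?exprn_ge0 ?(ltW r0).
  rewrite exchange_big ler_sum // => j _.
  have -> : \sum_(i < N.+1) r ^+ j * ((\poly_(i < N.+1) beta i) ^+ j)`_i * d ^+ i =
      r ^+ j * \sum_(i < N.+1) ((\poly_(i < N.+1) beta i) ^+ j)`_i * d ^+ i.
    by rewrite mulr_sumr; apply: eq_bigr => i _; rewrite mulrA.
  rewrite exprMn ler_wpM2l ?exprn_ge0 ?(ltW r0) // (le_trans (horner_partial _ _ _)) //.
  by rewrite horner_exp horner_poly.
have X_le N : r * X N <= 2^-1.
  elim: N => [|N IH]; first by rewrite /X big_ord1 beta0 mul0r mulr0.
  have : r * X N.+1 <= r * (2 * K * d * 2).
    rewrite ler_wpM2l ?(ltW r0) // (le_trans (XS N)) // ler_wpM2l ?mulr_ge0 //.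
    by apply: geometric_le2 => //; rewrite mulr_ge0 // ltW.
  by move=> /le_trans; apply; move: Krd; nra.
(* A single term of [X] is at most the whole sum, hence at most [1 / (2 r)]. *)
exists (2^-1 / r) => k s; rewrite ler_pdivlMr // mulrC.
apply: le_trans (X_le k.+1); rewrite ler_wpM2l ?(ltW r0) //.
apply: (@le_trans _ _ (beta k.+1 * d ^+ k.+1)).
  rewrite ler_wpM2r ?exprn_ge0 // betaS (le_trans (b_le k s)) //.
  rewrite ler_peMl ?ler1n //; exact: le_trans (b_le k s).
rewrite /X [leRHS]big_ord_recr /= lerDr sumr_ge0 // => i _.
by rewrite mulr_ge0 // exprn_ge0.
Qed.

End Majorant.

End Residual.

End FormalSolution.

(** * Action-angle coordinates *)

Section DifferentialCalculus.
Context {R : realType}.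

Lemma derive_comp (U V W : normedModType R) (g : U -> V) (f : V -> W) x v :
  differentiable g x -> differentiable f (g x) ->
  'D_v (fun w => f (g w)) x = 'D_('D_v g x) f (g x).
Proof.
move=> dg df; rewrite (deriveE _ (differentiable_comp dg df)) diff_comp //=.
by rewrite deriveE // deriveE.
Qed.

Lemma derive_pair (U V W : normedModType R) (f : U -> V) (g : U -> W) x v :
  differentiable f x -> differentiable g x ->
  'D_v (fun w => (f w, g w)) x = ('D_v f x, 'D_v g x).
Proof.
move=> df dg; rewrite deriveE; last exact: differentiable_pair.
by rewrite diff_pair // !deriveE.
Qed.

Lemma differentiable_row (U : normedModType R) n (f : U -> 'I_n -> R^o) x :
  (forall i, differentiable (f ^~ i) x) -> differentiable (fun w => \row_i f w i : 'rV[R]_n) x.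
Proof.
move=> df.
have -> : (fun w => \row_i f w i : 'rV[R]_n) =
    fun w => \sum_i (fun w => f w i *: (delta_mx 0 i : 'rV[R]_n)) w.
  apply/funext => w; rewrite [LHS]row_sum_delta; apply: eq_bigr => i _.
  by rewrite mxE.
have -> : (fun w => \sum_i f w i *: (delta_mx 0 i : 'rV[R]_n)) =
    \sum_i (fun w => f w i *: (delta_mx 0 i : 'rV[R]_n)).
  by apply/funext => w; rewrite fct_sumE.
by apply: differentiable_sum => i; exact: differentiableZl.
Qed.

Lemma derive_row (U : normedModType R) n (f : U -> 'I_n -> R^o) x v :
  (forall i, differentiable (f ^~ i) x) ->
  'D_v (fun w => \row_i f w i : 'rV[R]_n) x = \row_i 'D_v (f ^~ i) x.
Proof.
move=> df; rewrite derive_mx; last by apply: diff_derivable; exact: differentiable_row.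
apply/rowP => j; rewrite [LHS]mxE [RHS]mxE.
have -> : (fun w => (\row_i f w i : 'rV[R]_n) 0 j) = f ^~ j by apply/funext => w; rewrite mxE.
by [].
Qed.

Lemma differentiable_fst (U V : normedModType R) (x : U * V) : differentiable fst x.
Proof. by apply: linear_differentiable => y; exact: cvg_fst. Qed.

Lemma differentiable_snd (U V : normedModType R) (x : U * V) : differentiable snd x.
Proof. by apply: linear_differentiable => y; exact: cvg_snd. Qed.

Lemma near_eq_differentiable (U V : normedModType R) (f g : U -> V) x :
  (\forall w \near x, f w = g w) -> differentiable f x -> differentiable g x.
Proof.
move=> fg df; have fgx : f x = g x by exact: nbhs_singleton fg.
have dl : is_diff x g ('d f x); last exact: ex_diff.
apply: is_diff_bound; first exact: diff_continuous.
move=> e e0; have := diff_bound df e0.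
have cx : (fun h => x + h) @ (0 : U) --> x.
  by rewrite -[X in _ --> X]addr0; apply: cvgD; [exact: cvg_cst|exact: cvg_id].
have := cx _ fg; rewrite nbhs_filterE /=.
apply: filterS2 => h /= E; by rewrite -E -fgx.
Qed.

End DifferentialCalculus.

(** * Polar coordinates and their lifts *)

Section CircleAngles.
Context {R : realType}.

Lemma circle_angle (a b : R) : a ^+ 2 + b ^+ 2 = 1 ->
  exists x, 0 <= x < 2 * pi /\ cos x = a /\ sin x = b.
Proof.
move=> ab.
have a1 : -1 <= a <= 1 by apply/andP; split; have := sqr_ge0 b; nra.
have ca : cos (acos a) = a by rewrite acosK // in_itv.
have sa : sin (acos a) = `|b|.
  by rewrite sin_acos // -sqrtr_sqr; congr Num.sqrt; lra.
have p0 := pi_gt0 R; have x0 := acos_ge0 a1; have xpi := acos_lepi a1.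
have [b0|b0] := leP 0 b.
  exists (acos a); rewrite ca sa ger0_norm //; split=> //.
  by apply/andP; split=> //; lra.
exists (2 * pi - acos a); rewrite mulr_natl cosB sinB cos2pi sin2pi ca sa ltr0_norm //.
split; last by split; ring.
have : 0 < acos a.
  rewrite acos_gt0 //; have /andP[-> a1'] := a1; rewrite lt_neqAle a1' andbT.
  by apply/eqP => a1E; move: ab; rewrite a1E; nra.
by move=> ?; apply/andP; split; lra.
Qed.

(** After subtraction of periods the difference [d] lies in [[0, 2 pi)] and has cosine 1; then
    [sin (d / 2)] vanishes while [d / 2] lies in [[0, pi)], which forces [d = 0]. *)
Lemma cos_sin_mod (x y : R) : cos x = cos y -> sin x = sin y ->
  exists k : int, x = y + 2 * pi * k%:~R.
Proof.
move=> cE sE; have p0 := pi_gt0 R.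
have p20 : 0 < 2 * pi :> R by lra.
pose u := (x - y) / (2 * pi); pose k := Num.floor u; pose d := x - y - 2 * pi * k%:~R.
exists k; suff : d = 0 by rewrite /d; lra.
have cosn m (a : R) : cos (a + 2 * pi * m%:R) = cos a.
  by rewrite mulr_natr mulrC mulr_natr; exact: (periodicn (@cosD2pi R)).
have cosz (n : int) (a : R) : cos (a - 2 * pi * n%:~R) = cos a.
  case: n => m; first by have := cosn m (a - 2 * pi * m%:R); rewrite subrK => ->.
  by rewrite NegzE mulrNz mulrN opprK cosn.
have cd : cos d = 1 by rewrite cosz cosB -cE -sE -!expr2 cos2Dsin2.
have xyE : x - y = 2 * pi * u by rewrite /u mulrC divfK // gt_eqF.
have d0 : 0 <= d by rewrite /d xyE -mulrBr mulr_ge0 ?(ltW p20) // subr_ge0 floor_le.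
have d1 : d < 2 * pi.
  rewrite /d xyE -mulrBr gtr_pMr // ltrBlDr addrC.
  by have := floorD1_gt u; rewrite intrD.
have s0 : sin (d / 2) ^+ 2 = 0.
  have := cos_mulr2n (d / 2); rewrite (_ : d / 2 *+ 2 = d); last by rewrite -mulr_natr divfK.
  by rewrite cd sin2cos2 -mulr_natr; lra.
apply/eqP; rewrite eq_le d0 andbT leNgt; apply/negP => dgt.
have : 0 < sin (d / 2) by apply: sin_gt0_pi; apply/andP; split; lra.
by move/eqP: s0; rewrite expf_eq0 /= => /eqP ->; rewrite ltxx.
Qed.

End CircleAngles.

Section Polar.
Context {R : realType} {l : nat}.
Local Notation pt := (phase R l).
Local Notation E := (R^o * 'rV[R]_l)%type.
Implicit Types (z v : pt) (x xi : 'rV[R]_l).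

Definition angle z : 'rV[R]_l := (action_angle_inv z).2.

Lemma actionsE z i : actions z 0 i = z.1 0 i ^+ 2 + z.2 0 i ^+ 2.
Proof. by rewrite mxE. Qed.

Lemma actions_action_angle xi x : (forall i, 0 <= xi 0 i) -> actions (action_angle (xi, x)) = xi.
Proof.
move=> xi0; apply/rowP => i; rewrite !mxE sqrrN !exprMn sqr_sqrtr //.
by rewrite -mulrDr addrC cos2Dsin2 mulr1.
Qed.

(** Replaces membership in an image by an open condition on Cartesian coordinates. *)
Lemma phase_spaceP z : phase_space z <-> forall i, 0 < actions z 0 i.
Proof.
split=> [[[xi x] xid <-] i|z0].
  rewrite actions_action_angle; first by have [] := xid i.
  by move=> k; have [/ltW] := xid k.
have ex i : exists t, 0 <= t < 2 * pi /\ cos t = z.2 0 i / Num.sqrt (actions z 0 i) /\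
    sin t = - z.1 0 i / Num.sqrt (actions z 0 i).
  apply: circle_angle; have := z0 i; have := sqr_sqrtr (ltW (z0 i)) => sq zi.
  rewrite !exprMn !exprVn sq sqrrN -mulrDl addrC -actionsE divff // gt_eqF //.
pose t i := projT1 (cid (ex i)).
exists (actions z, \row_i t i) => [i|] /=.
  by rewrite mxE /t; case: cid => /= y [].
case: z z0 ex @t => a b z0 ex t; rewrite /action_angle /=.
have q0 i : Num.sqrt (actions (a, b) 0 i) != 0 by rewrite gt_eqF // sqrtr_gt0.
congr (_, _); apply/rowP => i; rewrite !mxE /t -/(actions (a, b)); case: cid => /= y [_ [cE sE]].
  by rewrite -[a 0 i ^+ 2 + _](actionsE (a, b)) sE mulrC divfK ?opprK.
by rewrite -[a 0 i ^+ 2 + _](actionsE (a, b)) cE mulrC divfK.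
Qed.

Lemma action_angle_invK z : phase_space z -> action_angle (action_angle_inv z) = z.
Proof. by move=> pz; rewrite /action_angle_inv pinvK ?inE. Qed.

Lemma action_angle_inv_dom z : phase_space z -> action_angle_domain (action_angle_inv z).
Proof.
move=> pz; apply: (@surjpinv_image_sub _ _ _ _ phase_space action_angle) => //.
by exists z.
Qed.

Lemma action_angle_inv1 z : phase_space z -> (action_angle_inv z).1 = actions z.
Proof.
move=> pz; rewrite -[in RHS](action_angle_invK pz) [in RHS](surjective_pairing (action_angle_inv z)).
by rewrite actions_action_angle // => i; have [/ltW] := action_angle_inv_dom pz i.
Qed.

Lemma action_angleK z : phase_space z -> action_angle (actions z, angle z) = z.
Proof. by move=> pz; rewrite -action_angle_inv1 // -surjective_pairing action_angle_invK. Qed.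

Lemma phase_space_action_angle xi x : (forall i, 0 < xi 0 i) -> phase_space (action_angle (xi, x)).
Proof.
move=> xi0; apply/phase_spaceP => i; rewrite actions_action_angle // => k.
exact: ltW.
Qed.

Lemma action_angle_mod xi x y : (forall i, 0 < xi 0 i) ->
  action_angle (xi, x) = action_angle (xi, y) ->
  exists k : 'rV[int]_l, x = y + (2 * pi) *: zvec k.
Proof.
move=> xi0 [] /rowP s /rowP c.
have ex i : exists k : int, x 0 i = y 0 i + 2 * pi * k%:~R.
  have q0 : Num.sqrt (xi 0 i) != 0 by rewrite gt_eqF // sqrtr_gt0.
  apply: cos_sin_mod.
    by have := c i; rewrite !mxE /= => /(mulfI q0).
  by have := s i; rewrite !mxE /= => /oppr_inj /(mulfI q0).
exists (\row_i projT1 (cid (ex i))); apply/rowP => i; rewrite !mxE.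
by case: cid.
Qed.

Lemma angle_action_angle xi x : (forall i, 0 < xi 0 i) ->
  exists k : 'rV[int]_l, angle (action_angle (xi, x)) = x + (2 * pi) *: zvec k.
Proof.
move=> xi0; apply: (action_angle_mod xi0).
have xi0' i := ltW (xi0 i).
by have := action_angleK (phase_space_action_angle x xi0); rewrite actions_action_angle.
Qed.

Lemma hamiltonian0E omega z : hamiltonian0 omega z = dot omega (actions z).
Proof. by apply: eq_bigr => i _; rewrite mxE. Qed.

Lemma hamiltonian1E omega V z : phase_space z ->
  hamiltonian1 omega V z = V (dot omega (actions z)) (angle z).
Proof. by move=> pz; rewrite /hamiltonian1 /subst_omega action_angle_inv1. Qed.

(* The differential of the angles is single-valued although the angles are not. *)
Definition angle_form z v : 'rV[R]_l :=
  \row_i ((z.1 0 i * v.2 0 i - z.2 0 i * v.1 0 i) / actions z 0 i).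

(** If [z] and [z'] have actions [xi, xi'] and angles [x, x'], then [cross] and [inner] are
    [sqrt (xi xi')] times the sine and the cosine of [x' - x]. *)
Definition cross z z' i : R := z.1 0 i * z'.2 0 i - z.2 0 i * z'.1 0 i.
Definition inner z z' i : R := z.1 0 i * z'.1 0 i + z.2 0 i * z'.2 0 i.

(* The small angle from z to z'; it makes angle z + turn z _ a differentiable lift of the angles near z. *)
Definition turn z z' : 'rV[R]_l := \row_i atan (cross z z' i / inner z z' i).

Lemma lagrange_identity z z' i :
  cross z z' i ^+ 2 + inner z z' i ^+ 2 = actions z 0 i * actions z' 0 i.
Proof. by rewrite !actionsE /cross /inner; ring. Qed.

(** Addition formulas: the identity of Lagrange gives the cosine and sine of the arctangent, and
    [inner > 0] fixes the sign of the square root, that is, keeps the turn in the branch of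
    [atan]. *)
Lemma action_angle_turn z z' x : phase_space z' -> (forall i, 0 < inner z z' i) ->
  action_angle (actions z, x) = z -> action_angle (actions z', x + turn z z') = z'.
Proof.
move=> /phase_spaceP pz' in0 zE.
have pz i : 0 < actions z 0 i.
  rewrite lt_neqAle actionsE addr_ge0 ?sqr_ge0 // andbT eq_sym paddr_eq0 ?sqr_ge0 //.
  rewrite !sqrf_eq0; apply/negP => /andP[/eqP a /eqP b].
  by have := in0 i; rewrite /inner a b !mul0r addr0 ltxx.
have E i : [/\ z.1 0 i = - (Num.sqrt (actions z 0 i) * sin (x 0 i)),
    z.2 0 i = Num.sqrt (actions z 0 i) * cos (x 0 i),
    cos (turn z z' 0 i) = inner z z' i / (Num.sqrt (actions z 0 i) * Num.sqrt (actions z' 0 i)) &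
    sin (turn z z' 0 i) = cross z z' i / (Num.sqrt (actions z 0 i) * Num.sqrt (actions z' 0 i))].
  have d0 := in0 i; have q0 : 0 < actions z 0 i * actions z' 0 i by rewrite mulr_gt0.
  have cE : cos (turn z z' 0 i) = inner z z' i / (Num.sqrt (actions z 0 i) * Num.sqrt (actions z' 0 i)).
    rewrite mxE cos_atan -sqrtrM ?ltW // -lagrange_identity.
    have -> : 1 + (cross z z' i / inner z z' i) ^+ 2 =
        (cross z z' i ^+ 2 + inner z z' i ^+ 2) / inner z z' i ^+ 2.
      by field; rewrite gt_eqF.
    rewrite sqrtrM ?addr_ge0 ?sqr_ge0 // sqrtrV ?sqr_ge0 // sqrtr_sqr gtr0_norm //.
    by rewrite invfM invrK mulrC.
  have c0 : cos (turn z z' 0 i) != 0.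
    by rewrite cE mulf_neq0 ?invr_eq0 ?mulf_neq0 // gt_eqF // sqrtr_gt0.
  split; [by rewrite -[in LHS]zE !mxE|by rewrite -[in LHS]zE !mxE|exact: cE|].
  have := atanK (cross z z' i / inner z z' i); rewrite /tan.
  have -> : atan (cross z z' i / inner z z' i) = turn z z' 0 i by rewrite mxE.
  move=> /(canRL (divfK c0)) ->; rewrite cE mulrA divfK // gt_eqF //.
rewrite /action_angle [RHS]surjective_pairing; congr (_, _); apply/rowP => i.
all: have [z1E z2E cE sE] := E i.
all: have q0 : Num.sqrt (actions z 0 i) != 0 by rewrite gt_eqF // sqrtr_gt0.
all: have q0' : Num.sqrt (actions z' 0 i) != 0 by rewrite gt_eqF // sqrtr_gt0.
all: have sqE : z.1 0 i ^+ 2 + z.2 0 i ^+ 2 = Num.sqrt (actions z 0 i) ^+ 2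
  by rewrite sqr_sqrtr -?actionsE // ltW.
all: have sxE : sin (x 0 i) = - z.1 0 i / Num.sqrt (actions z 0 i)
  by rewrite z1E opprK mulrC mulKf.
all: have cxE : cos (x 0 i) = z.2 0 i / Num.sqrt (actions z 0 i)
  by rewrite z2E mulrC mulKf.
- rewrite mxE [(x + _) 0 i]mxE sinD cE sE sxE cxE /cross /inner.
  transitivity (z'.1 0 i * (z.1 0 i ^+ 2 + z.2 0 i ^+ 2) / Num.sqrt (actions z 0 i) ^+ 2); last first.
    by rewrite sqE mulfK // expf_neq0.
  by field; apply/andP.
- rewrite mxE [(x + _) 0 i]mxE cosD cE sE sxE cxE /cross /inner.
  transitivity (z'.2 0 i * (z.1 0 i ^+ 2 + z.2 0 i ^+ 2) / Num.sqrt (actions z 0 i) ^+ 2); last first.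
    by rewrite sqE mulfK // expf_neq0.
  by field; apply/andP.
Qed.

End Polar.

(** * Derivatives of functions of the angles *)

Section ScalarChainRule.
Context {R : realType} {U : normedModType R}.
Implicit Types (f g : U -> R^o) (x v : U).

(** As in the rules that follow, differentiability and the formula are proved together, so that the
    derivative of a compound expression is assembled by forward application, without guessing it. *)
Lemma chain_rule (k : R -> R) g x (k' : R) :
  is_derive (g x : R) 1 k k' -> differentiable g x ->
  differentiable (fun w => k (g w) : R^o) x /\
  forall v, 'D_v (fun w => k (g w) : R^o) x = k' * 'D_v g x.
Proof.
move=> [dk kE] dg.
have dk' : differentiable (k : R^o -> R^o) (g x) by apply/derivable1_diffP.
split; first exact: (@differentiable_comp _ _ _ _ g (k : R^o -> R^o)).
move=> v; rewrite (@derive_comp _ _ _ _ g (k : R^o -> R^o)) // deriveE //.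
rewrite -[X in 'd _ _ X]mulr1 [X in 'd _ _ X](_ : _ = 'D_v g x *: (1 : R^o)) //.
by rewrite linearZ /= -deriveE // kE mulrC.
Qed.

Lemma diff_sub f g x : differentiable f x -> differentiable g x ->
  differentiable (fun w => f w - g w : R^o) x /\
  forall v, 'D_v (fun w => f w - g w : R^o) x = 'D_v f x - 'D_v g x.
Proof.
move=> df dg; split; first exact: differentiableB.
by move=> v; apply: deriveB; exact: diff_derivable.
Qed.

Lemma diff_add f g x : differentiable f x -> differentiable g x ->
  differentiable (fun w => f w + g w : R^o) x /\
  forall v, 'D_v (fun w => f w + g w : R^o) x = 'D_v f x + 'D_v g x.
Proof.
move=> df dg; split; first exact: differentiableD.
by move=> v; apply: deriveD; exact: diff_derivable.
Qed.

Lemma diff_mul f g x : differentiable f x -> differentiable g x ->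
  differentiable (fun w => f w * g w : R^o) x /\
  forall v, 'D_v (fun w => f w * g w : R^o) x = f x * 'D_v g x + g x * 'D_v f x.
Proof.
move=> df dg; split; first exact: differentiableM.
by move=> v; apply: deriveM; exact: diff_derivable.
Qed.

Lemma diff_inv f x : differentiable f x -> f x != 0 ->
  differentiable (fun w => (f w)^-1 : R^o) x /\
  forall v, 'D_v (fun w => (f w)^-1 : R^o) x = - (f x) ^- 2 * 'D_v f x.
Proof.
move=> df f0; split; first exact: differentiableV.
by move=> v; apply: deriveV => //; exact: diff_derivable.
Qed.

Lemma diff_sqrt f x : differentiable f x -> 0 < f x ->
  differentiable (fun w => Num.sqrt (f w) : R^o) x /\
  forall v, 'D_v (fun w => Num.sqrt (f w) : R^o) x = (2 * Num.sqrt (f x))^-1 * 'D_v f x.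
Proof.
by move=> df f0; apply: chain_rule => //; exact: is_derive1_sqrt.
Qed.

Lemma diff_sum n (f : 'I_n -> U -> R^o) x : (forall i, differentiable (f i) x) ->
  differentiable (fun w => \sum_i f i w : R^o) x /\
  forall v, 'D_v (fun w => \sum_i f i w : R^o) x = \sum_i 'D_v (f i) x.
Proof.
move=> df; have -> : (fun w => \sum_i f i w : R^o) = \sum_i f i.
  by apply/funext => w; rewrite fct_sumE.
split; first exact: differentiable_sum.
by move=> v; apply: derive_sum => i; exact: diff_derivable.
Qed.

End ScalarChainRule.

Section AngleCalculus.
Context {R : realType} {l : nat}.
Local Notation pt := (phase R l).
Local Notation E := (R^o * 'rV[R]_l)%type.
Context {U : normedModType R}.
Implicit Types (z : U -> pt) (w v : U).

Lemma derive_fst z w v : differentiable z w -> 'D_v (fun w => (z w).1) w = ('D_v z w).1.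
Proof.
move=> dz; rewrite (@derive_comp _ _ _ _ z fst) //; last exact: differentiable_fst.
by rewrite deriveE ?diff_lin //; [move=> y; exact: cvg_fst|exact: differentiable_fst].
Qed.

Lemma derive_snd z w v : differentiable z w -> 'D_v (fun w => (z w).2) w = ('D_v z w).2.
Proof.
move=> dz; rewrite (@derive_comp _ _ _ _ z snd) //; last exact: differentiable_snd.
by rewrite deriveE ?diff_lin //; [move=> y; exact: cvg_snd|exact: differentiable_snd].
Qed.

Lemma diff_coord (N : U -> 'rV[R]_l) w i : differentiable N w ->
  differentiable (fun w => N w 0 i : R^o) w /\
  forall v, 'D_v (fun w => N w 0 i : R^o) w = ('D_v N w) 0 i.
Proof.
move=> dN; split.
  apply: (@differentiable_comp _ _ _ _ N (fun M : 'rV[R]_l => M 0 i : R^o)) => //.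
  exact: differentiable_coord.
by move=> v; rewrite derive_mx ?mxE //; exact: diff_derivable.
Qed.

Lemma diff_eta z w i : differentiable z w ->
  differentiable (fun w => (z w).1 0 i : R^o) w /\
  forall v, 'D_v (fun w => (z w).1 0 i : R^o) w = ('D_v z w).1 0 i.
Proof.
move=> dz; have d1 : differentiable (fun w => (z w).1) w.
  by apply: (@differentiable_comp _ _ _ _ z fst) => //; exact: differentiable_fst.
have [dc cE] := diff_coord i d1; split=> // v.
by rewrite cE derive_fst.
Qed.

Lemma diff_y z w i : differentiable z w ->
  differentiable (fun w => (z w).2 0 i : R^o) w /\
  forall v, 'D_v (fun w => (z w).2 0 i : R^o) w = ('D_v z w).2 0 i.
Proof.
move=> dz; have d1 : differentiable (fun w => (z w).2) w.
  by apply: (@differentiable_comp _ _ _ _ z snd) => //; exact: differentiable_snd.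
have [dc cE] := diff_coord i d1; split=> // v.
by rewrite cE derive_snd.
Qed.

Lemma diff_eta_y z w : differentiable z w ->
  differentiable (fun w => \sum_i ((z w).1 0 i * (z w).2 0 i) : R^o) w /\
  forall v, 'D_v (fun w => \sum_i ((z w).1 0 i * (z w).2 0 i) : R^o) w =
    \sum_i ((z w).1 0 i * ('D_v z w).2 0 i + (z w).2 0 i * ('D_v z w).1 0 i).
Proof.
move=> dz; have ab i := diff_mul (diff_eta i dz).1 (diff_y i dz).1.
have [ds sE] := diff_sum (fun i => (ab i).1); split=> // v.
rewrite [LHS]sE; apply: eq_bigr => i _.
by rewrite (ab i).2 (diff_eta i dz).2 (diff_y i dz).2.
Qed.

Lemma diff_cross z z' w i : differentiable z w -> differentiable z' w ->
  differentiable (fun w => cross (z w) (z' w) i : R^o) w /\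
  forall v, 'D_v (fun w => cross (z w) (z' w) i : R^o) w =
    cross (z w) ('D_v z' w) i + cross ('D_v z w) (z' w) i.
Proof.
move=> dz dz'; have [d1 e1] := diff_eta i dz; have [d2 e2] := diff_y i dz.
have [d1' e1'] := diff_eta i dz'; have [d2' e2'] := diff_y i dz'.
have [p1 q1] := diff_mul d1 d2'; have [p2 q2] := diff_mul d2 d1'.
have [p q] := diff_sub p1 p2; split=> // v.
rewrite [LHS]q q1 q2 e1 e2 e1' e2'.
rewrite /cross; move: ('D_v z w) ('D_v z' w) (z w) (z' w) => a b c d.
by move: (a.1 0 i) (a.2 0 i) (b.1 0 i) (b.2 0 i) (c.1 0 i) (c.2 0 i) (d.1 0 i) (d.2 0 i) => *; ring.
Qed.

Lemma diff_inner z z' w i : differentiable z w -> differentiable z' w ->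
  differentiable (fun w => inner (z w) (z' w) i : R^o) w /\
  forall v, 'D_v (fun w => inner (z w) (z' w) i : R^o) w =
    inner (z w) ('D_v z' w) i + inner ('D_v z w) (z' w) i.
Proof.
move=> dz dz'; have [d1 e1] := diff_eta i dz; have [d2 e2] := diff_y i dz.
have [d1' e1'] := diff_eta i dz'; have [d2' e2'] := diff_y i dz'.
have [p1 q1] := diff_mul d1 d1'; have [p2 q2] := diff_mul d2 d2'.
have [p q] := diff_add p1 p2; split=> // v.
rewrite [LHS]q q1 q2 e1 e2 e1' e2'.
rewrite /inner; move: ('D_v z w) ('D_v z' w) (z w) (z' w) => a b c d.
by move: (a.1 0 i) (a.2 0 i) (b.1 0 i) (b.2 0 i) (c.1 0 i) (c.2 0 i) (d.1 0 i) (d.2 0 i) => *; ring.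
Qed.

Lemma angle_formE (a b : pt) i : angle_form a b 0 i = cross a b i / actions a 0 i.
Proof. by rewrite mxE. Qed.

Lemma inner_gt0_actions (a b : pt) i : 0 < inner a b i ->
  0 < actions a 0 i /\ 0 < actions b 0 i.
Proof.
have pos (c d : R) : (c != 0) || (d != 0) -> 0 < c ^+ 2 + d ^+ 2.
  move=> cd; rewrite lt_neqAle addr_ge0 ?sqr_ge0 // andbT eq_sym paddr_eq0 ?sqr_ge0 //.
  by rewrite !sqrf_eq0 negb_and.
rewrite !actionsE /inner => in0; split; apply: pos; rewrite -negb_and; apply/negP => /andP[/eqP x0 /eqP y0].
  by move: in0; rewrite x0 y0 !mul0r addr0 ltxx.
by move: in0; rewrite x0 y0 !mulr0 addr0 ltxx.
Qed.

(** The turn is the difference of two angles modulo periods, so its differential is the difference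
    of two angle forms, each of them single-valued. *)
Lemma diff_turn z z' w : differentiable z w -> differentiable z' w ->
  (forall i, 0 < inner (z w) (z' w) i) ->
  differentiable (fun w => turn (z w) (z' w)) w /\
  forall v, 'D_v (fun w => turn (z w) (z' w)) w =
    angle_form (z' w) ('D_v z' w) - angle_form (z w) ('D_v z w).
Proof.
move=> dz dz' in0.
have step i : differentiable (fun w => atan (cross (z w) (z' w) i / inner (z w) (z' w) i) : R^o) w
   /\ forall v, 'D_v (fun w => atan (cross (z w) (z' w) i / inner (z w) (z' w) i) : R^o) w =
    cross (z' w) ('D_v z' w) i / actions (z' w) 0 i - cross (z w) ('D_v z w) i / actions (z w) 0 i.
  have [dc cE] := diff_cross i dz dz'; have [di iE] := diff_inner i dz dz'.
  have in_neq0 : inner (z w) (z' w) i != 0 by rewrite gt_eqF.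
  have [dv vE] := diff_inv di in_neq0.
  have [dq qE] := diff_mul dc dv.
  have [da aE] := chain_rule (is_derive1_atan _) dq; split=> // v.
  have [a0 a0'] := inner_gt0_actions (in0 i).
  have L := lagrange_identity (z w) (z' w) i.
  rewrite aE qE vE cE iE.
  have -> : (1 + (cross (z w) (z' w) i / inner (z w) (z' w) i) ^+ 2)^-1 =
      inner (z w) (z' w) i ^+ 2 / (actions (z w) 0 i * actions (z' w) 0 i).
    rewrite -L; field; rewrite in_neq0 /= L mulf_neq0 // gt_eqF //.
  have n0 : actions (z w) 0 i != 0 by rewrite gt_eqF.
  have n0' : actions (z' w) 0 i != 0 by rewrite gt_eqF.
  clear -n0 n0' in_neq0; move: n0 n0' in_neq0; rewrite !actionsE /inner /cross.
  move: ('D_v z w) ('D_v z' w) (z w) (z' w) => a b c d.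
  move: (a.1 0 i) (a.2 0 i) (b.1 0 i) (b.2 0 i) (c.1 0 i) (c.2 0 i) (d.1 0 i) (d.2 0 i).
  by move=> {a b c d} a a' b b' c c' d d' n0 n0' n; field; rewrite n0 n0' n.
split; first by apply: differentiable_row => i; have [] := step i.
move=> v; rewrite (derive_row (f := fun w i => atan (cross (z w) (z' w) i / inner (z w) (z' w) i))).
  by apply/rowP => i; have [_ H] := step i; rewrite mxE H !mxE.
by move=> i; have [] := step i.
Qed.

(** [angle] jumps where an angle passes a multiple of [2 pi], but [h] is periodic and does not see
    the jump. The term [r w *: omega] is carried along for the implicit equation that defines the
    transformation. *)
Lemma angle_comp (h : E -> R^o) (s : U -> R^o) z (r : U -> R^o) (omega : 'rV[R]_l) w :
  in_span h -> differentiable s w -> differentiable z w -> differentiable r w ->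
  phase_space (z w) ->
  differentiable (fun w => h (s w, angle (z w) - r w *: omega)) w /\
  forall v, 'D_v (fun w => h (s w, angle (z w) - r w *: omega)) w =
    'D_(('D_v s w, angle_form (z w) ('D_v z w) - 'D_v r w *: omega) : E) h
      (s w, angle (z w) - r w *: omega).
Proof.
move=> hh ds dz dr pz.
have in0 i : 0 < inner (z w) (z w) i.
  have /phase_spaceP/(_ i) := pz; rewrite actionsE /inner.
  by rewrite !expr2.
have dcst : differentiable (cst (z w) : U -> pt) w by exact: differentiable_cst.
have [dt tE] := @diff_turn (cst (z w)) z w dcst dz in0.
(* A differentiable lift: equal to the shifted angle at [w], and equal to it modulo periods
   nearby. *)
pose X u := angle (z w) + turn (z w) (z u) - r u *: omega.
have turn0 : turn (z w) (z w) = 0.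
  by apply/rowP => i; rewrite !mxE /cross [X in X - _]mulrC subrr mul0r atan0.
have Xw : X w = angle (z w) - r w *: omega by rewrite /X turn0 addr0.
have dro : differentiable (fun u => r u *: omega) w by exact: differentiableZl.
have dX : differentiable X w.
  apply: (@differentiableB _ _ _ (fun u => angle (z w) + turn (z w) (z u)) (fun u => r u *: omega)) => //.
  apply: (@differentiableD _ _ _ (cst (angle (z w))) (fun u => turn (z w) (z u))) => //.
have XE v : 'D_v X w = angle_form (z w) ('D_v z w) - 'D_v r w *: omega.
  have e1 : 'D_v (fun u => angle (z w) + turn (z w) (z u)) w = angle_form (z w) ('D_v z w).
    rewrite (@deriveD _ _ _ (cst (angle (z w))) (fun u => turn (z w) (z u))) //; last exact: diff_derivable.
    rewrite derive_cst add0r tE derive_cst.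
    have -> : angle_form (cst (z w) w) 0 = 0.
      by apply/rowP => i; rewrite !mxE !mulr0 subrr mul0r.
    by rewrite subr0.
  have e2 : 'D_v (fun u => r u *: omega) w = 'D_v r w *: omega.
    by rewrite deriveE // diffZl //= -deriveE.
  rewrite -e1 -e2; apply: (@deriveB _ _ _ (fun u => angle (z w) + turn (z w) (z u)) (fun u => r u *: omega)).
    apply: diff_derivable.
    exact: (@differentiableD _ _ _ (cst (angle (z w))) (fun u => turn (z w) (z u))).
  exact: diff_derivable.
have dsX : differentiable (fun u => (s u, X u)) w by exact: differentiable_pair.
have nearX : \forall u \near w, h (s u, X u) = h (s u, angle (z u) - r u *: omega).
  have nin : \forall u \near w, forall i, 0 < inner (z w) (z u) i.
    apply: filter_forall => i.
    have [di _] := diff_inner i dcst dz.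
    have ci : {for w, continuous (fun u => inner (z w) (z u) i)} := differentiable_continuous di.
    by apply: (cvgr_gt _ ci); exact: in0.
  apply: filterS nin => u uin.
  have pzu : phase_space (z u).
    by apply/phase_spaceP => i; have [] := inner_gt0_actions (uin i).
  have tE' := action_angle_turn pzu uin (action_angleK pz).
  have [i||k kE] := @action_angle_mod R l (actions (z u)) (angle (z u)) (angle (z w) + turn (z w) (z u)).
  - by have [] := inner_gt0_actions (uin i).
  - by rewrite tE' action_angleK.
  rewrite kE addrAC; symmetry; exact: in_span_periodic.
have dh := in_span_differentiable hh (s w, X w).
have dhX : differentiable (fun u => h (s u, X u)) w.
  exact: (@differentiable_comp _ _ _ _ (fun u => (s u, X u)) h).
split; first exact: near_eq_differentiable nearX dhX.
move=> v; rewrite -(near_eq_derive _ nearX) -Xw.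
apply: etrans (@derive_comp _ _ _ _ (fun u => (s u, X u)) h w v dsX dh) _.
by rewrite derive_pair // XE.
Qed.

End AngleCalculus.

(** * Uniqueness of the normal form *)

Section SmallPolynomial.
Context {R : realType}.

(** Letting [e] tend to 0 kills the constant coefficient; dividing by [e] then lowers the degree and
    the order of the bound together. *)
Lemma small_poly_eq0 n (c : nat -> R) (M : R) :
  (\forall e \near (0 : R), `|\sum_(k < n) c k * e ^+ k| <= M * `|e| ^+ n) ->
  forall k, (k < n)%N -> c k = 0.
Proof.
move=> H.
have {H} [d d0 H] : exists2 d : R, 0 < d & forall e, 0 < e < d ->
    `|\sum_(k < n) c k * e ^+ k| <= M * `|e| ^+ n.
  have [d /= d0 Hd] := H; exists d => // e /andP[e0 ed]; apply: Hd.
  by rewrite /= sub0r normrN gtr0_norm.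
elim: n c H => // n IH c H.
have c0 : c 0%N = 0.
  pose A := `|M| + \sum_(k < n) `|c k.+1|.
  have A0 : 0 <= A by rewrite addr_ge0 // sumr_ge0.
  apply/eqP; rewrite -normr_le0; apply/ler_addgt0Pl => e e0; rewrite addr0.
  (* [t < d] permits the use of the hypothesis, [t <= 1] bounds all positive powers of [t] by [t],
     and the last entry gives [A * t <= e]. *)
  pose t := Num.min (Num.min (d / 2) 1) (e / (A + 1)).
  have t0 : 0 < t by rewrite !lt_min ltr01 !divr_gt0 // ltr_wpDl.
  have td : t < d by rewrite !gt_min; apply/orP; left; apply/orP; left; lra.
  have t1 : t <= 1 by rewrite !ge_min lexx orbT.
  have te : A * t <= e.
    rewrite (@le_trans _ _ ((A + 1) * t)) //; first by rewrite ler_wpM2r ?lerDl // ltW.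
    by rewrite mulrC -ler_pdivlMr ?ltr_wpDl // !ge_min lexx orbT.
  have := H t; rewrite t0 td => /(_ isT).
  rewrite big_ord_recl /= expr0 mulr1 (gtr0_norm t0) => Ht.
  apply: le_trans te; rewrite /A mulrDl.
  rewrite -[c 0%N](addrK (\sum_(i < n) c (bump 0 i) * t ^+ bump 0 i)).
  rewrite (le_trans (ler_normB _ _)) // lerD //.
    rewrite (le_trans Ht) // (le_trans (ler_wpM2r _ (ler_norm M))) ?exprn_ge0 ?(ltW t0) //.
    by rewrite ler_wpM2l // exprS ler_piMr ?(ltW t0) // exprn_ile1 ?(ltW t0).
  rewrite mulr_suml (le_trans (ler_norm_sum _ _ _)) // ler_sum // => i _.
  rewrite normrM /bump add1n ler_wpM2l // normrX gtr0_norm //.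
  by rewrite exprS ler_piMr ?(ltW t0) // exprn_ile1 ?(ltW t0).
have {}IH k : (k < n)%N -> c k.+1 = 0.
  apply: (IH (fun k => c k.+1)) => e e0d; have /andP[e0 _] := e0d.
  have := H e e0d; rewrite big_ord_recl c0 mul0r add0r exprS.
  have -> : \sum_(i < n) c (lift ord0 i) * e ^+ lift ord0 i = e * \sum_(k < n) c k.+1 * e ^+ k.
    by rewrite mulr_sumr; apply: eq_bigr => i _; rewrite /= /bump add1n exprS mulrCA.
  by rewrite normrM mulrCA ler_pM2l // normr_gt0 gt_eqF.
by case=> [|k] //; rewrite ltnS; exact: IH.
Qed.

End SmallPolynomial.

Section PhaseBasis.
Context {R : realType} {l : nat}.
Local Notation pt := (phase R l).

Definition eta_dir (i : 'I_l) : pt := (delta_mx 0 i, 0).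
Definition y_dir (i : 'I_l) : pt := (0, delta_mx 0 i).

Lemma phase_basis (v : pt) :
  v = \sum_i (v.1 0 i *: eta_dir i + v.2 0 i *: y_dir i).
Proof.
have fsum (f : 'I_l -> pt) : (\sum_i f i).1 = \sum_i (f i).1 by elim/big_rec2: _ => //= i a b _ ->.
have ssum (f : 'I_l -> pt) : (\sum_i f i).2 = \sum_i (f i).2 by elim/big_rec2: _ => //= i a b _ ->.
rewrite [LHS]surjective_pairing [RHS]surjective_pairing fsum ssum; congr (_, _).
  rewrite [LHS]row_sum_delta; apply: eq_bigr => i _.
  by rewrite /= scaler0 addr0.
rewrite [LHS]row_sum_delta; apply: eq_bigr => i _.
by rewrite /= scaler0 add0r.
Qed.

(** The definition of a canonical family provides only directional derivatives of the exactness
    primitive. Continuity of its partial derivatives upgrades them to a differential, by the mean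
    value theorem along the segment from [z] to [z + h]. *)
Lemma gateaux_frechet (f : pt -> R^o) (p q : 'I_l -> pt -> R) (z : pt) :
  (\forall y \near z, forall v,
     is_derive y v f (\sum_i (v.1 0 i * p i y + v.2 0 i * q i y))) ->
  (forall i, {for z, continuous (p i)}) -> (forall i, {for z, continuous (q i)}) ->
  differentiable f z.
Proof.
move=> df cp cq.
pose L (y v : pt) : R^o := \sum_i (v.1 0 i * p i y + v.2 0 i * q i y).
have Llin : linear (L z).
  move=> a u v; rewrite /L scaler_sumr -big_split; apply: eq_bigr => i _ /=.
  by rewrite !mxE /GRing.scale /=; ring.
pose LM := GRing.isLinear.Build R pt R^o *:%R (L z) Llin.
pose LL : {linear pt -> R^o} := HB.pack (L z) LM.
have vle (v : pt) i : `|v.1 0 i| <= `|v| /\ `|v.2 0 i| <= `|v|.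
  rewrite prod_normE !le_max; split; apply/orP; [left|right]; exact: coord_le_norm.
have dL : is_diff z f LL; last exact: ex_diff.
apply: is_diff_bound.
  apply: bounded_linear_continuous; apply/linear_boundedP.
  exists (\sum_i (`|p i z| + `|q i z|)); split; first exact: num_real.
  move=> r rM v; apply: le_trans (ler_wpM2r (normr_ge0 v) (ltW rM)).
  rewrite mulr_suml (le_trans (ler_norm_sum _ _ _)) // ler_sum // => i _.
  have [v1 v2] := vle v i.
  by rewrite (le_trans (ler_normD _ _)) // mulrDl !normrM lerD // mulrC ler_wpM2l.
(* There are [2 l] partial derivatives, each allowed an error [e']; adding 1 keeps the denominator
   positive. *)
move=> e e0; pose e' := e / (2 * l%:R + 1).
have e'0 : 0 < e' by rewrite divr_gt0 // ltr_wpDl // mulr_ge0 // ler0n.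
have near_i i : \forall y \near z, `|p i y - p i z| <= e' /\ `|q i y - q i z| <= e'.
  apply: filterI.
    by have /cvgrPdist_le/(_ _ e'0) := cp i; apply: filterS => y; rewrite distrC.
  by have /cvgrPdist_le/(_ _ e'0) := cq i; apply: filterS => y; rewrite distrC.
have near_z : \forall y \near z, (forall v, is_derive y v f (L y v)) /\
    forall i, `|p i y - p i z| <= e' /\ `|q i y - q i z| <= e'.
  by apply: filterI; [exact: df|exact: (@filter_forall pt _ (fun i y => `|p i y - p i z| <= e' /\ `|q i y - q i z| <= e') (nbhs z) _ near_i)].
move/nbhs_ballP: near_z => [d /= d0 Hd].
have : \forall h \near (0 : pt), `|h| < d by exact: nbhs0_lt.
apply: filterS => h hd.
have inball (c : R) : `|c| <= 1 -> ball z d (z + c *: h).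
  move=> c1; rewrite -ball_normE /= opprD addNKr normrN normrZ.
  by apply: le_lt_trans hd; rewrite ler_piMl.
pose g (t : R) : R := f (z + t *: h) - L z h * t.
have := @mean_value_bound R g (fun t => L (z + t *: h) h - L z h) 1 (e * `|h|).
rewrite normr1 [leRHS]mulr1 /g scale1r scale0r addr0 mulr0 subr0 mulr1 [X in `|X| <= _]addrAC; apply.
- move=> c c1; apply: is_deriveB; last first.
    by rewrite -[X in is_derive _ _ _ X]mulr1; exact: (is_deriveZ (f := id)).
  have [/(_ h) [dv dE] _] := Hd _ (inball c c1).
  have shiftE : (fun a : R => a^-1 *: (((fun t : R => f (z + t *: h) : R) \o shift c) (a *: 1) - f (z + c *: h)))
    = fun a => a^-1 *: ((f \o shift (z + c *: h)) (a *: h) - f (z + c *: h)).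
    apply/funext => a; congr (_ *: (f _ - _)).
    by rewrite /= scalerDl [_ *: 1]mulr1 addrCA.
  split; first by rewrite /derivable shiftE.
  by rewrite /derive shiftE.
- move=> c c1; have [_ pq] := Hd _ (inball c c1).
  rewrite /L -sumrB (@le_trans _ _ (\sum_(i < l) (2 * e') * `|h|)) //.
    rewrite (le_trans (ler_norm_sum _ _ _)) // ler_sum // => i _.
    have [h1 h2] := vle h i; have [p1 q1] := pq i.
    have -> : h.1 0 i * p i (z + c *: h) + h.2 0 i * q i (z + c *: h) -
        (h.1 0 i * p i z + h.2 0 i * q i z) =
        h.1 0 i * (p i (z + c *: h) - p i z) + h.2 0 i * (q i (z + c *: h) - q i z) by ring.
    have -> : 2 * e' * `|h| = `|h| * e' + `|h| * e' by ring.
    by rewrite (le_trans (ler_normD _ _)) // !normrM lerD // ler_pM.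
  have -> : \sum_(i < l) 2 * e' * `|h| = (l%:R * (2 * e')) * `|h| :> R.
    by rewrite sumr_const card_ord -[LHS]mulr_natl mulrA.
  rewrite ler_wpM2r // /e' !mulrA.
  rewrite ler_pdivrMr; last by rewrite ltr_wpDl // mulr_ge0 // ler0n.
  by clear -e0; move: (l%:R : R) => n; lra.
Qed.

End PhaseBasis.

(** * Tori of constant actions and their rotations *)

Section Torus.
Context {R : realType} {l : nat}.
Local Notation pt := (phase R l).
Local Notation E := (R^o * 'rV[R]_l)%type.

(** A vector of the kernel satisfies [v = - v (A - 1)]; with the given entries the sup norm of the
    right-hand side is at most [l / (2 l + 1)] times that of [v], and this factor is below 1/2. *)
Lemma near_one_unitmx (A : 'M[R]_l) :
  (forall i j, `|A i j - (i == j)%:R| <= (2 * l%:R + 1)^-1) -> A \in unitmx.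
Proof.
move=> HA; rewrite -row_free_unit; apply: inj_row_free => v vA0.
have [l0|l0] := posnP l; first by move: v {vA0 HA A}; rewrite l0 => v; rewrite [v]thinmx0.
have e0 : 0 < 2 * l%:R + 1 :> R by rewrite ltr_wpDl // mulr_ge0 // ler0n.
have vE i : v 0 i = - \sum_j v 0 j * (A j i - (j == i)%:R).
  have : (v *m A) 0 i = 0 by rewrite vA0 mxE.
  rewrite mxE => s0; under eq_bigr do rewrite mulrBr.
  rewrite sumrB s0 sub0r opprK (bigD1 i) //= eqxx mulr1 big1 ?addr0 // => j ji.
  by rewrite (negbTE ji) mulr0.
have vi i : `|v 0 i| <= 2^-1 * `|v|.
  rewrite vE normrN (le_trans (ler_norm_sum _ _ _)) //.
  apply: (@le_trans _ _ (\sum_(j < l) `|v| * (2 * l%:R + 1)^-1)).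
    by apply: ler_sum => j _; rewrite normrM ler_pM // coord_le_norm.
  have -> : \sum_(j < l) `|v| * (2 * l%:R + 1)^-1 = (l%:R / (2 * l%:R + 1)) * `|v| :> R.
    by rewrite sumr_const card_ord -[LHS]mulr_natl; ring.
  rewrite ler_wpM2r // ler_pdivrMr //; move: (l%:R : R) => n; lra.
have : `|v| <= 2^-1 * `|v|.
  rewrite [leLHS]mx_normrE; apply: bigmax_le => [|[i j] _ /=].
    by rewrite mulr_ge0.
  by rewrite ord1.
have := normr_ge0 v => n0 n1; apply/eqP; rewrite -normr_eq0; apply/eqP; lra.
Qed.

(** The velocity at [z] when the [i]-th plane rotates with angular speed [v i]: a vector tangent to
    the torus through [z]. *)
Definition rot_field (z : pt) (v : 'rV[R]_l) : pt :=
  (\row_i - (v 0 i * z.2 0 i), \row_i (v 0 i * z.1 0 i)).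

Lemma rot_field_basis z v : rot_field z v = \sum_j v 0 j *: rot_field z (delta_mx 0 j).
Proof.
have fsum (f : 'I_l -> pt) : (\sum_i f i).1 = \sum_i (f i).1 by elim/big_rec2: _ => //= i a b _ ->.
have ssum (f : 'I_l -> pt) : (\sum_i f i).2 = \sum_i (f i).2 by elim/big_rec2: _ => //= i a b _ ->.
rewrite [RHS]surjective_pairing fsum ssum; congr (_, _); apply/rowP => i;
  rewrite summxE (bigD1 i) //= big1 => [|j ji]; rewrite !mxE ?eqxx ?mul1r ?addr0 ?mulrN //;
  by rewrite eq_sym (negbTE ji) andbF !(mul0r, oppr0, mulr0).
Qed.

Lemma angle_form_rot_field z v : (forall i, 0 < actions z 0 i) -> angle_form z (rot_field z v) = v.
Proof.
move=> z0; apply/rowP => i; rewrite angle_formE.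
apply: (canLR (mulfK (lt0r_neq0 (z0 i)))).
by rewrite actionsE /cross /rot_field /= !mxE; ring.
Qed.

Lemma angle_form_sum z n (a : 'I_n -> R) (u : 'I_n -> pt) :
  angle_form z (\sum_j a j *: u j) = \sum_j a j *: angle_form z (u j).
Proof.
have fsum (f : 'I_n -> pt) : (\sum_i f i).1 = \sum_i (f i).1 by elim/big_rec2: _ => //= i c b _ ->.
have ssum (f : 'I_n -> pt) : (\sum_i f i).2 = \sum_i (f i).2 by elim/big_rec2: _ => //= i c b _ ->.
apply/rowP => i; rewrite angle_formE /cross fsum ssum !summxE.
rewrite !mulr_sumr -sumrB mulr_suml; apply: eq_bigr => j _.
by rewrite [in RHS]mxE angle_formE /cross /= !mxE; ring.
Qed.

Variable I : 'rV[R]_l.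
Hypothesis I0 : forall i, 0 < I 0 i.

Definition torus_point (x : 'rV[R]_l) : pt := action_angle (I, x).

Lemma actions_torus_point x : actions (torus_point x) = I.
Proof. by rewrite actions_action_angle // => i; exact: ltW. Qed.

Lemma torus_point_onto z : actions z = I -> torus_point (angle z) = z.
Proof.
move=> zI; rewrite /torus_point -zI action_angleK //.
by apply/phase_spaceP => i; rewrite zI.
Qed.

Lemma torus_point_periodic x k : torus_point (x + (2 * pi) *: zvec k) = torus_point x.
Proof.
have cosn (m : nat) b : cos (b + 2 * pi * m%:R) = cos b :> R.
  by rewrite mulr_natr mulrC mulr_natr; exact: (periodicn (@cosD2pi R)).
have sinn (m : nat) b : sin (b + 2 * pi * m%:R) = sin b :> R.
  by rewrite mulr_natr mulrC mulr_natr; exact: (periodicn (@sinD2pi R)).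
have per (n : int) b : cos (b + 2 * pi * n%:~R) = cos b :> R /\ sin (b + 2 * pi * n%:~R) = sin b :> R.
  case: n => m; first by split; [exact: cosn|exact: sinn].
  rewrite NegzE mulrNz mulrN; split.
    by have := cosn m.+1 (b - 2 * pi * m.+1%:R); rewrite subrK => ->.
  by have := sinn m.+1 (b - 2 * pi * m.+1%:R); rewrite subrK => ->.
rewrite /torus_point /action_angle /=; congr (_, _); apply/rowP => i;
  by have [c s] := per (k 0 i) (x 0 i); rewrite !mxE ?c ?s.
Qed.

Lemma diff_torus_point x : differentiable torus_point x /\
  forall v, 'D_v torus_point x = rot_field (torus_point x) v.
Proof.
have dx i : differentiable (fun y : 'rV[R]_l => y 0 i : R^o) x /\
    forall v, 'D_v (fun y : 'rV[R]_l => y 0 i : R^o) x = v 0 i.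
  have [d dE] := @diff_coord R l _ (fun y : 'rV[R]_l => y) x i (@linear_differentiable _ _ _ idfun x (fun y => cvg_id)).
  by split=> // v; rewrite dE derive_id.
have ds i : differentiable (fun y : 'rV[R]_l => - (Num.sqrt (I 0 i) * sin (y 0 i)) : R^o) x /\
    forall v, 'D_v (fun y : 'rV[R]_l => - (Num.sqrt (I 0 i) * sin (y 0 i)) : R^o) x =
      - (v 0 i * (torus_point x).2 0 i).
  have [dxi xiE] := dx i.
  have [d1 e1] := chain_rule (is_derive_sin _) dxi.
  split.
    apply: (@differentiableN _ _ _ (fun y : 'rV[R]_l => Num.sqrt (I 0 i) * sin (y 0 i) : R^o)).
    exact: (@differentiableZ _ _ _ (fun y : 'rV[R]_l => sin (y 0 i) : R^o)).
  move=> v; have dd := @diff_derivable _ _ _ _ _ v d1.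
  rewrite (@deriveN _ _ _ (fun y : 'rV[R]_l => Num.sqrt (I 0 i) * sin (y 0 i) : R^o)); last first.
    exact: (@derivableZ _ _ _ (fun y : 'rV[R]_l => sin (y 0 i) : R^o)).
  rewrite (@deriveZ _ _ _ (fun y : 'rV[R]_l => sin (y 0 i) : R^o)) // e1 xiE !mxE.
  by rewrite /GRing.scale /=; ring.
have dc i : differentiable (fun y : 'rV[R]_l => Num.sqrt (I 0 i) * cos (y 0 i) : R^o) x /\
    forall v, 'D_v (fun y : 'rV[R]_l => Num.sqrt (I 0 i) * cos (y 0 i) : R^o) x =
      v 0 i * (torus_point x).1 0 i.
  have [dxi xiE] := dx i.
  have [d1 e1] := chain_rule (is_derive_cos _) dxi.
  split; first exact: (@differentiableZ _ _ _ (fun y : 'rV[R]_l => cos (y 0 i) : R^o)).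
  move=> v; have dd := @diff_derivable _ _ _ _ _ v d1.
  rewrite (@deriveZ _ _ _ (fun y : 'rV[R]_l => cos (y 0 i) : R^o)) // e1 xiE !mxE.
  by rewrite /GRing.scale /=; ring.
have d1 : differentiable (fun y : 'rV[R]_l => \row_i - (Num.sqrt (I 0 i) * sin (y 0 i)) : 'rV[R]_l) x.
  by apply: differentiable_row => i; have [] := ds i.
have d2 : differentiable (fun y : 'rV[R]_l => \row_i (Num.sqrt (I 0 i) * cos (y 0 i)) : 'rV[R]_l) x.
  by apply: differentiable_row => i; have [] := dc i.
split; first exact: differentiable_pair.
move=> v; apply: etrans (derive_pair _ d1 d2) _; congr (_, _).
  rewrite (derive_row (f := fun (y : 'rV[R]_l) i => - (Num.sqrt (I 0 i) * sin (y 0 i)))).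
    by apply/rowP => i; rewrite [LHS]mxE [RHS]mxE; have [_ ->] := ds i.
  by move=> i; have [] := ds i.
rewrite (derive_row (f := fun (y : 'rV[R]_l) i => Num.sqrt (I 0 i) * cos (y 0 i))).
  by apply/rowP => i; rewrite [LHS]mxE [RHS]mxE; have [_ ->] := dc i.
by move=> i; have [] := dc i.
Qed.

Lemma torus_compact : compact [set z : pt | actions z = I].
Proof.
have -> : [set z : pt | actions z = I] =
    torus_point @` [set v : 'rV[R]_l | forall i, 0 <= v 0 i <= 2 * pi].
  apply/seteqP; split=> [z zI|_ [x _ <-]]; last exact: actions_torus_point.
  exists (angle z); last exact: torus_point_onto.
  move=> i; have pz : phase_space z by apply/phase_spaceP => k; rewrite zI.
  by have [_ /andP[-> /ltW ->]] := action_angle_inv_dom pz i.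
apply: continuous_compact; last exact: cube_compact.
apply: continuous_subspaceT => x; apply: differentiable_continuous.
by have [] := diff_torus_point x.
Qed.

End Torus.

Section CvgCoordinates.
Context {R : realType} {T : Type} (F : set_system T) {FF : Filter F}.

Lemma cvg_fst_comp (A B : normedModType R) (f : T -> A * B) (a : A * B) :
  f @ F --> a -> (fun y => (f y).1) @ F --> a.1.
Proof.
move=> cf; apply: (@cvg_comp _ _ _ f fst F (nbhs a) (nbhs a.1) cf).
by apply: cvg_fst.
Qed.

Lemma cvg_snd_comp (A B : normedModType R) (f : T -> A * B) (a : A * B) :
  f @ F --> a -> (fun y => (f y).2) @ F --> a.2.
Proof.
move=> cf; apply: (@cvg_comp _ _ _ f snd F (nbhs a) (nbhs a.2) cf).
by apply: cvg_snd.
Qed.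

Lemma cvg_coord l (f : T -> 'rV[R]_l) (a : 'rV[R]_l) i :
  f @ F --> a -> (fun y => f y 0 i : R) @ F --> a 0 i.
Proof.
move=> cf; apply: (@cvg_comp _ _ _ f (fun M : 'rV[R]_l => M 0 i) F (nbhs a) (nbhs (a 0 i)) cf).
exact: coord_continuous.
Qed.

Lemma cvg_ord_sum n (f : 'I_n -> T -> R) (a : 'I_n -> R) :
  (forall i, f i y @[y --> F] --> a i) -> (\sum_i f i y) @[y --> F] --> \sum_i a i.
Proof.
move=> fa; elim: (index_enum _) => [|i s IH].
  rewrite big_nil (_ : (fun y => _) = cst 0); first exact: cvg_cst.
  by apply/funext => y; rewrite big_nil.
rewrite big_cons (_ : (fun y => _) = fun y => f i y + \sum_(j <- s) f j y).
  exact: cvgD.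
by apply/funext => y; rewrite big_cons.
Qed.

End CvgCoordinates.

(** * An extremal point on a torus *)

Section TorusExtremum.
Context {R : realType} {l : nat}.
Local Notation pt := (phase R l).
Local Notation E := (R^o * 'rV[R]_l)%type.
Variables (I omega : 'rV[R]_l) (h : E -> R^o) (s0 : R) (C : pt -> pt) (S : pt -> R).
Hypotheses (I0 : forall i, 0 < I 0 i) (hh : in_span h).

(** The identity [d(eta y) - 2 y d(eta) = xi dx]. The factor 2 stems from [xi = eta^2 + y^2], which
    is twice the area-normalized action. *)
Lemma liouville_double (z v : pt) : (forall i, 0 < actions z 0 i) ->
  \sum_i (z.1 0 i * v.2 0 i + z.2 0 i * v.1 0 i) - 2 * liouville z v =
  dot (actions z) (angle_form z v).
Proof.
move=> z0; rewrite /liouville /dot mulr_sumr -sumrB; apply: eq_bigr => i _.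
by rewrite angle_formE [actions z 0 i * _]mulrC divfK ?gt_eqF // /cross; ring.
Qed.

Lemma liouville_diff z : (\forall y \near z, differentiable C y /\
    forall v, is_derive y v (S : pt -> R^o) (liouville (C y) ('D_v C y) - liouville y v)) ->
  (forall i, {for z, continuous (fun y => 'D_(eta_dir i) C y)}) ->
  (forall i, {for z, continuous (fun y => 'D_(y_dir i) C y)}) ->
  differentiable (S : pt -> R^o) z /\
  forall v, 'D_v (S : pt -> R^o) z = liouville (C z) ('D_v C z) - liouville z v.
Proof.
move=> Sz ce cy; have [dC SD] := nbhs_singleton Sz.
have cC : {for z, continuous C} by exact: differentiable_continuous.
have cid : {for z, continuous (fun y : pt => y)} by exact: cvg_id.
have cli (f g : pt -> pt) : {for z, continuous f} -> {for z, continuous g} ->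
    {for z, continuous (fun y => liouville (f y) (g y))}.
  move=> cf cg; rewrite /liouville /dot; apply: cvg_ord_sum => i.
  by apply: cvgM; apply: cvg_coord; [exact: cvg_snd_comp|exact: cvg_fst_comp].
have ccst (v : pt) : {for z, continuous (fun=> v : pt)} by exact: cvg_cst.
split; last by move=> v; have [_ ->] := SD v.
apply: (@gateaux_frechet R l (S : pt -> R^o)
  (fun i y => liouville (C y) ('D_(eta_dir i) C y) - liouville y (eta_dir i))
  (fun i y => liouville (C y) ('D_(y_dir i) C y) - liouville y (y_dir i))).
- apply: filterS Sz => y [dCy SDy] v.
  have liD (a u u' : pt) : liouville a (u + u') = liouville a u + liouville a u'.
    rewrite /liouville /dot -big_split; apply: eq_bigr => i _ /=.
    by rewrite !mxE mulrDr.
  have liZ (a u : pt) (k : R) : liouville a (k *: u) = k * liouville a u.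
    rewrite /liouville /dot mulr_sumr; apply: eq_bigr => i _ /=.
    by rewrite !mxE mulrCA.
  have liS (a : pt) (f : 'I_l -> pt) : liouville a (\sum_i f i) = \sum_i liouville a (f i).
    elim/big_rec2: _ => [|i x u _ IH]; last by rewrite liD IH.
    by rewrite /liouville /dot big1 // => i _; rewrite mxE mulr0.
  apply: is_derive_eq (SDy v) _.
  have liE (a : pt) (L : {linear pt -> pt}) : liouville a (L v) =
      \sum_i (v.1 0 i * liouville a (L (eta_dir i)) + v.2 0 i * liouville a (L (y_dir i))).
    rewrite [X in liouville _ (L X)](phase_basis v) linear_sum liS; apply: eq_bigr => i _.
    by rewrite linearD !linearZ /= liD !liZ.
  rewrite deriveE // liE (liE y idfun) -sumrB; apply: eq_bigr => i _ /=.
  by rewrite -!deriveE // !mulrBr opprD addrACA.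
- by move=> i; apply: cvgB; apply: cli.
- by move=> i; apply: cvgB; apply: cli.
Qed.

Hypothesis canonical_near : forall z, actions z = I -> \forall y \near z, differentiable C y /\
    forall v, is_derive y v (S : pt -> R^o) (liouville (C y) ('D_v C y) - liouville y v).
Hypothesis continuous_eta : forall z, actions z = I ->
  forall i, {for z, continuous (fun y => 'D_(eta_dir i) C y)}.
Hypothesis continuous_y : forall z, actions z = I ->
  forall i, {for z, continuous (fun y => 'D_(y_dir i) C y)}.
Hypothesis inner_gt0 : forall z, actions z = I -> forall i, 0 < inner z (C z) i.
Hypothesis angle_jacobian : forall z, actions z = I -> forall i j : 'I_l,
  `|angle_form (C z) ('D_(rot_field z (delta_mx 0 i)) C z) 0 j - (i == j)%:R| <= (2 * l%:R + 1)^-1.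

(* On the torus actions = I, the derivative of g along u is
   <xi - I - grad h, X> with xi the actions of C z and X the derivative of its
   angles; u is chosen such that X = omega. *)
Let g (z : pt) : R^o :=
  \sum_i ((C z).1 0 i * (C z).2 0 i) - \sum_i (z.1 0 i * z.2 0 i) - 2 * S z
  - \sum_i I 0 i * turn z (C z) 0 i - h (s0, angle (C z)).

(** By [liouville_double] at [C z] and at [z], the first three terms of [g] contribute
    [<xi, X> - <I, dx(u)>]; the turn contributes [- <I, X> + <I, dx(u)>], which cancels the angle
    form at [z]. The turn is used because it is a single-valued determination of the displacement of
    the angles. *)
Let diff_g z : actions z = I -> differentiable g z /\ forall u,
  'D_u g z = dot (actions (C z)) (angle_form (C z) ('D_u C z))
    - dot I (angle_form (C z) ('D_u C z))
    - 'D_((0, angle_form (C z) ('D_u C z)) : E) h (s0, angle (C z)).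
Proof.
move=> zI.
have [dC _] := nbhs_singleton (canonical_near zI).
have pz i : 0 < actions z 0 i by rewrite zI.
have pC i : 0 < actions (C z) 0 i by have [] := inner_gt0_actions (inner_gt0 zI i).
have [dS SE] := liouville_diff (canonical_near zI) (continuous_eta zI) (continuous_y zI).
have did : differentiable (fun y : pt => y) z.
  by apply: (@linear_differentiable _ _ _ idfun) => y; exact: cvg_id.
have [d1 e1] := diff_eta_y dC; have [d2 e2] := diff_eta_y did.
have [d3 e3] := diff_mul (differentiable_cst (2 : R^o) z) dS.
have [dt tE] := diff_turn did dC (inner_gt0 zI).
have d4i i := diff_mul (differentiable_cst (I 0 i : R^o) z) (diff_coord i dt).1.
have [d4 e4] := diff_sum (fun i => (d4i i).1).
have pCz : phase_space (C z) by apply/phase_spaceP.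
have [d5 e5] := angle_comp omega hh (differentiable_cst (s0 : R^o) z) dC
  (differentiable_cst (0 : R^o) z) pCz.
have [d12 e12] := diff_sub d1 d2.
have [d123 e123] := diff_sub d12 d3.
have [d1234 e1234] := diff_sub d123 d4.
have [d e] := diff_sub d1234 d5.
have gE : (fun w => \sum_i ((C w).1 0 i * (C w).2 0 i) - \sum_i (w.1 0 i * w.2 0 i) -
    cst 2 w * S w - \sum_i cst (I 0 i) w * turn w (C w) 0 i -
    h (cst s0 w, angle (C w) - cst 0 w *: omega)) = g.
  by apply/funext => w; rewrite /g /= scale0r subr0.
rewrite gE in d e; split=> // u.
rewrite e e1234 e123 e12 e1 e2 e3 e4 e5 !derive_cst SE derive_id scale0r subr0.
rewrite subr0 /cst; congr (_ - _).
have -> : \sum_i 'D_u (fun w => I 0 i * turn w (C w) 0 i : R^o) z =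
    dot I (angle_form (C z) ('D_u C z)) - dot I (angle_form z u).
  rewrite /dot -sumrB; apply: eq_bigr => i _.
  rewrite [LHS](d4i i).2 derive_cst mulr0 addr0 (diff_coord i dt).2 tE derive_id.
  by rewrite -mulrBr; congr (_ * _); rewrite !mxE.
have E1 := liouville_double ('D_u C z) pC; have E2 := liouville_double u pz.
rewrite zI in E2; rewrite -E1 -E2 mulr0 addr0.
set x1 := dot I _; set x2 := liouville _ _; set x3 := liouville _ _.
set x4 := \sum_i _; set x5 := \sum_i _.
by move: x1 x2 x3 x4 x5 => *; ring.
Qed.

Lemma torus_extremum : exists z, actions z = I /\
  dot omega (actions (C z)) = dot omega I + 'D_((0, omega) : E) h (s0, angle (C z)).
Proof.
have [x|x k|c [_ cmax]] := @periodic_max R l (fun x => g (torus_point I x)).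
- have [dt _] := diff_torus_point I x; have [dg _] := diff_g (actions_torus_point I0 x).
  exact: (@differentiable_comp _ _ _ _ (torus_point I) g).
- by rewrite torus_point_periodic.
have zI := actions_torus_point I0 c; set z := torus_point I c in zI.
exists z; split=> //.
have [dC _] := nbhs_singleton (canonical_near zI).
have [dt tE] := diff_torus_point I c; have [dg gE] := diff_g zI.
pose A : 'M[R]_l := \matrix_(i, j) angle_form (C z) ('D_(rot_field z (delta_mx 0 i)) C z) 0 j.
have Au : A \in unitmx by apply: near_one_unitmx => i j; rewrite mxE; exact: angle_jacobian.
(* Row [i] of [A] is the velocity of the angles of [C z] when the [i]-th plane rotates; with
   [v A = omega] these angles move with velocity [omega]. *)
pose v := omega *m invmx A.
have XE : angle_form (C z) ('D_(rot_field z v) C z) = omega.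
  rewrite -[RHS](mulmxKV Au) -/v rot_field_basis deriveE // linear_sum.
  under eq_bigr do rewrite linearZ.
  rewrite angle_form_sum; apply/rowP => j; rewrite [RHS]mxE summxE; apply: eq_bigr => i _.
  by rewrite !mxE -deriveE // mxE.
have := cmax v; rewrite (@derive_comp _ _ _ _ (torus_point I) g) // tE -/z gE XE.
have dC' (a b : 'rV[R]_l) : dot a b = dot b a by apply: eq_bigr => i _; rewrite mulrC.
by rewrite (dC' _ omega) (dC' I) => /eqP; rewrite -addrA -opprD subr_eq0 => /eqP ->.
Qed.

End TorusExtremum.

Section CvgPhase.
Context {R : realType} {l : nat} {T : Type} (F : set_system T) {FF : Filter F}.
Local Notation pt := (phase R l).
Variables (f g : T -> pt) (a b : pt).
Hypotheses (fa : f @ F --> a) (gb : g @ F --> b).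

Lemma cvg_eta i : (f y).1 0 i @[y --> F] --> (a.1 0 i : R).
Proof. exact: (cvg_coord (cvg_fst_comp fa)). Qed.

Lemma cvg_y i : (f y).2 0 i @[y --> F] --> (a.2 0 i : R).
Proof. exact: (cvg_coord (cvg_snd_comp fa)). Qed.

End CvgPhase.

Section CvgForms.
Context {R : realType} {l : nat} {T : Type} (F : set_system T) {FF : Filter F}.
Local Notation pt := (phase R l).
Variables (f g : T -> pt) (a b : pt).
Hypotheses (fa : f @ F --> a) (gb : g @ F --> b).

Lemma cvg_inner i : inner (f y) (g y) i @[y --> F] --> (inner a b i : R).
Proof. by apply: cvgD; apply: cvgM; first [exact: cvg_eta|exact: cvg_y]. Qed.

Lemma cvg_cross i : cross (f y) (g y) i @[y --> F] --> (cross a b i : R).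
Proof. by apply: cvgB; apply: cvgM; first [exact: cvg_eta|exact: cvg_y]. Qed.

Lemma cvg_actions i : actions (f y) 0 i @[y --> F] --> (actions a 0 i : R).
Proof.
rewrite (_ : (fun y => _) = fun y => (f y).1 0 i * (f y).1 0 i + (f y).2 0 i * (f y).2 0 i); last first.
  by apply/funext => y; rewrite actionsE !expr2.
by rewrite actionsE !expr2; apply: cvgD; apply: cvgM; first [exact: cvg_eta|exact: cvg_y].
Qed.

Lemma cvg_angle_form i : actions a 0 i != 0 ->
  angle_form (f y) (g y) 0 i @[y --> F] --> (angle_form a b 0 i : R).
Proof.
move=> a0; rewrite (_ : (fun y => _) = fun y => cross (f y) (g y) i / actions (f y) 0 i); last first.
  by apply/funext => y; rewrite angle_formE.
by rewrite angle_formE; apply: cvgM; [exact: cvg_cross|apply: cvgV => //; exact: cvg_actions].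
Qed.

End CvgForms.

Section Uniqueness.
Context {R : realType} {l : nat}.
Local Notation pt := (phase R l).
Local Notation E := (R^o * 'rV[R]_l)%type.
Implicit Types (z : pt).

Lemma phase_space_near z : phase_space z -> \forall y \near z, phase_space y.
Proof.
move=> /phase_spaceP pz.
have : \forall y \near z, forall i, 0 < actions y 0 i.
  apply: (@filter_forall pt _ (fun i y => 0 < actions y 0 i) (nbhs z) _) => i.
  have ca : (fun y : pt => actions y 0 i) @ nbhs z --> (actions z 0 i : R).
    by apply: (@cvg_actions R l pt (nbhs z) _ (fun y => y) z); exact: cvg_id.
  by apply: (cvgr_gt _ ca); exact: pz.
by apply: filterS => y yp; apply/phase_spaceP.
Qed.

Lemma differentiable_slice (e : R) z : differentiable (fun z : pt => (e, z) : R^o * pt) z.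
Proof.
apply: differentiable_pair; first exact: differentiable_cst.
exact: (@linear_differentiable _ _ _ idfun _ (fun y => cvg_id)).
Qed.

(** * Canonical families near a torus *)

Section NearIdentity.
Variables (U : set (R^o * pt)) (C : R -> pt -> pt) (can : canonical_near_id U C).
Local Notation Cf := (fun w : R^o * pt => C w.1 w.2).

Lemma canonical_differentiable w : U w -> differentiable Cf w.
Proof. by move=> Uw; have [_ sm _ _ _] := can; have [d _] := sm 1%N; exact: d. Qed.

Lemma canonical_derive_continuous w v : U w -> {for w, continuous (fun w => 'D_v Cf w)}.
Proof.
move=> Uw; have [_ sm _ _ _] := can; have [_ /(_ v) [d _]] := sm 2%N.
by apply: differentiable_continuous; exact: d.
Qed.

Lemma canonical_slice e z : U (e, z) -> differentiable (C e) z.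
Proof.
move=> Uw; apply: (@differentiable_comp _ _ _ _ (fun z => (e, z) : R^o * pt) Cf).
  exact: differentiable_slice.
exact: canonical_differentiable.
Qed.

Lemma canonical_slice_derive_continuous e z v : U (e, z) ->
  {for z, continuous (fun y => 'D_v (C e) y)}.
Proof.
move=> Uw.
have -> : (fun y => 'D_v (C e) y) = (fun w => 'D_((0, v) : R^o * pt) Cf w) \o (fun y => (e, y)).
  by apply/funext => y; rewrite /= -(derive_slice Cf).
apply: (@continuous_comp _ _ _ (fun y : pt => (e, y) : R^o * pt)).
  exact: differentiable_continuous (differentiable_slice e z).
exact: canonical_derive_continuous.
Qed.

Lemma canonical_derive0 z v : phase_space z -> 'D_((0, v) : R^o * pt) Cf (0, z) = v.
Proof.
move=> pz; rewrite -(derive_slice Cf) /=.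
have [_ _ C0 _ _] := can.
have : \forall y \near z, y = C 0 y by apply: filterS (phase_space_near pz) => y /C0.
by move=> /(near_eq_derive v) <-; rewrite derive_id.
Qed.

(** At [e = 0] the map is the identity, where [inner z z] is the positive action and the matrix of
    angular velocities is the unit matrix. Joint continuity of the first derivatives extends this to
    a neighbourhood of each point, and compactness of the torus gives a common range of [e]. *)
Lemma near_torus (I : 'rV[R]_l) : (forall i, 0 < I 0 i) ->
  \forall e \near (0 : R), forall z, actions z = I ->
  [/\ U (e, z), forall i, 0 < inner z (C e z) i &
   forall i j : 'I_l,
   `|angle_form (C e z) ('D_(rot_field z (delta_mx 0 i)) (C e) z) 0 j - (i == j)%:R| <= (2 * l%:R + 1)^-1].
Proof.
move=> I0.
have [[oU U0] _ C0 _ _] := can.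
have /compact_near_coveringP/(_ R (nbhs (0 : R))
  (fun e z => [/\ U (e, z), forall i, 0 < inner z (C e z) i &
   forall i j : 'I_l,
   `|angle_form (C e z) ('D_(rot_field z (delta_mx 0 i)) (C e) z) 0 j - (i == j)%:R| <= (2 * l%:R + 1)^-1])) := torus_compact I0.
apply => z /= zI.
have pz i : 0 < actions z 0 i by rewrite zI.
have phz : phase_space z by apply/phase_spaceP.
pose F := filter_prod (nbhs z) (nbhs (0 : R)).
have FF : Filter F by apply: filter_prod_filter.
pose sw (p : pt * R) : R^o * pt := (p.2, p.1).
have csw : sw @ F --> nbhs ((0, z) : R^o * pt) 
  by move=> P [[A B] /= [A0 Bz] sub]; exists (B, A) => //= -[y e] [/= By Ae]; apply: (sub (e, y)).
have c1 : (fun p : pt * R => p.1) @ F --> z by exact: cvg_fst.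
have Fd (f : R^o * pt -> pt) : {for (0, z), continuous f} -> f \o sw @ F --> f (0, z).
  by move=> cf; exact: cvg_comp csw cf.
have cC := Fd Cf (differentiable_continuous (canonical_differentiable (U0 _ phz))).
have cD v := Fd _ (@canonical_derive_continuous (0, z) v (U0 _ phz)).
rewrite /= C0 // in cC.
have nU : \forall p \near F, U (p.2, p.1).
  by apply: csw; apply: open_nbhs_nbhs; split=> //; exact: U0.
have nin : \forall p \near F, forall i, 0 < inner p.1 (C p.2 p.1) i.
  apply: (@filter_forall _ _ (fun i (p : pt * R) => 0 < inner p.1 (C p.2 p.1) i) F _) => i.
  have ci : inner p.1 (C p.2 p.1) i @[p --> F] --> (inner z z i : R) by exact: cvg_inner.
  by apply: (cvgr_gt _ ci); move: (pz i); rewrite actionsE /inner !expr2.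
(* The derivative along [rot_field] expanded in constant directions, since continuity of the
   derivative is available for fixed directions only. *)
pose comb i (p : pt * R) : pt := - p.1.2 0 i *: 'D_((0, eta_dir i) : R^o * pt) Cf (p.2, p.1)
  + p.1.1 0 i *: 'D_((0, y_dir i) : R^o * pt) Cf (p.2, p.1).
have rotE (y : pt) i : rot_field y (delta_mx 0 i) = - y.2 0 i *: eta_dir i + y.1 0 i *: y_dir i.
  congr (_, _); apply/rowP => j; rewrite !mxE /= ?mulr0 ?addr0 ?add0r.
    by case: eqP => [->|_]; rewrite ?andbF ?mul0r ?mulr0 ?oppr0 ?mul1r ?mulr1.
  by case: eqP => [->|_]; rewrite ?andbF ?mul0r ?mulr0 ?mul1r ?mulr1.
have ccomb i : comb i p @[p --> F] --> rot_field z (delta_mx 0 i).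
  rewrite rotE -[X in _ *: X + _](canonical_derive0 (eta_dir i) phz).
  rewrite -[X in _ + _ *: X](canonical_derive0 (y_dir i) phz).
  apply: cvgD; apply: cvgZ; try exact: cD.
    by apply: cvgN; exact: cvg_y.
  exact: cvg_eta.
have njac : \forall p \near F, forall ij : 'I_l * 'I_l,
    `|angle_form (C p.2 p.1) (comb ij.1 p) 0 ij.2 - (ij.1 == ij.2)%:R| <= (2 * l%:R + 1)^-1.
  apply: (@filter_forall _ _ (fun ij (p : pt * R) =>
    `|angle_form (C p.2 p.1) (comb ij.1 p) 0 ij.2 - (ij.1 == ij.2)%:R| <= (2 * l%:R + 1)^-1) F _) => -[i j] /=.
  have ca : angle_form (C p.2 p.1) (comb i p) 0 j @[p --> F] --> ((i == j)%:R : R).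
    have -> : (i == j)%:R = angle_form z (rot_field z (delta_mx 0 i)) 0 j.
      by rewrite angle_form_rot_field // mxE eqxx eq_sym.
    by apply: cvg_angle_form => //; rewrite gt_eqF.
  have e0 : 0 < (2 * l%:R + 1)^-1 :> R.
    by rewrite invr_gt0 ltr_wpDl // mulr_ge0 // ler0n.
  by have /cvgrPdist_le/(_ _ e0) := ca; apply: filterS => p; rewrite distrC.
apply: filterS3 nU nin njac => -[y e] /= Uw yin yj; split=> // i j.
have := yj (i, j); rewrite /= /comb /=.
have dCy := canonical_slice Uw.
have -> : 'D_(rot_field y (delta_mx 0 i)) (C e) y =
    - y.2 0 i *: 'D_((0, eta_dir i) : R^o * pt) Cf (e, y)
  + y.1 0 i *: 'D_((0, y_dir i) : R^o * pt) Cf (e, y).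
  by rewrite rotE -!(derive_slice Cf) /= !deriveE // linearD !linearZ.
by [].
Qed.

End NearIdentity.

Lemma hamiltonian_at omega (V : R -> 'rV[R]_l -> R) e z : phase_space z ->
  hamiltonian0 omega z + e * hamiltonian1 omega V z =
  dot omega (actions z) + e * V (dot omega (actions z)) (angle z).
Proof. by move=> pz; rewrite hamiltonian0E hamiltonian1E. Qed.

(** At the extremal point the value of [<omega, xi>] is [s + D], with [D] taken at the angle of
    [C e z] itself. The Hamiltonian there is thus the quantity estimated by [residual_bound], and by
    the hypothesis it is also close to the partial sum of [B]; with the actions [I] fixed, this
    holds for all small [e]. *)
Lemma normal_form_unique (omega : 'rV[R]_l) (V : R -> 'rV[R]_l -> R)
    (b : nat -> R -> R) (S : nat -> E -> R^o) (B : nat -> 'rV[R]_l -> R) :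
  in_span (fun w : E => V w.1 w.2 : R^o) ->
  formal_solution omega (fun w : E => V w.1 w.2) b S ->
  birkhoff_normal_form (hamiltonian0 omega) (hamiltonian1 omega V) B ->
  forall k z, phase_space z -> B k.+1 (actions z) = b k.+1 (dot omega (actions z)).
Proof.
move=> hh sol nf k z pz.
have I0 : forall i, 0 < actions z 0 i by apply/phase_spaceP.
move: (actions z) I0 => I I0 {z pz}.
have [U [C [can HM]]] := nf k.+1.
have subK : [set y : pt | actions y = I] `<=` phase_space.
  by move=> y /= yI; apply/phase_spaceP => i; rewrite yI.
have [M HMK] := HM _ (torus_compact I0) subK.
have [Cr resid] := residual_bound hh sol k.+1.
(* Both forms have the same term [<omega, I>] of order 0, so the difference starts at order 1. *)
pose c j := if j == 0%N then 0 else B j I - b j (dot omega I).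
suff /(_ k.+1 (ltnSn _)) : forall j, (j < k.+2)%N -> c j = 0 by move/subr0_eq.
apply: (@small_poly_eq0 R k.+2 c (M + Cr)).
have n1 : \forall e \near (0 : R), `|e| <= 1 by exact: nbhs0_le.
apply: filterS3 n1 (near_torus can I0) HMK => e e1 torus HMe.
have [[oU _] sm _ pU [Sg SgP]] := can.
have spS j : in_span (S j) by have [] := sol.
pose h (w : E) : R^o := \sum_(j < k.+2) e ^+ j * S j w.
have hspan : in_span h.
  by apply: in_span_sum => j _; apply: in_spanZ.
have [||y yI|y yI i|y yI i|y yI i|y yI i j|z [zI]] :=
  @torus_extremum R l I omega h (dot omega I) (C e) (Sg e).
- exact: I0.
- exact: hspan.
- have [Uy _ _] := torus y yI.
  have near_y : \forall x \near y, U (e, x).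
    have ce : (fun x : pt => (e, x) : R^o * pt) @ y --> ((e, y) : R^o * pt).
      exact: differentiable_continuous (differentiable_slice e y).
    by have := ce U (open_nbhs_nbhs (conj oU Uy)).
  apply: filterS near_y => x Ux; split; first exact: canonical_slice can _ _ Ux.
  by move=> v; exact: SgP.
- by have [Uy _ _] := torus y yI; exact: (canonical_slice_derive_continuous can).
- by have [Uy _ _] := torus y yI; exact: (canonical_slice_derive_continuous can).
- by have [_ iy _] := torus y yI.
- by have [_ _ jy] := torus y yI.
set w : E := (dot omega I, angle (C e z)).
have -> : 'D_((0, omega) : E) h w = truncated_slope omega S k.+1 e w.
  have dt (j : 'I_k.+2) := diff_mul (differentiable_cst (e ^+ j : R^o) w)
    (in_span_differentiable (spS j) w).
  have [_ hE] := diff_sum (fun j => (dt j).1).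
  rewrite [LHS]hE; apply: eq_bigr => j _.
  by rewrite (dt j).2 derive_cst mulr0 addr0.
move=> tE.
have [Uz _ _] := torus z zI; have [_ pCz] := pU _ _ Uz.
have := HMe z zI; rewrite hamiltonian_at // tE /birkhoff_partial_sum hamiltonian0E zI.
have := resid e w e1; rewrite /=.
set X := dot omega I + _ + _; set sb := \sum_(1 <= j < _) _; set sB := \sum_(1 <= j < _) _.
move=> Xb XB; have -> : \sum_(j < k.+2) c j * e ^+ j = sB - sb.
  rewrite /sB /sb -sumrB big_ord_recl /c /= mul0r add0r big_add1 /= big_mkord.
  by apply: eq_bigr => j _; rewrite mulrBl.
rewrite (_ : sB - sb = (X - (dot omega I + sb)) - (X - (dot omega I + sB))); last by ring.
by rewrite (le_trans (ler_normB _ _)) // mulrDl addrC lerD.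
Qed.

End Uniqueness.

(** * Existence of the normal form *)

Section ImplicitFunction.
Context {R : realType} {W : normedModType R}.
Variables (F : W * R^o -> R^o) (r : W -> R^o) (w0 : W).
Hypothesis dF : differentiable F (w0, r w0).
Hypothesis rF : \forall w \near w0, r w = F (w, r w).
Hypothesis F_contract : \forall w \near w0, forall a b, `|F (w, a) - F (w, b)| <= 2^-1 * `|a - b|.

(** Continuity of [r] is not assumed: the contraction bounds the increment of [r] by twice that of
    [F] at the fixed second argument [r w0]. With this Lipschitz bound at [w0], the candidate
    differential is the solution of [(1 - a) M h = L (h, 0)], where [a] is the derivative of [F] in
    its last variable. *)
Lemma implicit_differentiable : differentiable r w0.
Proof.
pose r0 : R := r w0; pose p0 : W * R^o := (w0, r0); have dFp : differentiable F p0 := dF.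
pose L : {linear (W * R^o)%type -> R^o} := 'd F p0.
have cL : continuous L by exact: diff_continuous.
pose a : R := L (0, 1).
have LE h d : L (h, d) = L (h, 0) + d * a.
  have -> : (h, d) = (h, 0) + d *: ((0, 1) : W * R^o).
    by congr (_, _); rewrite /= ?scaler0 ?addr0 ?add0r // [_ *: _]mulr1.
  by rewrite linearD linearZ.
have [k k0 Lk] : exists2 k, 0 < k & forall x, `|L x| <= k * `|x|.
  have /linear_boundedP [k0 [_ Hk]] := continuous_linear_bounded 0 (cL 0).
  exists (`|k0| + 1); first by rewrite ltr_wpDl.
  by move=> x; apply: Hk; rewrite (le_lt_trans (ler_norm _)) // ltrDl.
have diffE e : 0 < e -> exists2 d, 0 < d & forall h t, `|h| < d -> `|t| < d ->
    `|F (w0 + h, r0 + t) - F (w0, r0) - L (h, t)| <= e * Num.max `|h| `|t|.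
  move=> e0; have /nbhs_ballP [d /= d0 Hd] := diff_bound dFp e0.
  exists d => // h t hd td; have := Hd (h, t); apply.
  by split; rewrite /= -ball_normE /= sub0r normrN.
(* The contraction contributes 1/2 and the error of the differential, taken as 1/4, the rest; this
   keeps [1 - a] at least 1/4. *)
have a34 : `|a| <= 3 / 4.
  have [|d d0 Hd] := diffE 4^-1; first by [].
  have [d' /= d'0 Hd'] := (nbhs_ballP _ _).1 F_contract.
  have td : `|d / 2| < d by rewrite gtr0_norm ?divr_gt0 // ltr_pdivrMr // ltr_pMr // ltr1n.
  have := Hd 0 (d / 2); rewrite normr0 => /(_ d0 td).
  rewrite addr0 LE -/(L 0) linear0 add0r max_r // => H1.
  have := Hd' w0 (ballxx _ d'0) (r0 + d / 2) r0; rewrite addrAC subrr add0r => H2.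
  have : `|d / 2 * a| <= (3 / 4) * `|d / 2|.
    rewrite -[d / 2 * a](subKr (F (w0, r0 + d / 2) - F (w0, r0))).
    by rewrite (le_trans (ler_normB _ _)) //; lra.
  by rewrite normrM mulrC ler_pM2r // normr_gt0 gt_eqF // divr_gt0.
have a1 : 4^-1 <= 1 - a by have := ler_norm a; lra.
have a10 : 1 - a != 0 by rewrite gt_eqF //; lra.
have Mlin : linear (fun h : W => (1 - a)^-1 * L (h, 0) : R^o).
  move=> c u v; have -> : (c *: u + v, 0) = c *: (u, 0) + ((v, 0) : W * R^o).
    by congr (_, _); rewrite /= scaler0 addr0.
  by rewrite linearD linearZ /= /GRing.scale /=; ring.
pose M : {linear W -> R^o} := HB.pack (fun h : W => (1 - a)^-1 * L (h, 0) : R^o)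
  (GRing.isLinear.Build R W R^o *:%R _ Mlin).
have normh (h : W) : `|((h, 0) : W * R^o)| = `|h|.
  by rewrite prod_normE /= normr0 max_l.
have dM : is_diff w0 r M; last exact: ex_diff.
apply: is_diff_bound.
  apply: bounded_linear_continuous; apply/linear_boundedP.
  exists (4 * k); split; first exact: num_real.
  move=> c ck v; rewrite (@le_trans _ _ (4 * k * `|v|)) //; last by rewrite ler_wpM2r // ltW.
  rewrite normrM -mulrA ler_pM // ?normr_ge0 //; last by rewrite -normh.
  by rewrite normfV invf_ple ?posrE ?normr_gt0 // ger0_norm //; lra.
move=> e e0.
(* The Lipschitz constant of [r] at [w0]: [k] bounds the differential of [F], 1 its error, and the
   factor 2 absorbs the contraction. *)
pose K := 2 * (k + 1).
have K0 : 0 < K by rewrite mulr_gt0 // ltr_wpDl // ltW.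
have [|d1 d10 H1] := diffE 1; first exact: ltr01.
(* The factor 4 compensates for [1 - a >= 1/4], and [1 + K] bounds the maximum of the two increments
   in terms of the norm of [h]. *)
have e'0 : 0 < e / (4 * (1 + K)) by rewrite divr_gt0 // mulr_gt0 // ltr_wpDr // ltW.
have [d2 d20 H2] := diffE _ e'0.
have near_h : \forall h \near (0 : W), [/\ r (w0 + h) = F (w0 + h, r (w0 + h)),
    forall a b, `|F (w0 + h, a) - F (w0 + h, b)| <= 2^-1 * `|a - b|,
    `|h| < d1, `|h| < d2 & `|h| < d2 / K].
  have ch : (fun h => w0 + h) @ (0 : W) --> w0.
    by rewrite -[X in _ --> X]addr0; apply: cvgD; [exact: cvg_cst|exact: cvg_id].
  have n1 : \forall h \near (0 : W), r (w0 + h) = F (w0 + h, r (w0 + h)) by exact: ch _ rF.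
  have n2 : \forall h \near (0 : W), forall a b, `|F (w0 + h, a) - F (w0 + h, b)| <= 2^-1 * `|a - b|.
    exact: ch _ F_contract.
  have n3 : \forall h \near (0 : W), `|h| < d1 by exact: nbhs0_lt.
  have n4 : \forall h \near (0 : W), `|h| < d2 by exact: nbhs0_lt.
  have d2K : 0 < d2 / K by rewrite divr_gt0.
  have n5 : \forall h \near (0 : W), `|h| < d2 / K by exact: nbhs0_lt.
  apply: filterS3 (filterI n1 n2) (filterI n3 n4) n5 => h -[? ?] [? ?] ?.
  by split.
apply: filterS near_h => h [rE cE h1 h2 h3].
set t := r (w0 + h) - r0.
have rtE : r (w0 + h) = r0 + t by rewrite /t [r0 + _]addrC subrK.
have r0E : r0 = F (w0, r0) by exact: nbhs_singleton rF.
have tK : `|t| <= K * `|h|.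
  have := H1 h 0 h1; rewrite normr0 => /(_ d10); rewrite addr0 max_l // mul1r => c2.
  have c3 : `|F (w0 + h, r0) - F (w0, r0)| <= (k + 1) * `|h|.
    rewrite -[X in `|X|](subrK (L (h, 0))) (le_trans (ler_normD _ _)) // mulrDl mul1r addrC lerD //.
    by rewrite -normh.
  have : `|t| <= 2^-1 * `|t| + (k + 1) * `|h|.
    have tE : t = (F (w0 + h, r (w0 + h)) - F (w0 + h, r0)) + (F (w0 + h, r0) - F (w0, r0)).
      by rewrite -rE -r0E addrA subrK.
    rewrite {1}tE (le_trans (ler_normD _ _)) // lerD //.
  by rewrite /K; lra.
have td : `|t| < d2.
  by rewrite (le_lt_trans tK) // mulrC -ltr_pdivlMr.
have := H2 h t h2 td; rewrite -rtE -rE -r0E -/t LE => H.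
have : `|(1 - a) * (t - M h)| <= e / 4 * `|h|.
  have -> : (1 - a) * (t - M h) = t - (L (h, 0) + t * a).
    by rewrite /M /=; field.
  apply: le_trans H _; rewrite invfM mulrA -mulrA ler_wpM2l ?divr_ge0 ?(ltW e0) //.
  rewrite mulrC ler_pdivrMr; last by rewrite ltr_wpDr // ltW.
  rewrite ge_max; apply/andP; split; first by rewrite ler_peMr // lerDl ltW.
  by rewrite (le_trans tK) // mulrC ler_wpM2l // lerDr.
rewrite normrM (ger0_norm (le_trans _ a1)) // => H'.
have : 4^-1 * `|t - M h| <= e / 4 * `|h|.
  by apply: le_trans H'; rewrite ler_wpM2r.
by rewrite /t; move: (`|_ - M h|) (`|h|) => x y; lra.
Qed.

End ImplicitFunction.

Section CkCongruence.
Context {R : realType}.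

Lemma Ck_eq (E F : normedModType R) n (U : set E) (f g : E -> F) : open U ->
  (forall w, U w -> f w = g w) -> Ck n U f -> Ck n U g.
Proof.
move=> oU; elim: n f g => [|n IH] f g fg.
  move=> cf w Uw; have near_fg : \forall y \near w, f y = g y.
    by have := open_nbhs_nbhs (conj oU Uw); apply: filterS => y; exact: fg.
  rewrite /prop_for /continuous_at -fg //.
  by apply: cvg_trans (cf _ Uw); exact: near_eq_cvg.
have near_fg w : U w -> \forall y \near w, f y = g y.
  by move=> Uw; have := open_nbhs_nbhs (conj oU Uw); apply: filterS => y; exact: fg.
move=> [df dDf]; split=> [w Uw|v].
  by apply: near_eq_differentiable (df _ Uw); exact: near_fg.
apply: IH (dDf v) => w Uw; apply: near_eq_derive; exact: near_fg.
Qed.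

End CkCongruence.

Lemma diff_exp {R : realType} {T : normedModType R} (f : T -> R^o) x n : differentiable f x ->
  differentiable (fun w => f w ^+ n : R^o) x /\
  forall v, 'D_v (fun w => f w ^+ n : R^o) x = n%:R * f x ^+ n.-1 * 'D_v f x.
Proof.
move=> df; elim: n => [|n [dn nE]].
  by split=> [|v]; [exact: differentiable_cst|rewrite derive_cst !mul0r].
have [dm mE] := diff_mul df dn.
rewrite (_ : (fun w => _) = fun w => f w * f w ^+ n); last by apply/funext => y; rewrite exprS.
split=> // v; rewrite [LHS]mE nE; move: ('D_v f x) => c.
case: n {dn nE dm mE} => [|n]; first by rewrite /= !expr0; ring.
by rewrite /= [in RHS]exprS -natr1 exprS; ring.
Qed.

(** * The transformation generated by the truncated series *)

Section NormalFormTransformation.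
Context {R : realType} {l : nat}.
Local Notation pt := (phase R l).
Local Notation E := (R^o * 'rV[R]_l)%type.
Local Notation W := (R^o * pt)%type.
Variables (omega : 'rV[R]_l) (S : nat -> E -> R^o) (N : nat).
Hypotheses (S_span : forall k, in_span (S k)) (S0 : S 0%N = (fun=> 0 : R^o)).

Definition power_sum (u : nat -> E -> R^o) (e : R) (w : E) : R := \sum_(k < N.+1) e ^+ k * u k w.

Definition space_derivative (h : E -> R^o) i : E -> R^o :=
  fun w => 'D_((0, delta_mx 0 i) : E) h w.

Definition flow_derivative (h : E -> R^o) : E -> R^o := fun w => 'D_((0, omega) : E) h w.

Lemma derive_coords h w (a : R) (x : 'rV[R]_l) : in_span h ->
  'D_((a, x) : E) h w = a * dtime h w + \sum_i x 0 i * space_derivative h i w.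
Proof.
move=> hh; have dh := in_span_differentiable hh w.
have -> : ((a, x) : E) = a *: ((1, 0) : E) + \sum_i x 0 i *: ((0, delta_mx 0 i) : E).
  have fsum (f : 'I_l -> E) : (\sum_i f i).1 = \sum_i (f i).1 by elim/big_rec2: _ => //= i c b _ ->.
  have ssum (f : 'I_l -> E) : (\sum_i f i).2 = \sum_i (f i).2 by elim/big_rec2: _ => //= i c b _ ->.
  rewrite [RHS]surjective_pairing; congr (_, _).
    by rewrite /= fsum big1 ?addr0 => [|i _]; rewrite /= ?scaler0 // [_ *: _]mulr1.
  rewrite /= ssum scaler0 add0r [LHS]row_sum_delta; apply: eq_bigr => i _.
  by [].
rewrite deriveE // linearD linearZ linear_sum /= /dtime deriveE //; congr (_ + _).
by apply: eq_bigr => i _; rewrite linearZ /= /space_derivative deriveE.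
Qed.

Lemma in_span_power_sum u e : (forall k, in_span (u k)) -> in_span (fun w => power_sum u e w : R^o).
Proof. by move=> uu; apply: in_span_sum => k _; exact: in_spanZ. Qed.

Lemma derive_power_sum u e w v : (forall k, in_span (u k)) ->
  'D_v (fun w => power_sum u e w : R^o) w = power_sum (fun k w => 'D_v (u k) w) e w.
Proof.
move=> uu.
have dt (j : 'I_N.+1) := diff_mul (differentiable_cst (e ^+ j : R^o) w)
  (in_span_differentiable (uu j) w).
have [_ hE] := diff_sum (fun j => (dt j).1).
rewrite [LHS]hE; apply: eq_bigr => j _.
by rewrite (dt j).2 derive_cst mulr0 addr0.
Qed.

Lemma power_sum_small u : (forall k, in_span (u k)) -> u 0%N = (fun=> 0) ->
  exists C, 0 <= C /\ forall e w, `|e| <= 1 -> `|power_sum u e w| <= C * `|e|.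
Proof.
move=> uu u0.
pose c k := sval (cid (in_span_bounded (uu k))).
have cP k w : `|u k w| <= c k by exact: (svalP (cid (in_span_bounded (uu k)))).
have c0 k : 0 <= c k by exact: le_trans (cP k 0).
exists (\sum_(k < N.+1) c k); split; first by rewrite sumr_ge0.
move=> e w e1; rewrite mulr_suml (le_trans (ler_norm_sum _ _ _)) // ler_sum // => -[[|k] /= kN] _.
  by rewrite u0 mulr0 normr0 mulr_ge0.
rewrite normrM mulrC ler_pM ?cP //.
by rewrite normrX exprS ler_piMr // exprn_ile1.
Qed.

Local Notation St := (fun k => dtime (S k)).

Let St_span k : in_span (dtime (S k)).
Proof. exact: in_span_derive. Qed.

Let Sx_span i k : in_span (space_derivative (S k) i).
Proof. exact: in_span_derive. Qed.

Let Stw_span k : in_span (flow_derivative (dtime (S k))).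
Proof. by apply: in_span_derive; exact: St_span. Qed.

Let S0_derive v : (fun w => 'D_v (S 0%N) w) = (fun=> 0 : R^o).
Proof. by apply/funext => w; rewrite S0; exact: derive_cst. Qed.

Lemma derivative_bounds : exists C, 0 < C /\ forall e w, `|e| <= 1 ->
  [/\ `|power_sum St e w| <= C * `|e|,
      forall i, `|power_sum (fun k => space_derivative (S k) i) e w| <= C * `|e| &
      `|power_sum (fun k => flow_derivative (dtime (S k))) e w| <= C * `|e|].
Proof.
have [C1 [C10 H1]] := power_sum_small St_span (S0_derive _).
have [|C2 [C20 H2]] := power_sum_small Stw_span.
  have -> : flow_derivative (dtime (S 0%N)) = fun w => 'D_((0, omega) : E) (fun=> 0 : R^o) w.
    by rewrite /dtime S0_derive.
  by apply/funext => w; exact: derive_cst.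
pose c i := sval (cid (power_sum_small (Sx_span i) (S0_derive _))).
have cP i : 0 <= c i /\ forall e w, `|e| <= 1 ->
    `|power_sum (fun k => space_derivative (S k) i) e w| <= c i * `|e|.
  exact: (svalP (cid (power_sum_small (Sx_span i) (S0_derive _)))).
have cs : 0 <= \sum_i c i by rewrite sumr_ge0 // => i _; have [] := cP i.
exists (C1 + C2 + \sum_i c i + 1); split; first by lra.
move=> e w e1; have e0 := normr_ge0 e; split=> [|i|].
- by rewrite (le_trans (H1 _ _ e1)) // ler_wpM2r //; lra.
- have [_ Hi] := cP i; rewrite (le_trans (Hi _ _ e1)) // ler_wpM2r //.
  rewrite (bigD1 i) //= in cs *.
  have : 0 <= \sum_(j < l | j != i) c j by rewrite sumr_ge0 // => j _; have [] := cP j.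
  lra.
- by rewrite (le_trans (H2 _ _ e1)) // ler_wpM2r //; lra.
Qed.

Variable C0 : R.
Hypotheses (C0_gt0 : 0 < C0) (C0_bound : forall e w, `|e| <= 1 ->
  [/\ `|power_sum St e w| <= C0 * `|e|,
      forall i, `|power_sum (fun k => space_derivative (S k) i) e w| <= C0 * `|e| &
      `|power_sum (fun k => flow_derivative (dtime (S k))) e w| <= C0 * `|e|]).

(** Below this value the right-hand side of the equation for the shift [r] is a contraction with
    constant 1/2 and takes values in [[-1, 1]]. *)
Definition e_max : R := Num.min 1 (2 * C0)^-1.

Lemma e_max_gt0 : 0 < e_max.
Proof. by rewrite lt_min ltr01 invr_gt0 mulr_gt0. Qed.

Lemma e_max_le1 (e : R) : `|e| < e_max -> `|e| <= 1.
Proof. by rewrite lt_min => /andP[/ltW]. Qed.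

Lemma e_max_half (e : R) : `|e| < e_max -> C0 * `|e| <= 2^-1.
Proof.
rewrite lt_min => /andP[_]; rewrite invfM -ltr_pdivrMr ?invr_gt0 // invrK => /ltW.
by rewrite mulrC.
Qed.

Lemma is_derive_backward_line (k : E -> R^o) (s b t : R) x :
  differentiable k (s, x - (b + t) *: omega) ->
  is_derive (t : R) 1 (fun t : R => k (s, x - (b + t) *: omega) : R)
    (- 'D_((0, omega) : E) k (s, x - (b + t) *: omega)).
Proof.
move=> dk.
have dv : derivable k (s, x - (b + t) *: omega) ((0, - omega) : E) by exact: diff_derivable.
have shiftE : (fun c : R => c^-1 *: (((fun t : R => k (s, x - (b + t) *: omega) : R) \o shift t) (c *: 1)
      - k (s, x - (b + t) *: omega))) =
    fun c => c^-1 *: ((k \o shift ((s, x - (b + t) *: omega) : E)) (c *: ((0, - omega) : E))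
      - k (s, x - (b + t) *: omega)).
  apply/funext => c; congr (_ *: (k (_, _) - _)); first by rewrite /= scaler0 add0r.
  rewrite /= [c *: 1]mulr1 scalerN [RHS]addrCA -opprD -scalerDl.
  by rewrite [in LHS]addrCA.
split; first by rewrite /derivable shiftE.
rewrite /derive shiftE -[LHS]/('D_((0, - omega) : E) k _).
have -> : ((0, - omega) : E) = - ((0, omega) : E) by congr (_, _); rewrite /= oppr0.
by rewrite deriveE // linearN -deriveE.
Qed.

Lemma shift_contract (e s : R) x (a b : R) : `|e| < e_max ->
  `|power_sum St e (s, x - a *: omega) - power_sum St e (s, x - b *: omega)| <= 2^-1 * `|a - b|.
Proof.
move=> ee; pose g (t : R) := power_sum St e (s, x - (b + t) *: omega).
have gD t : is_derive (t : R) 1 (g : R -> R)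
    (- power_sum (fun k => flow_derivative (dtime (S k))) e (s, x - (b + t) *: omega)).
  have dh := in_span_differentiable (in_span_power_sum e St_span) (s, x - (b + t) *: omega).
  apply: is_derive_eq (is_derive_backward_line dh) _.
  by rewrite derive_power_sum.
have := @mean_value_bound R g _ (a - b) 2^-1 (fun c _ => gD c).
rewrite /g addr0 addrCA subrr addr0; apply => c _.
have [_ _ H] := C0_bound (s, x - (b + c) *: omega) (e_max_le1 ee).
by rewrite normrN (le_trans H) // e_max_half.
Qed.

(** Intermediate value theorem on [[-1, 1]], at the ends of which the equation has opposite signs
    because its right-hand side is at most 1 in absolute value. *)
Lemma shift_exists (e s : R) x : `|e| < e_max ->
  exists a, a = power_sum St e (s, x - a *: omega).
Proof.
move=> ee; pose f (a : R) := a - power_sum St e (s, x - a *: omega).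
have fle a : `|power_sum St e (s, x - a *: omega)| <= 1.
  have [H _ _] := C0_bound (s, x - a *: omega) (e_max_le1 ee).
  by rewrite (le_trans H) // (le_trans (e_max_half ee)) // invf_le1 // ler1n.
have cf : continuous f.
  move=> a; apply: cvgB; first exact: cvg_id.
  apply/cvgrPdist_le => d d0.
  have : (fun b : R => b) @ a --> a by exact: cvg_id.
  move=> /cvgrPdist_le/(_ _ d0); apply: filterS => b /= bd.
  rewrite (le_trans (shift_contract _ _ _ _ ee)) // (le_trans _ bd) //.
  by rewrite ler_piMl // invf_le1 // ler1n.
have [|||a _ fa] := @IVT R f (-1) 1 0.
- lra.
- exact: continuous_subspaceT.
- have h1 := fle (-1); have h2 := fle 1; rewrite !ler_norml in h1 h2.
  move: h1 h2; rewrite /f => /andP[a1 a2] /andP[b1 b2].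
  by rewrite ge_min le_max; apply/andP; split; apply/orP; [left|right]; lra.
- by exists a; move/eqP: fa; rewrite /f subr_eq0 => /eqP.
Qed.

(* The new angles x and the old ones phi are related by phi = x + r omega with
   r = d/ds S(s, x, e), an implicit scalar equation for r. *)
Definition time_shift (w : W) : R^o :=
  if pselect (exists a, a = power_sum St w.1 (dot omega (actions w.2), angle w.2 - a *: omega))
  is left H then projT1 (cid H) else 0.

(** The second condition exceeds the size of the gradient of [S] and so keeps the actions of the
    image positive; the admissible range of [e] shrinks as [z] approaches the boundary of the phase
    space. *)
Definition normal_domain : set W :=
  [set w | `|w.1| < e_max /\ forall i, C0 * `|w.1| < actions w.2 0 i].

Local Notation U := normal_domain.
Local Notation slow w := (dot omega (actions w.2)).
Local Notation shifted_angle w := (angle w.2 - time_shift w *: omega).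

Lemma time_shiftE w : `|w.1| < e_max ->
  time_shift w = power_sum St w.1 (slow w, shifted_angle w).
Proof.
move=> we; rewrite /time_shift; case: pselect => [H|[]]; first by case: cid.
exact: shift_exists.
Qed.

Lemma normal_domain_phase w : U w -> phase_space w.2.
Proof.
move=> [_ Hw]; apply/phase_spaceP => i; apply: le_lt_trans (Hw i).
by rewrite mulr_ge0 // ltW.
Qed.

Lemma normal_domain_open : open U.
Proof.
rewrite openE => w [we wa].
have id_w : (fun y : W => y) @ nbhs w --> w by exact: cvg_id.
have ce : (fun y : W => `|y.1|) @ nbhs w --> (`|w.1| : R).
  by apply: cvg_norm; exact: (cvg_fst_comp id_w).
have n1 : \forall y \near w, `|y.1| < e_max by apply: (cvgr_lt _ ce).
have n2 : \forall y \near w, forall i, C0 * `|y.1| < actions y.2 0 i.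
  apply: (@filter_forall W _ (fun i (y : W) => C0 * `|y.1| < actions y.2 0 i) (nbhs w) _) => i.
  have cd : (fun y : W => actions y.2 0 i - C0 * `|y.1|) @ nbhs w --> (actions w.2 0 i - C0 * `|w.1| : R).
    apply: cvgB; first by apply: cvg_actions; exact: (cvg_snd_comp id_w).
    by apply: cvgM => //; exact: cvg_cst.
  have := cvgr_gt _ cd; have d0 : 0 < actions w.2 0 i - C0 * `|w.1| by rewrite subr_gt0.
  by move=> /(_ _ _ d0); apply: filterS => y; rewrite subr_gt0.
exact: filterI n1 n2.
Qed.

Let e_maxU w : U w -> `|w.1| < e_max. Proof. by case. Qed.
Local Notation r := time_shift.
Local Notation shifted w := ((slow w, shifted_angle w) : E).

Definition slow_form (z v : pt) : R := \sum_i omega 0 i * (inner z v i + inner v z i).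

Lemma diff_slow (T : normedModType R) (z : T -> pt) w : differentiable z w ->
  differentiable (fun w => dot omega (actions (z w)) : R^o) w /\
  forall v, 'D_v (fun w => dot omega (actions (z w)) : R^o) w = slow_form (z w) ('D_v z w).
Proof.
move=> dz; rewrite (_ : (fun w => _) = fun w => \sum_i omega 0 i * inner (z w) (z w) i); last first.
  by apply/funext => y; apply: eq_bigr => i _; rewrite actionsE !expr2.
have di i := diff_inner i dz dz.
have dm i := diff_mul (differentiable_cst (omega 0 i : R^o) w) (di i).1.
have [ds sE] := diff_sum (fun i => (dm i).1); split=> // v.
rewrite [LHS]sE; apply: eq_bigr => i _.
by rewrite (dm i).2 derive_cst mulr0 addr0 (di i).2.
Qed.

Lemma time_shift_differentiable w : U w -> differentiable r w.
Proof.
move=> Uw; have we := e_maxU Uw.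
pose F (p : W * R^o) : R^o := power_sum St p.1.1 (slow p.1, angle p.1.2 - p.2 *: omega).
apply: (@implicit_differentiable R W F).
- have d1 : differentiable (fst : W * R^o -> W) (w, r w) by exact: differentiable_fst.
  have de : differentiable (fun p : W * R^o => p.1.1) (w, r w).
    apply: (@differentiable_comp _ _ _ _ (fst : W * R^o -> W) fst) => //; exact: differentiable_fst.
  have dz : differentiable (fun p : W * R^o => p.1.2) (w, r w).
    apply: (@differentiable_comp _ _ _ _ (fst : W * R^o -> W) snd) => //; exact: differentiable_snd.
  have dr : differentiable (snd : W * R^o -> R^o) (w, r w) by exact: differentiable_snd.
  have [ds _] := diff_slow dz.
  have dk (k : 'I_N.+1) := (angle_comp omega (St_span k) ds dz dr (normal_domain_phase Uw)).1.
  have dm (k : 'I_N.+1) := diff_mul (diff_exp k de).1 (dk k).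
  exact: (diff_sum (fun k => (dm k).1)).1.
- have := open_nbhs_nbhs (conj normal_domain_open Uw); apply: filterS => y /e_maxU; exact: time_shiftE.
- have := open_nbhs_nbhs (conj normal_domain_open Uw); apply: filterS => y /e_maxU ye a b.
  exact: (shift_contract).
Qed.

(* A class of functions on U closed under directional derivatives, hence made of
   smooth functions; it contains the components of the transformation. *)
Inductive nf_class : (W -> R^o) -> Prop :=
| nf_cst c : nf_class (fun=> c)
| nf_eps : nf_class (fun w => w.1)
| nf_eta i : nf_class (fun w => w.2.1 0 i)
| nf_y i : nf_class (fun w => w.2.2 0 i)
| nf_add f g : nf_class f -> nf_class g -> nf_class (fun w => f w + g w)
| nf_mul f g : nf_class f -> nf_class g -> nf_class (fun w => f w * g w)
| nf_inv f : nf_class f -> (forall w, U w -> f w != 0) -> nf_class (fun w => (f w)^-1)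
| nf_sqrt f : nf_class f -> (forall w, U w -> 0 < f w) -> nf_class (fun w => Num.sqrt (f w))
| nf_shift : nf_class r
| nf_comp h : in_span h -> nf_class (fun w => h (shifted w)).

Lemma nf_sum n (f : 'I_n -> W -> R^o) : (forall i, nf_class (f i)) ->
  nf_class (fun w => \sum_i f i w).
Proof.
move=> nf; elim: (index_enum _) => [|i s IH].
  by under eq_fun do rewrite big_nil; exact: nf_cst.
by under eq_fun do rewrite big_cons; exact: nf_add.
Qed.

Lemma nf_exp n f : nf_class f -> nf_class (fun w => f w ^+ n).
Proof.
move=> nf; elim: n => [|n IH]; first exact: nf_cst.
by under eq_fun do rewrite exprS; exact: nf_mul.
Qed.

Lemma nf_opp f : nf_class f -> nf_class (fun w => - f w).
Proof.
move=> nf; under eq_fun do rewrite -mulN1r.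
by apply: nf_mul => //; exact: nf_cst.
Qed.

Lemma nf_inner_l i (v : pt) : nf_class (fun w => inner w.2 v i).
Proof.
by apply: nf_add; apply: nf_mul; try exact: nf_cst; first [exact: nf_eta|exact: nf_y].
Qed.

Lemma nf_inner_r i (v : pt) : nf_class (fun w => inner v w.2 i).
Proof.
by apply: nf_add; apply: nf_mul; try exact: nf_cst; first [exact: nf_eta|exact: nf_y].
Qed.

Lemma nf_actions i : nf_class (fun w => actions w.2 0 i).
Proof.
under eq_fun do rewrite actionsE.
by apply: nf_add; apply: nf_exp; first [exact: nf_eta|exact: nf_y].
Qed.

Lemma nf_slow_form v : nf_class (fun w => slow_form w.2 v).
Proof.
apply: nf_sum => i; apply: nf_mul; first exact: nf_cst.
by apply: nf_add; [exact: nf_inner_l|exact: nf_inner_r].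
Qed.

Lemma nf_angle_form v i : nf_class (fun w => angle_form w.2 v 0 i).
Proof.
under eq_fun do rewrite angle_formE.
apply: nf_mul.
  by apply: nf_add; [|apply: nf_opp]; apply: nf_mul; try exact: nf_cst; first [exact: nf_eta|exact: nf_y].
apply: nf_inv; first exact: nf_actions.
by move=> w /normal_domain_phase/phase_spaceP/(_ i) ?; rewrite gt_eqF.
Qed.

(** The derivative of [h] at the shifted point with [r] held fixed; the variation of [r] adds a
    multiple of the derivative of [h] along [omega]. *)
Definition frozen_derivative (h : E -> R^o) (v : pt) : W -> R^o :=
  fun w => 'D_((slow_form w.2 v, angle_form w.2 v) : E) h (shifted w).

Lemma nf_frozen h v : in_span h -> nf_class (frozen_derivative h v).
Proof.
move=> hh; rewrite /frozen_derivative; under eq_fun do rewrite derive_coords //.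
apply: nf_add; first by apply: nf_mul; [exact: nf_slow_form|apply: nf_comp; exact: in_span_derive].
apply: nf_sum => i; apply: nf_mul; first exact: nf_angle_form.
by apply: nf_comp; exact: in_span_derive.
Qed.

Lemma comp_derive h w v : in_span h -> U w ->
  differentiable (fun w => h (shifted w)) w /\
  'D_v (fun w => h (shifted w)) w =
    frozen_derivative h v.2 w - 'D_v r w * flow_derivative h (shifted w).
Proof.
move=> hh Uw; have dz : differentiable (snd : W -> pt) w by exact: differentiable_snd.
have [ds sE] := diff_slow dz; have dr := time_shift_differentiable Uw.
have zE : 'D_v (snd : W -> pt) w = v.2.
  by rewrite deriveE // diff_lin // => y; exact: cvg_snd.
have [dc cE] := angle_comp omega hh ds dz dr (normal_domain_phase Uw); split=> //.
rewrite [LHS]cE sE zE /frozen_derivative /flow_derivative.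
move: ('D_v r w) => c; have dh := in_span_differentiable hh (shifted w).
have -> : ((slow_form w.2 v.2, angle_form w.2 v.2 - c *: omega) : E) =
   (slow_form w.2 v.2, angle_form w.2 v.2) - c *: (0, omega).
  by congr (_, _); rewrite /= scaler0 subr0.
by move: (shifted w) dh => p dh; rewrite !deriveE // linearB linearZ.
Qed.

(** Implicit differentiation of the equation for [r]: the numerator collects the terms without the
    derivative of [r], and the denominator is its coefficient, at least 1/2 on the domain. At
    [k = 0] the factor [k] cancels the term with exponent [k.-1]. *)
Definition shift_numerator (v : W) (w : W) : R^o :=
  \sum_(k < N.+1) (w.1 ^+ k * frozen_derivative (St k) v.2 w
     + k%:R * w.1 ^+ k.-1 * v.1 * dtime (S k) (shifted w)).

Definition shift_denominator (w : W) : R^o :=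
  1 + power_sum (fun k => flow_derivative (dtime (S k))) w.1 (shifted w).

Lemma shift_denominator_gt0 w : U w -> 0 < shift_denominator w.
Proof.
move=> /e_maxU we; have [_ _ H] := C0_bound (shifted w) (e_max_le1 we).
have := le_trans H (e_max_half we).
rewrite /shift_denominator ler_norml => /andP[]; lra.
Qed.

Lemma shift_derive w v : U w -> 'D_v r w = shift_numerator v w / shift_denominator w.
Proof.
move=> Uw; have de : differentiable (fst : W -> R^o) w by exact: differentiable_fst.
have eE : 'D_v (fst : W -> R^o) w = v.1.
  by rewrite deriveE // diff_lin // => y; exact: cvg_fst.
have rE : 'D_v r w = 'D_v (fun w => power_sum St w.1 (shifted w) : R^o) w.
  apply: near_eq_derive.
  by have := open_nbhs_nbhs (conj normal_domain_open Uw); apply: filterS => y /e_maxU; exact: time_shiftE.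
have dX (k : nat) : differentiable (fun w : W => w.1 ^+ k : R^o) w /\
    'D_v (fun w : W => w.1 ^+ k : R^o) w = k%:R * w.1 ^+ k.-1 * v.1.
  have [d E1] := diff_exp k de.
  by split=> //; rewrite E1 eE.
have dk (k : 'I_N.+1) := comp_derive v (St_span k) Uw.
have dm (k : 'I_N.+1) := diff_mul (dX k).1 (dk k).1.
have [_ sE] := diff_sum (fun k => (dm k).1).
have := shift_denominator_gt0 Uw; have : 'D_v r w = shift_numerator v w - 'D_v r w * (shift_denominator w - 1).
  rewrite [LHS]rE [LHS]sE /shift_denominator addrAC subrr add0r /shift_numerator.
  rewrite mulr_sumr -sumrB; apply: eq_bigr => k _.
  rewrite (dm k).2 (dX k).2 (dk k).2.
  move: ('D_v r w) (frozen_derivative _ _ _) (flow_derivative _ _) (dtime _ _) => a b c d.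
  ring.
move: ('D_v r w) (shift_numerator v w) (shift_denominator w) => a b c abc c0.
by apply: (mulIf (lt0r_neq0 c0)); rewrite divfK ?gt_eqF //; lra.
Qed.

Lemma nf_power_sum u : (forall k, in_span (u k)) ->
  nf_class (fun w => power_sum u w.1 (shifted w)).
Proof.
move=> uu; apply: nf_sum => k; apply: nf_mul; first by apply: nf_exp; exact: nf_eps.
exact: nf_comp.
Qed.

Lemma nf_shift_derive v : nf_class (fun w => shift_numerator v w / shift_denominator w).
Proof.
apply: nf_mul.
  apply: nf_sum => k; apply: nf_add.
    by apply: nf_mul; [apply: nf_exp; exact: nf_eps|exact: nf_frozen].
  apply: nf_mul; last exact: nf_comp.
  apply: nf_mul; last exact: nf_cst.
  by apply: nf_mul; [exact: nf_cst|apply: nf_exp; exact: nf_eps].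
apply: nf_inv; last by move=> w /shift_denominator_gt0 ?; rewrite gt_eqF.
apply: nf_add; first exact: nf_cst.
by apply: nf_power_sum => k; exact: in_span_derive.
Qed.

(** Derivatives are identified with members of the class on [U] only, where inverses and square
    roots have admissible arguments and [r] solves its equation. *)
Lemma nf_class_derive f : nf_class f -> (forall w, U w -> differentiable f w) /\
  forall v, exists2 g, nf_class g & forall w, U w -> 'D_v f w = g w.
Proof.
have dz w : differentiable (snd : W -> pt) w by exact: differentiable_snd.
have zE w v : 'D_v (snd : W -> pt) w = v.2.
  by rewrite deriveE // diff_lin // => y; exact: cvg_snd.
elim=> {f} [c||i|i|f g nf [df Df] ng [dg Dg]|f g nf [df Df] ng [dg Dg]|f nf [df Df] f0|f nf [df Df] f0||h hh].
- split=> [w _|v]; first exact: differentiable_cst.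
  by exists (fun=> 0); [exact: nf_cst|move=> w _; exact: derive_cst].
- split=> [w _|v]; first exact: differentiable_fst.
  exists (fun=> v.1); first exact: nf_cst.
  by move=> w _; rewrite deriveE ?diff_lin //; [move=> y; exact: cvg_fst|exact: differentiable_fst].
- split=> [w _|v]; first by have [] := diff_eta i (dz w).
  exists (fun=> v.2.1 0 i); first exact: nf_cst.
  by move=> w _; rewrite [LHS](diff_eta i (dz w)).2 zE.
- split=> [w _|v]; first by have [] := diff_y i (dz w).
  exists (fun=> v.2.2 0 i); first exact: nf_cst.
  by move=> w _; rewrite [LHS](diff_y i (dz w)).2 zE.
- split=> [w Uw|v]; first exact: differentiableD (df _ Uw) (dg _ Uw).
  have [f' nf' fE] := Df v; have [g' ng' gE] := Dg v.
  exists (fun w => f' w + g' w); first exact: nf_add.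
  by move=> w Uw; rewrite [LHS](diff_add (df _ Uw) (dg _ Uw)).2 fE // gE.
- split=> [w Uw|v]; first exact: differentiableM (df _ Uw) (dg _ Uw).
  have [f' nf' fE] := Df v; have [g' ng' gE] := Dg v.
  exists (fun w => f w * g' w + g w * f' w); first by apply: nf_add; exact: nf_mul.
  by move=> w Uw; rewrite [LHS](diff_mul (df _ Uw) (dg _ Uw)).2 fE // gE.
- split=> [w Uw|v]; first exact: differentiableV (df _ Uw) (f0 _ Uw).
  have [f' nf' fE] := Df v.
  exists (fun w => - ((f w)^-1 ^+ 2) * f' w).
    by apply: nf_mul => //; apply: nf_opp; apply: nf_exp; exact: nf_inv.
  by move=> w Uw; rewrite [LHS](diff_inv (df _ Uw) (f0 _ Uw)).2 fE // exprVn.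
- split=> [w Uw|v]; first by have [] := diff_sqrt (df _ Uw) (f0 _ Uw).
  have [f' nf' fE] := Df v.
  exists (fun w => (2 * Num.sqrt (f w))^-1 * f' w).
    apply: nf_mul => //; apply: nf_inv; first by apply: nf_mul; [exact: nf_cst|exact: nf_sqrt].
    by move=> w Uw; rewrite gt_eqF // mulr_gt0 // sqrtr_gt0 f0.
  by move=> w Uw; rewrite [LHS](diff_sqrt (df _ Uw) (f0 _ Uw)).2 fE.
- split=> [w Uw|v]; first exact: time_shift_differentiable.
  exists (fun w => shift_numerator v w / shift_denominator w); first exact: nf_shift_derive.
  by move=> w Uw; exact: shift_derive.
- split=> [w Uw|v]; first by have [] := comp_derive 0 hh Uw.
  exists (fun w => frozen_derivative h v.2 w
     - (shift_numerator v w / shift_denominator w) * flow_derivative h (shifted w)).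
    apply: nf_add; first exact: nf_frozen.
    apply: nf_opp; apply: nf_mul; first exact: nf_shift_derive.
    by apply: nf_comp; exact: in_span_derive.
  by move=> w Uw; rewrite [LHS](comp_derive v hh Uw).2 shift_derive.
Qed.

(** Induction on the order: on the open set [U] a directional derivative coincides with a pair of
    rows of the same kind, and [Ck_eq] transfers regularity between them. *)
Lemma nf_class_smooth (f g : 'I_l -> W -> R^o) :
  (forall i, nf_class (f i)) -> (forall i, nf_class (g i)) ->
  smooth U (fun w => (\row_i f i w, \row_i g i w) : pt).
Proof.
move=> nf ng n; elim: n f nf g ng => [|n IH] f nf g ng.
  move=> w Uw; apply: differentiable_continuous; apply: differentiable_pair;
    apply: differentiable_row => i.
    exact: (nf_class_derive (nf i)).1.
  exact: (nf_class_derive (ng i)).1.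
have df i w (Uw : U w) := (nf_class_derive (nf i)).1 w Uw.
have dg i w (Uw : U w) := (nf_class_derive (ng i)).1 w Uw.
have df' w (Uw : U w) := @differentiable_row R W l (fun w i => f i w) w (fun i => df i w Uw).
have dg' w (Uw : U w) := @differentiable_row R W l (fun w i => g i w) w (fun i => dg i w Uw).
split=> [w Uw|v]; first exact: differentiable_pair (df' _ Uw) (dg' _ Uw).
have exD (k : 'I_l -> W -> R^o) : (forall i, nf_class (k i)) ->
    exists k' : 'I_l -> W -> R^o, (forall i, nf_class (k' i)) /\
      forall i w, U w -> 'D_v (k i) w = k' i w.
  move=> nk; pose e i := cid2 ((nf_class_derive (nk i)).2 v).
  exists (fun i => projT1 (sig_of_sig2 (e i))); split=> i; rewrite /=.
    by case: (e i).
  by case: (e i).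
have [f' [nf' fE]] := exD f nf; have [g' [ng' gE]] := exD g ng.
apply: (Ck_eq normal_domain_open) (IH f' nf' g' ng') => w Uw; apply/esym.
rewrite [LHS](derive_pair v (df' _ Uw) (dg' _ Uw)); congr (_, _).
  by rewrite [LHS](derive_row v (fun i => df i w Uw)); apply/rowP => i; rewrite !mxE fE.
by rewrite [LHS](derive_row v (fun i => dg i w Uw)); apply/rowP => i; rewrite !mxE gE.
Qed.

Definition new_action i (w : W) : R^o :=
  actions w.2 0 i + power_sum (fun k => space_derivative (S k) i) w.1 (shifted w).

(** The mixed-variable transformation in explicit form: if [z] has actions [I] and angles [phi], the
    image has actions [I + grad_x S] and angles [x = phi - r omega]. *)
Definition normal_map (e : R) (z : pt) : pt :=
  action_angle (\row_i new_action i (e, z), shifted_angle ((e, z) : W)).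

Lemma new_action_gt0 i w : U w -> 0 < new_action i w.
Proof.
move=> [we wa]; have [_ /(_ i) H _] := C0_bound (shifted w) (e_max_le1 we).
by have := wa i; move: H; rewrite /new_action ler_norml => /andP[]; lra.
Qed.

Lemma normal_map_phase e z : U (e, z) -> phase_space (normal_map e z).
Proof. by move=> Uw; apply: phase_space_action_angle => i; rewrite mxE; exact: new_action_gt0. Qed.

Lemma normal_mapE e z : normal_map e z =
  (\row_i (Num.sqrt (new_action i (e, z)) * cos ((shifted ((e, z) : W)).2 0 i + pi / 2)),
   \row_i (Num.sqrt (new_action i (e, z)) * cos ((shifted ((e, z) : W)).2 0 i + 0))).
Proof.
congr (_, _); apply/rowP => i; rewrite mxE [RHS]mxE.
  by rewrite /= [in Num.sqrt _]mxE cosDpihalf mulrN.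
by rewrite /= [in Num.sqrt _]mxE addr0.
Qed.

Lemma nf_new_action i : nf_class (new_action i).
Proof. by apply: nf_add; [exact: nf_actions|exact: nf_power_sum]. Qed.

Lemma nf_new_coord i th : nf_class (fun w => Num.sqrt (new_action i w) * cos ((shifted w).2 0 i + th)).
Proof.
apply: nf_mul; last exact: (nf_comp (in_span_cos_angle i th)).
by apply: nf_sqrt; [exact: nf_new_action|move=> w; exact: new_action_gt0].
Qed.

Lemma normal_map_smooth : smooth U (fun w => normal_map w.1 w.2).
Proof.
rewrite (_ : (fun w => _) = fun w =>
  (\row_i (Num.sqrt (new_action i w) * cos ((shifted w).2 0 i + pi / 2)),
   \row_i (Num.sqrt (new_action i w) * cos ((shifted w).2 0 i + 0)))).
  apply: (nf_class_smooth) => i; exact: nf_new_coord.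
by apply/funext => -[e z]; rewrite normal_mapE.
Qed.

Lemma normal_map0 z : phase_space z -> normal_map 0 z = z.
Proof.
move=> pz; have p0 u w : u 0%N = (fun=> 0) -> power_sum u 0 w = 0 :> R.
  move=> u0; rewrite /power_sum big_ord_recl u0 mulr0 big1 ?addr0 // => i _.
  by rewrite expr0n mul0r.
have S0D v : (fun w => 'D_v (S 0%N) w) = (fun=> 0 : R^o).
  by apply/funext => w; rewrite S0; exact: derive_cst.
have e0 : `|((0, z) : W).1| < e_max by rewrite normr0 e_max_gt0.
have r0 : r (0, z) = 0 by rewrite (time_shiftE e0) p0 //; exact: S0D.
rewrite /normal_map r0 scale0r subr0 -[RHS](action_angleK pz); congr (action_angle (_, _)).
by apply/rowP => i; rewrite mxE /new_action p0 ?addr0 //; exact: S0D.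
Qed.

(** Here [q] is a radius with derivative [d], and [(c, s)] are the cosine and sine of an angle with
    derivative [b]: the radial motion drops out of the angle form. *)
Lemma cross_rotation (q a c s d b : R) : c ^+ 2 + s ^+ 2 = 1 -> q ^+ 2 = a -> 0 < a ->
  (q * - s * (q * (- s * b) + c * d) - q * c * (q * (- c * b) - s * d)) / a = b.
Proof.
move=> cs qa a0; apply: (mulIf (lt0r_neq0 a0)); rewrite divfK ?gt_eqF //.
transitivity (q ^+ 2 * b * (c ^+ 2 + s ^+ 2)); first by ring.
by rewrite cs qa; ring.
Qed.

(** * Exactness at a fixed value of the parameter *)

Section Slice.
Variables (e : R) (z v : pt).
Hypothesis Uz : U (e, z).
Let re (y : pt) : R^o := r (e, y).
(** The derivative along [v] of the angles [x = phi - r omega]. *)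
Let beta : 'rV[R]_l := angle_form z v - 'D_v re z *: omega.

Let slice_diff (T : normedModType R) (f : W -> T) : differentiable f (e, z) ->
  differentiable (fun y => f (e, y)) z.
Proof.
by move=> df; apply: (@differentiable_comp _ _ _ _ (fun y => (e, y) : W) f).
Qed.

Let did : differentiable (fun y : pt => y) z.
Proof. by apply: (@linear_differentiable _ _ _ idfun) => y; exact: cvg_id. Qed.

Let dr : differentiable re z.
Proof. by apply: slice_diff; exact: (time_shift_differentiable Uz). Qed.

Let slice_comp (h : E -> R^o) : in_span h ->
  differentiable (fun y => h (shifted ((e, y) : W))) z /\
  'D_v (fun y => h (shifted ((e, y) : W))) z =
     slow_form z v * dtime h (shifted ((e, z) : W)) + 'D_((0, beta) : E) h (shifted ((e, z) : W)).
Proof.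
move=> hh; have [ds sE] := diff_slow did.
have [dc cE] := angle_comp omega hh ds did dr (normal_domain_phase Uz).
split; first exact: dc.
rewrite [LHS]cE sE derive_id -/beta; move: (shifted ((e, z) : W)) => p.
by rewrite !derive_coords // mul0r add0r.
Qed.

Let diff_cos_shifted i th :
  differentiable (fun y => cos ((shifted ((e, y) : W)).2 0 i + th) : R^o) z /\
  'D_v (fun y => cos ((shifted ((e, y) : W)).2 0 i + th) : R^o) z =
    - sin ((shifted ((e, z) : W)).2 0 i + th) * beta 0 i.
Proof.
have hh := in_span_cos_angle (R := R) i th; have [dc cE] := slice_comp hh; split; first exact: dc.
rewrite [LHS]cE; move: (shifted ((e, z) : W)) => p.
have hE u : 'D_u (fun w : E => cos (w.2 0 i + th) : R^o) p = - sin (p.2 0 i + th) * u.2 0 i.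
  have d2 : differentiable (fun w : E => w.2) p by exact: differentiable_snd.
  have [di iE] := diff_coord i d2.
  have [da aE] := diff_add di (differentiable_cst (th : R^o) p).
  have [_ E1] := @chain_rule R E cos (fun w : E => w.2 0 i + th : R^o) p _ (is_derive_cos (p.2 0 i + th)) da.
  rewrite [LHS]E1 aE derive_cst addr0 iE; congr (_ * _).
  by rewrite deriveE // diff_lin // => y; exact: cvg_snd.
by rewrite /dtime !hE /= mxE !mulr0 add0r.
Qed.

Lemma normal_map_derive : differentiable (normal_map e) z /\
  angle_form (normal_map e z) ('D_v (normal_map e) z) = beta.
Proof.
have pos i := new_action_gt0 i Uz.
have da i : differentiable (fun y => new_action i (e, y)) z.
  by apply: slice_diff; have [+ _] := nf_class_derive (nf_new_action i); exact.
have [dq _] : (forall i, differentiable (fun y => Num.sqrt (new_action i (e, y)) : R^o) z) /\ True.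
  by split=> // i; have [] := diff_sqrt (da i) (pos i).
have dm i th := diff_mul (dq i) (diff_cos_shifted i th).1.
have dM th := @differentiable_row R pt l (fun y i => Num.sqrt (new_action i (e, y)) *
  cos ((shifted ((e, y) : W)).2 0 i + th)) z (fun i => (dm i th).1).
have mapE : normal_map e = fun y =>
  (\row_i (Num.sqrt (new_action i (e, y)) * cos ((shifted ((e, y) : W)).2 0 i + pi / 2)),
   \row_i (Num.sqrt (new_action i (e, y)) * cos ((shifted ((e, y) : W)).2 0 i + 0))).
  by apply/funext => y; rewrite normal_mapE.
have dmap : differentiable (normal_map e) z by rewrite mapE; exact: differentiable_pair (dM _) (dM _).
split=> //.
have DE i : ('D_v (normal_map e) z).1 0 i =
     Num.sqrt (new_action i (e, z)) * (- cos ((shifted ((e, z) : W)).2 0 i) * beta 0 i)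
     - sin ((shifted ((e, z) : W)).2 0 i) * 'D_v (fun y => Num.sqrt (new_action i (e, y)) : R^o) z /\
   ('D_v (normal_map e) z).2 0 i =
     Num.sqrt (new_action i (e, z)) * (- sin ((shifted ((e, z) : W)).2 0 i) * beta 0 i)
     + cos ((shifted ((e, z) : W)).2 0 i) * 'D_v (fun y => Num.sqrt (new_action i (e, y)) : R^o) z.
  rewrite mapE derive_pair //; split.
    rewrite /= [in LHS](derive_row v (fun i => (dm i _).1)) mxE (dm i _).2 (diff_cos_shifted i _).2.
    by rewrite cosDpihalf sinDpihalf; congr (_ + _); exact: mulNr.
  rewrite /= [in LHS](derive_row v (fun i => (dm i _).1)) mxE (dm i _).2 (diff_cos_shifted i _).2.
  by rewrite addr0.
apply/rowP => i; rewrite angle_formE actions_action_angle; last first.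
  by move=> j; rewrite mxE; exact: ltW (new_action_gt0 j Uz).
rewrite /cross (DE i).1 (DE i).2 [in X in _ / X]mxE.
rewrite normal_mapE [(_, _).1]/= [(_, _).2]/= ![(\row_j _) 0 i]mxE cosDpihalf addr0.
exact: cross_rotation (cos2Dsin2 _) (sqr_sqrtr (ltW (pos i))) (pos i).
Qed.

(* y d(eta) = (d(eta y) - xi dx) / 2, and xi dx - I dphi = d(S - s r) for the
   generating function S. *)
Definition exactness_primitive (y : pt) : R^o :=
  2^-1 * (\sum_i ((normal_map e y).1 0 i * (normal_map e y).2 0 i) - \sum_i (y.1 0 i * y.2 0 i)
    - (power_sum S e (shifted ((e, y) : W)) - slow ((e, y) : W) * re y)).

Lemma normal_map_exact : is_derive z v exactness_primitive
  (liouville (normal_map e z) ('D_v (normal_map e) z) - liouville z v).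
Proof.
have [dC CE] := normal_map_derive.
have [d1 E1] := diff_eta_y dC; have [d2 E2] := diff_eta_y did.
have hS := in_span_power_sum e S_span.
have [d3 E3] := slice_comp hS.
have [ds sE] := diff_slow did; have [d4 E4] := diff_mul ds dr.
have [d34 E34] := diff_sub d3 d4.
have [d12 E12] := diff_sub d1 d2; have [d5 E5] := diff_sub d12 d34.
have [d6 E6] := diff_mul (differentiable_cst (2^-1 : R^o) z) d5.
split; first exact: diff_derivable d6.
rewrite [LHS]E6 derive_cst mulr0 addr0 E5 E12 E1 E2 E34 E3 E4 sE derive_id.
have pz := (phase_spaceP _).1 (normal_domain_phase Uz).
have pC := (phase_spaceP _).1 (normal_map_phase Uz).
have L1 := liouville_double ('D_v (normal_map e) z) pC; have L2 := liouville_double v pz.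
rewrite CE actions_action_angle in L1; last first.
  by move=> j; rewrite mxE; exact: ltW (new_action_gt0 j Uz).
have tE : re z = power_sum St e (shifted ((e, z) : W)).
  by have [we _] := Uz; exact: (time_shiftE we).
(* The derivative of [S] in [s] is [r] by the defining equation, so the variations of [s] in [S] and
   in [s r] cancel. *)
have -> : dtime (fun w => power_sum S e w : R^o) (shifted ((e, z) : W)) = re z.
  by rewrite tE /dtime derive_power_sum.
have DE : 'D_((0, beta) : E) (fun w => power_sum S e w : R^o) (shifted ((e, z) : W)) =
    dot (\row_i new_action i (e, z)) beta - dot (actions z) beta.
  rewrite derive_coords // mul0r add0r /dot -sumrB; apply: eq_bigr => i _.
  rewrite [(\row_j _) 0 i]mxE /new_action [X in _ = X - _]mulrDl [RHS]addrAC subrr add0r mulrC.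
  congr (_ * _).
  exact: derive_power_sum.
have BE : dot (actions z) beta = dot (actions z) (angle_form z v) - 'D_v re z * dot omega (actions z).
  rewrite /dot mulr_sumr -sumrB; apply: eq_bigr => i _; rewrite !mxE.
  by rewrite mulrBr; congr (_ - _); rewrite mulrCA [omega _ _ * _]mulrC.
rewrite DE BE.
move: (dot _ beta) (dot _ (angle_form _ _)) ('D_v re z) (dot omega _) L1 L2 (re z) (slow_form _ _) => x1 x2 x3 x4 L1 L2 x5 x6.
move: L1 L2; set y1 := \sum_i _; set y2 := \sum_i _.
rewrite /cst; move: (liouville _ _) (liouville _ _) => w1 w2.
move: y1 y2 => y1 y2 L1 L2.
lra.
Qed.

End Slice.

Lemma normal_map_canonical : canonical_near_id U normal_map.
Proof.
split.
- split; first exact: normal_domain_open.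
  move=> z /phase_spaceP z0; split=> [|i]; first by rewrite normr0 e_max_gt0.
  by rewrite normr0 mulr0.
- exact: normal_map_smooth.
- exact: normal_map0.
- move=> e z Uz; split; [exact: normal_domain_phase Uz|exact: normal_map_phase].
- by exists exactness_primitive => e z v; exact: normal_map_exact.
Qed.

Lemma truncated_slope_coords e w : truncated_slope omega S N e w =
  \sum_i omega 0 i * power_sum (fun k => space_derivative (S k) i) e w.
Proof.
under [RHS]eq_bigr do rewrite mulr_sumr.
rewrite exchange_big; apply: eq_bigr => k _.
rewrite derive_coords // mul0r add0r mulr_sumr; apply: eq_bigr => i _.
exact: mulrCA.
Qed.

(** Puts the image at the point [(s + D, x)] treated by [residual_bound]. Its angles are known
    modulo periods only, which a periodic potential does not notice. *)
Lemma normal_map_slow e z : U (e, z) -> exists w : E, exists k : 'rV[int]_l,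
  [/\ w.1 = dot omega (actions z), angle (normal_map e z) = w.2 + (2 * pi) *: zvec k &
   dot omega (actions (normal_map e z)) = w.1 + truncated_slope omega S N e w].
Proof.
move=> Uz; have pos i := new_action_gt0 i Uz.
have xi0 i : 0 < (\row_i new_action i (e, z)) 0 i by rewrite mxE.
have [k kE] := angle_action_angle (shifted_angle ((e, z) : W)) xi0.
exists (shifted ((e, z) : W)), k; split=> //.
rewrite actions_action_angle => [|i]; last exact: ltW.
rewrite truncated_slope_coords /dot -big_split; apply: eq_bigr => i _ /=.
by rewrite [(\row_j _) 0 i]mxE mulrDr.
Qed.

End NormalFormTransformation.

Lemma near_compact {R : realType} {T : topologicalType} (U : set (R^o * T)) (K : set T) :
  open U -> compact K -> (forall z, K z -> U (0, z)) ->
  \forall e \near (0 : R), forall z, K z -> U (e, z).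
Proof.
move=> oU /compact_near_coveringP/(_ R (nbhs (0 : R)) (fun e z => U (e, z))) cK U0.
apply: cK => z Kz.
have [[A B] /= [A0 Bz] sub] := open_nbhs_nbhs (conj oU (U0 z Kz)).
by exists (B, A) => //= -[y e] [/= By Ae]; apply: (sub (e, y)).
Qed.

Lemma normal_form_exists {R : realType} {l : nat} (omega : 'rV[R]_l) (V : R -> 'rV[R]_l -> R)
    (b : nat -> R -> R) (S : nat -> R^o * 'rV[R]_l -> R^o) :
  in_span (fun w : R^o * 'rV[R]_l => V w.1 w.2 : R^o) ->
  formal_solution omega (fun w : R^o * 'rV[R]_l => V w.1 w.2) b S ->
  birkhoff_normal_form (hamiltonian0 omega) (hamiltonian1 omega V)
    (fun k I => b k (dot omega I)).
Proof.
move=> hh sol N; have [S_span _ S0 _ _] := sol.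
have [C0 [C0_gt0 C0_bound]] := derivative_bounds omega N S_span S0.
have can := normal_map_canonical S_span S0 C0_gt0 C0_bound.
exists (@normal_domain R l C0), (normal_map omega S N); split=> // K cK Kp.
have [M HM] := residual_bound hh sol N; exists M.
have [[oU U0] _ _ pU _] := can.
have n1 : \forall e \near (0 : R), `|e| <= 1 by exact: nbhs0_le.
have n2 := near_compact oU cK (fun z Kz => U0 z (Kp z Kz)).
apply: filterS2 n1 n2 => e e1 KU z Kz; have Uz := KU z Kz.
have [_ pC] := pU _ _ Uz.
have [w [k [wE aE sE]]] := normal_map_slow S_span C0_bound Uz.
rewrite hamiltonian_at // sE aE (in_span_periodic hh (w.1 + truncated_slope omega S N e w) w.2 k).
rewrite /birkhoff_partial_sum hamiltonian0E -wE.
exact: HM.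
Qed.

(** * The Fourier representation *)

Section CountableSums.
Import finmap.
Context {R : realType} {I : countType}.

(** The finite sets of elements with code below [n] eventually contain every finite set, so the
    unordered sum is also the limit along the enumeration. Codes that name no element contribute
    0. *)
Lemma unordered_sum_cvg (x : I -> R) (a : R) :
  summability.partial_sum x @ summability.totally --> a ->
  (fun n => \sum_(0 <= k < n) oapp x 0 (pickle_inv k)) @ \oo --> a.
Proof.
move=> xa; pose s n : seq I := pmap pickle_inv (iota 0 n).
have us n : uniq (s n) by apply: (pmap_uniq pickle_invK); exact: iota_uniq.
pose A n : {fset I} := [fset q in s n]%fset.
have At : A @ \oo --> summability.totally.
  move=> P [B _ BP]; exists (\max_(q <- B) choice.pickle q).+1 => // n /= Bn; apply: BP => /=.
  apply/fsubsetP => q qB; rewrite !inE mem_pmap; apply/mapP; exists (choice.pickle q).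
    rewrite mem_iota /= add0n (leq_trans _ Bn) // ltnS.
    by apply: (@leq_bigmax_seq I (enum_fset B) xpredT choice.pickle q).
  by rewrite pickleK_inv.
have sE : (fun n => \sum_(0 <= k < n) oapp x 0 (pickle_inv k)) = summability.partial_sum x \o A.
  apply/funext => n /=; rewrite /summability.partial_sum.
  rewrite -(big_seq_fsetE _ _ xpredT x) /=.
  rewrite (perm_big (s n)) /=; last first.
    by apply: uniq_perm; [exact: fset_uniq|exact: us|move=> q; rewrite !inE].
  rewrite /s /index_iota subn0; elim: (iota 0 n) => [|k t IH]; first by rewrite !big_nil.
  rewrite big_cons IH /=; case: (pickle_inv k) => [q|] /=; first by rewrite big_cons.
  by rewrite add0r.
by rewrite sE; exact: cvg_comp At xa.
Qed.

(** [i0] is the value of the enumeration at codes that name no element; such codes are excluded from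
    the sum. *)
Lemma esum_countable (i0 : I) (a : I -> \bar R) : (forall i, 0 <= a i)%E ->
  (\esum_(i in [set: I]) a i = \sum_(k <oo) oapp a 0 (pickle_inv k))%E.
Proof.
move=> a0; pose e k : I := odflt i0 (pickle_inv k).
pose P k := isSome (@pickle_inv I k).
have eP : e @` [set k | P k] = [set: I].
  apply/seteqP; split=> // q _; exists (choice.pickle q); rewrite /= /P /e pickleK_inv //.
have ei : set_inj [set k | P k] e.
  move=> j k /set_mem + /set_mem; rewrite /= /P /e.
  have := @pickle_invK I j; have := @pickle_invK I k.
  by case: (pickle_inv j) => // q; case: (pickle_inv k) => //= q' <- <- _ _ ->.
have := @esum_pred_image R I a e P (fun n _ => a0 _) ei; rewrite eP => ->.
rewrite eseries_mkcond; apply: congr_lim; apply/funext => n; apply: eq_bigr => k _.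
by rewrite /P /e; case: (pickle_inv k).
Qed.

End CountableSums.

Lemma counting_integral_cvg {R : realType} (g : nat -> R) :
  (@counting _ R).-integrable setT (EFin \o g) ->
  (fun n => \sum_(0 <= k < n) g k) @ \oo --> \int[@counting _ R]_k g k.
Proof.
move=> ig.
have sg : esum.summable setT (EFin \o g).
  have /integrableP[_] := ig; rewrite ge0_integral_count; last by move=> k; exact: abse_ge0.
  by rewrite nneseries_esumT // => k; exact: abse_ge0.
have cg : cvgn (series g).
  apply: normed_cvg.
  have := @summable_cvg R xpredT (fun k => `|(g k)%:E|%E) (fun k _ => abse_ge0 _).
  apply; rewrite /esum.summable; under eq_esum do rewrite abse_id.
  rewrite (_ : (fun k => _) = [set: nat]); first exact: sg.
  by apply/seteqP; split.
have lE : \int[@counting _ R]_k g k = limn (series g).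
  rewrite /Rintegral integral_count //.
  have cE : (fun n => \sum_(0 <= k < n) (g k)%:E)%E @ \oo --> (limn (series g))%:E.
    rewrite (_ : (fun n => _) = EFin \o series g); first by apply: cvg_EFin; [exact: nearW|exact: cg].
    by apply/funext => n /=; rewrite /series /= sumEFin.
  by rewrite (cvg_lim _ cE).
by rewrite lE.
Qed.

Lemma measurable_nat_prod {R : realType} d (T : measurableType d) (f : nat * T -> R) :
  (forall n, measurable_fun setT (fun p => f (n, p))) -> measurable_fun setT f.
Proof.
move=> mf _ Y mY; rewrite setTI.
rewrite (_ : f @^-1` Y = \bigcup_n ([set n] `*` ((fun p => f (n, p)) @^-1` Y))).
  apply: bigcup_measurable => n _; apply: measurableX => //.
  by rewrite -[X in measurable X]setTI; exact: mf.
apply/seteqP; split=> [[n p] /= Yf|[n p] [k _ [/= -> //]]].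
by exists n.
Qed.

Lemma exprn_le_expR {R : realType} n (x : R) : 0 <= x -> x ^+ n <= n`!%:R * expR x.
Proof.
move=> x0; case: n => [|n]; first by rewrite expr0 mul1r (le_trans _ (expR_ge1Dx x)) // lerDl.
have f0 : 0 < (n.+1)`!%:R :> R by rewrite ltr0n fact_gt0.
have H := expR_ge1Dxn n x0; rewrite mulrC -ler_pdivrMr //; lra.
Qed.

Section IteratedTimeDerivative.
Context {R : realType} {l : nat}.
Local Notation E := (R^o * 'rV[R]_l)%type.

(** A derivative in time multiplies the amplitude by the time frequency alone, so only moments in
    [p] appear and space frequencies cost nothing. *)
Lemma iter_dtime_osc_le j (X : @spectrum R l) th w :
  `|iter j dtime (osc X th) w| <= \int[sp_measure X]_i (`|amplitude i| * `|time_freq i| ^+ j).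
Proof.
elim: j X th => [|j IH] X th.
  rewrite [leRHS](_ : _ = \int[sp_measure X]_i `|amplitude i|); first exact: osc_le.
  by congr fine; apply: eq_integral => i _; rewrite expr0 mulr1.
have dE : dtime (osc X th) = osc (deriv_spectrum X (1, 0)) (th + pi / 2).
  apply/funext => y; have := in_span_is_diff [:: (X, th)] y.
  rewrite (_ : (fun w => _) = osc X th); last by apply/funext => u; rewrite big_seq1.
  move=> [dx oE]; by rewrite /dtime deriveE // oE big_seq1.
rewrite iterSr dE (le_trans (IH _ _)) // le_eqVlt; apply/orP; left; apply/eqP.
congr fine; apply: eq_integral => i _; congr (_%:E) => /=.
rewrite normrM /phase_at /dot /= mulr1 big1 ?addr0 => [|k _]; last by rewrite [X in _ * X]mxE mulr0.
by rewrite exprS mulrA.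
Qed.

End IteratedTimeDerivative.

(** * The Fourier representation as a wave integral *)

Section FourierSpectrum.
Context {R : realType} {l : nat}.
Local Notation E := (R^o * 'rV[R]_l)%type.
Local Notation zv q := (@zvec R l q).
Variables (Vhat : 'rV[int]_l -> R -> R[i]) (rho : R).
Hypotheses (rho1 : 1 <= rho)
  (Vhat_meas : forall q, measurable_fun setT (fun p => complex.Re (Vhat q p)) /\
                         measurable_fun setT (fun p => complex.Im (Vhat q p)))
  (fnorm_fin : (fnorm rho Vhat < +oo)%E).
Local Notation count := (sigma_finite_pack (sigma_finite_counting R)).
Local Notation leb := (@lebesgue_measure R).
Local Notation mu := (count \x leb)%E.

(** The modes are enumerated by natural numbers, so that counting measure times Lebesgue measure
    serves as the measure on the frequencies [(q, p)]; codes that name no mode carry the value 0. *)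
Definition spread (f : 'rV[int]_l -> R -> R) (j : nat * measurableTypeR R) : R :=
  oapp (fun q => f q j.2) 0 (pickle_inv j.1).

Lemma measurable_spread f : (forall q, measurable_fun setT (f q)) -> measurable_fun setT (spread f).
Proof.
move=> mf; apply: measurable_nat_prod => n; rewrite /spread /=.
by case: (pickle_inv n) => [q|]; [exact: mf|exact: measurable_cst].
Qed.

Lemma cmodulus_ge0 z : 0 <= cmodulus z :> R.
Proof. by case: z => a b; exact: sqrtr_ge0. Qed.

Lemma Re_le_cmodulus z : `|complex.Re z| <= cmodulus z :> R.
Proof. by case: z => a b; rewrite /cmodulus /= -sqrtr_sqr ler_wsqrtr // lerDl sqr_ge0. Qed.

Lemma Im_le_cmodulus z : `|complex.Im z| <= cmodulus z :> R.
Proof. by case: z => a b; rewrite /cmodulus /= -sqrtr_sqr ler_wsqrtr // lerDr sqr_ge0. Qed.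

Lemma measurable_cmodulus q : measurable_fun setT (fun p => cmodulus (Vhat q p)).
Proof.
have [mr mi] := Vhat_meas q.
rewrite (_ : (fun p => _) = fun p =>
    Num.sqrt (complex.Re (Vhat q p) ^+ 2 + complex.Im (Vhat q p) ^+ 2)); last first.
  by apply/funext => p; rewrite /cmodulus; case: (Vhat q p).
apply: measurableT_comp; first exact: continuous_measurable_fun (@sqrt_continuous R).
by apply: measurable_funD; exact: measurable_funX.
Qed.

Definition exp_weight q (p : R) : R := cmodulus (Vhat q p) * expR (rho * `|p|).

Lemma exp_weight_ge0 q p : 0 <= exp_weight q p.
Proof. by rewrite mulr_ge0 ?expR_ge0 ?cmodulus_ge0. Qed.

Lemma measurable_exp_weight q : measurable_fun setT (exp_weight q).
Proof.
apply: measurable_funM; first exact: measurable_cmodulus.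
apply: measurableT_comp; first exact: measurable_expR.
by apply: measurable_funM => //; exact: measurable_normr.
Qed.

Definition weight q (p : R) : R := expR (rho * enorm (zv q)) * exp_weight q p.

Lemma measurable_weight q : measurable_fun setT (weight q).
Proof. by apply: measurable_funM => //; exact: measurable_exp_weight. Qed.

Lemma weight_ge0 q p : 0 <= weight q p.
Proof. by rewrite mulr_ge0 ?expR_ge0 ?exp_weight_ge0. Qed.

Lemma spread_weight_ge0 j : 0 <= spread weight j.
Proof. by rewrite /spread; case: pickle_inv => // q; exact: weight_ge0. Qed.

Lemma rho_ge0 : 0 <= rho. Proof. exact: le_trans rho1. Qed.

Lemma enorm_ge0 (u : 'rV[R]_l) : 0 <= enorm u. Proof. exact: sqrtr_ge0. Qed.

Lemma cmodulus_le_weight q p : cmodulus (Vhat q p) <= weight q p.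
Proof.
have e1 (x : R) : 0 <= x -> 1 <= expR (rho * x).
  by move=> x0; rewrite -expR0 ler_expR mulr_ge0 // rho_ge0.
rewrite /weight /exp_weight mulrCA ler_peMr ?cmodulus_ge0 //.
by rewrite mulr_ege1 // e1 // enorm_ge0.
Qed.

Lemma integral_weight q : (\int[leb]_p (weight q p)%:E =
  (expR (rho * enorm (zv q)))%:E * \int[leb]_p (exp_weight q p)%:E)%E.
Proof.
rewrite -ge0_integralZl //.
- by apply/measurable_EFinP; exact: measurable_exp_weight.
- by move=> p _; rewrite lee_fin exp_weight_ge0.
Qed.

(** Theorem of Tonelli: the norm of the potential is the total mass of the exponentially weighted
    spectrum, which makes its finiteness an integrability statement. *)
Lemma integral_spread_weight : (\int[mu]_j (spread weight j)%:E = fnorm rho Vhat)%E.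
Proof.
rewrite (fubini_tonelli1 (fun j => (spread weight j)%:E)); last 2 first.
- by apply/measurable_EFinP; apply: measurable_spread => q; exact: measurable_weight.
- by move=> j; rewrite lee_fin spread_weight_ge0.
rewrite [LHS](ge0_integral_count (a := fubini_F leb (fun j => (spread weight j)%:E))); last first.
  by move=> k; apply: integral_ge0 => p _; rewrite lee_fin spread_weight_ge0.
rewrite /fnorm (esum_countable 0); last first.
  move=> q; apply: mule_ge0; first by rewrite lee_fin expR_ge0.
  by apply: integral_ge0 => p _; rewrite lee_fin exp_weight_ge0.
apply: congr_lim; apply/funext => n; apply: eq_bigr => k _.
rewrite /fubini_F /spread /=; case: pickle_inv => [q|] /=; first exact: integral_weight.
by rewrite integral0.
Qed.

Lemma integrable_weight : mu.-integrable setT (EFin \o spread weight).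
Proof.
apply/integrableP; split.
  by apply/measurable_EFinP; apply: measurable_spread => q; exact: measurable_weight.
rewrite (eq_integral (fun j => (spread weight j)%:E)) ?integral_spread_weight // => j _ /=.
by rewrite ger0_norm ?spread_weight_ge0.
Qed.

Lemma integrable_coef q : leb.-integrable setT (fun p => (weight q p)%:E).
Proof.
apply/integrableP; split; first by apply/measurable_EFinP; exact: measurable_weight.
apply: le_lt_trans fnorm_fin.
rewrite [leLHS](_ : _ = \int[leb]_p (weight q p)%:E)%E; last first.
  by apply: eq_integral => p _; rewrite /= ger0_norm ?weight_ge0.
rewrite integral_weight; apply: esum_ge.
by exists [set q]; [split|rewrite fsbig_set1].
Qed.

Lemma freq_size_exp m : exists C, 0 <= C /\ forall (p : R) q,
  freq_size p q ^+ m <= C * (expR (rho * enorm (zv q)) * expR (rho * `|p|)).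
Proof.
(* With [y = 1 + |p| + |q|], each of the [l] coordinates is at most [|q|], whence the power of
   [l + 1]; and [y^m <= m! exp y], with one factor [exp 1] taken out. The rest uses [rho >= 1]. *)
exists (l.+1%:R ^+ m * (m`!%:R * expR 1)); split.
  by rewrite !mulr_ge0 ?exprn_ge0 ?expR_ge0 ?ler0n.
move=> p q; have e0 := enorm_ge0 (zv q); have p0 := normr_ge0 p.
have coord i : `|zv q 0 i| <= enorm (zv q).
  rewrite -sqrtr_sqr ler_wsqrtr // /dot (bigD1 i) //= -expr2 lerDl sumr_ge0 // => k _.
  by rewrite -expr2 sqr_ge0.
have fs : freq_size p q <= l.+1%:R * (1 + `|p| + enorm (zv q)).
  rewrite /freq_size -natr1.
  have : \sum_i `|zv q 0 i| <= l%:R * enorm (zv q).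
    rewrite mulr_natl -[X in _ *+ X]card_ord -sumr_const; exact: ler_sum.
  have := ler0n R l; move: (\sum_i _) (l%:R) (`|p|) (enorm _) p0 e0 => a b c d; nra.
rewrite (le_trans (lerXn2r _ _ _ fs)) ?nnegrE ?freq_size_ge0 ?mulr_ge0 ?ler0n //; first by lra.
rewrite exprMn -mulrA ler_wpM2l ?exprn_ge0 ?ler0n //.
rewrite (le_trans (exprn_le_expR m _)); [by []|lra|].
rewrite -mulrA ler_wpM2l ?ler0n // -!expRD ler_expR.
have : `|p| <= rho * `|p| by rewrite ler_peMl.
have : enorm (zv q) <= rho * enorm (zv q) by rewrite ler_peMl.
lra.
Qed.

Section Spectrum.
Variable f : 'rV[int]_l -> R -> R.
Hypotheses (mf : forall q, measurable_fun setT (f q))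
  (f_le : forall q p, `|f q p| <= cmodulus (Vhat q p)).
Local Notation J := (nat * measurableTypeR R)%type.
(* The mode of an index that enumerates nothing is 0, but its amplitude is 0. *)
Definition mode (j : J) : 'rV[int]_l := odflt 0 (pickle_inv j.1).

Lemma measurable_mode i : measurable_fun setT (fun j : J => zv (mode j) 0 i).
Proof. by apply: measurable_nat_prod => n; rewrite /mode /=; exact: measurable_cst. Qed.

Lemma integrable_spread_moment m : mu.-integrable setT
  (EFin \o (fun j : J => spread f j * freq_size j.2 (mode j) ^+ m)).
Proof.
have [C [C0 HC]] := freq_size_exp m.
apply: (@le_integrable _ _ _ _ _ measurableT _ (EFin \o (fun j => C * spread weight j))).
- apply/measurable_EFinP/measurable_funM; first exact: measurable_spread.
  apply: measurable_funX; apply: measurable_funD; first apply: measurable_funD => //.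
    by apply: measurableT_comp => //; exact: measurable_snd.
  by apply: measurable_sum => i; apply: measurableT_comp => //; exact: measurable_mode.
- move=> j _ /=; rewrite lee_fin normrM [leRHS]ger0_norm ?mulr_ge0 ?spread_weight_ge0 //.
  rewrite [X in _ * X]ger0_norm ?exprn_ge0 ?freq_size_ge0 // /spread /mode.
  case: pickle_inv => [q|] /=; last by rewrite normr0 mul0r mulr0.
  rewrite mulrC (le_trans (ler_pM _ _ (HC j.2 q) (f_le q j.2))) ?exprn_ge0 ?freq_size_ge0 //.
  by rewrite -!mulrA ler_wpM2l // /weight /exp_weight [cmodulus _ * _]mulrC.
- exact: (integrableZl measurableT C integrable_weight).
Qed.

Definition fourier_spectrum : @spectrum R l :=
  @Spectrum R l _ J (sigma_finite_pack (sigma_finite_product count leb))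
    (spread f) (fun j => j.2) mode (measurable_spread mf) measurable_snd measurable_mode
    integrable_spread_moment.

Lemma integrable_mode q (g : R -> R) : measurable_fun setT g -> (forall p, `|g p| <= 1) ->
  leb.-integrable setT (EFin \o (fun p => f q p * g p)).
Proof.
move=> mg g1; apply: (@le_integrable _ _ _ _ _ measurableT _ _ _ _ (integrable_coef q)).
  by apply/measurable_EFinP; exact: (measurable_funM (mf q) mg).
move=> p _ /=; rewrite lee_fin normrM [leRHS]ger0_norm ?weight_ge0 //.
by rewrite (le_trans _ (cmodulus_le_weight q p)) // (le_trans _ (f_le q p)) // ler_piMr.
Qed.

Lemma measurable_cos_mode t a : measurable_fun setT (fun p : R => cos (p * t + a)).
Proof.
by apply: measurable_fun_cos; apply: measurable_funD => //; exact: measurable_funM.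
Qed.

(** Theorem of Fubini: integrating over [p] first leaves an integral for the counting measure, which
    is the limit of the partial sums along the enumeration. *)
Lemma osc_fourier_cvg th t x :
  (fun n => \sum_(0 <= k < n) oapp (fun q => \int[leb]_p (f q p * cos (p * t + (dot (zv q) x + th))))
     0 (pickle_inv k)) @ \oo --> (osc fourier_spectrum th (t, x) : R).
Proof.
pose F (j : J) := (amplitude (s := fourier_spectrum) j * cos (phase_at (X := fourier_spectrum) (t, x) j + th))%:E.
have iF : mu.-integrable setT F := integrable_cos fourier_spectrum th (t, x).
have FE k : fubini_F leb F k =
    (oapp (fun q => \int[leb]_p (f q p * cos (p * t + (dot (zv q) x + th)))) 0 (pickle_inv k))%:E.
  rewrite /fubini_F /F /= /spread /phase_at /= /mode /=.
  case: (pickle_inv k) => [q|] /=; last by under eq_integral do rewrite mul0r; rewrite integral0.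
  rewrite /Rintegral fineK; first by apply: eq_integral => p _; rewrite addrA.
  apply: integrable_fin_num => //; apply: integrable_mode; first exact: measurable_cos_mode.
  by move=> p; exact: cos_max.
have iG := integrable_fubini_F iF.
rewrite (_ : fubini_F leb F = EFin \o (fun k => oapp (fun q =>
    \int[leb]_p (f q p * cos (p * t + (dot (zv q) x + th)))) 0 (pickle_inv k))) in iG; last first.
  by apply/funext => k; exact: FE.
have := counting_integral_cvg iG; rewrite (_ : \int[counting]_k _ = osc fourier_spectrum th (t, x)) //.
congr fine; rewrite -[RHS](integral12_prod_meas1 iF).
by apply: eq_integral => k _; rewrite FE.
Qed.

(** Cauchy's estimate on a strip of width [rho] in complex time, in Fourier form: [|p|^n] is at most
    [n! rho^-n exp (rho |p|)]. *)
Lemma fourier_moment_le n : \int[sp_measure fourier_spectrum]_j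
   (`|amplitude j| * `|time_freq j| ^+ n) <= n`!%:R * rho^-1 ^+ n * fine (fnorm rho Vhat).
Proof.
set c := n`!%:R * rho^-1 ^+ n.
have rho0 : 0 < rho by apply: lt_le_trans rho1.
have c0 : 0 <= c by rewrite mulr_ge0 ?ler0n ?exprn_ge0 ?invr_ge0 ?(ltW rho0).
have pow_le (p : R) : `|p| ^+ n <= c * expR (rho * `|p|).
  have := @exprn_le_expR R n (rho * `|p|) (mulr_ge0 (ltW rho0) (normr_ge0 p)).
  rewrite exprMn mulrC -ler_pdivlMr ?exprn_gt0 // => H.
  by rewrite (le_trans H) // /c mulrAC exprVn.
have amp_le j : `|spread f j| * `|j.2| ^+ n <= c * spread weight j.
  rewrite /spread; case: pickle_inv => [q|] /=; last by rewrite normr0 mul0r mulr0.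
  rewrite (le_trans (ler_pM _ _ (f_le q j.2) (pow_le j.2))) ?exprn_ge0 //.
  rewrite mulrCA ler_wpM2l // -/(exp_weight q j.2) /weight ler_peMl ?exp_weight_ge0 //.
  by rewrite -expR0 ler_expR mulr_ge0 ?enorm_ge0 // ltW.
have iw : mu.-integrable setT (EFin \o (fun j => c * spread weight j)).
  exact: (integrableZl measurableT c integrable_weight).
have ia : mu.-integrable setT (EFin \o (fun j : J => `|spread f j| * `|j.2| ^+ n)).
  apply: (@le_integrable _ _ _ _ _ measurableT _ _ _ _ iw).
    apply/measurable_EFinP/measurable_funM.
      by apply: measurableT_comp => //; exact: measurable_spread.
    by apply: measurable_funX; apply: measurableT_comp => //; exact: measurable_snd.
  move=> j _ /=; rewrite lee_fin [leLHS]ger0_norm ?mulr_ge0 ?exprn_ge0 //.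
  by rewrite (le_trans (amp_le j)) // ler_norm.
have wE : \int[mu]_j spread weight j = fine (fnorm rho Vhat).
  by rewrite /Rintegral integral_spread_weight.
rewrite -wE -RintegralZl //; last exact: integrable_weight.
by apply: (le_Rintegral _ ia iw) => // j _; exact: amp_le.
Qed.

Lemma mode_integral_split q t b :
  \int[leb]_p (f q p * cos (p * t + b)) =
  cos b * \int[leb]_p (f q p * cos (p * t)) - sin b * \int[leb]_p (f q p * sin (p * t)).
Proof.
have ic : leb.-integrable setT (EFin \o (fun p => f q p * cos (p * t))).
  apply: integrable_mode => [|p]; last exact: cos_max.
  by apply: measurable_fun_cos; exact: measurable_funM.
have is_ : leb.-integrable setT (EFin \o (fun p => f q p * sin (p * t))).
  apply: integrable_mode => [|p]; last exact: sin_max.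
  by apply: measurable_fun_sin; exact: measurable_funM.
rewrite -[X in _ = X - _]RintegralZl // -[X in _ = _ - X]RintegralZl // -RintegralB //.
- by apply: eq_Rintegral => p _; rewrite cosD; ring.
- exact: (integrableZl measurableT (cos b) ic).
- exact: (integrableZl measurableT (sin b) is_).
Qed.

End Spectrum.

Let re q p : R := complex.Re (Vhat q p).
Let im q p : R := complex.Im (Vhat q p).
Let mre q : measurable_fun setT (re q). Proof. by have [] := Vhat_meas q. Qed.
Let mim q : measurable_fun setT (im q). Proof. by have [] := Vhat_meas q. Qed.
Let re_le q p : `|re q p| <= cmodulus (Vhat q p). Proof. exact: Re_le_cmodulus. Qed.
Let im_le q p : `|im q p| <= cmodulus (Vhat q p). Proof. exact: Im_le_cmodulus. Qed.

Lemma Re_mul (a b : R[i]) : complex.Re (a * b) = complex.Re a * complex.Re b - complex.Im a * complex.Im b.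
Proof. by case: a; case: b. Qed.

Lemma Im_mul (a b : R[i]) : complex.Im (a * b) = complex.Re a * complex.Im b + complex.Im a * complex.Re b.
Proof. by case: a; case: b. Qed.

(** The real part of [z e^(i a)] is [Re z cos a + Im z cos (a + pi / 2)], so the potential is a sum
    of two wave integrals with real amplitudes. *)
Lemma fourier_coef_Re q t b : complex.Re (fourier_coef Vhat q t * expi b) =
  \int[leb]_p (re q p * cos (p * t + (b + 0))) + \int[leb]_p (im q p * cos (p * t + (b + pi / 2))).
Proof.
have i1 (g : R -> R) : measurable_fun setT g -> (forall p, `|g p| <= 1) ->
    leb.-integrable setT (EFin \o (fun p => re q p * g p)) by exact: integrable_mode.
have i2 (g : R -> R) : measurable_fun setT g -> (forall p, `|g p| <= 1) ->
    leb.-integrable setT (EFin \o (fun p => im q p * g p)) by exact: integrable_mode.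
have mc : measurable_fun setT (fun p : R => cos (p * t)).
  by apply: measurable_fun_cos; exact: measurable_funM.
have ms : measurable_fun setT (fun p : R => sin (p * t)).
  by apply: measurable_fun_sin; exact: measurable_funM.
rewrite Re_mul /= !mode_integral_split // addr0 cosDpihalf sinDpihalf.
have -> : \int[leb]_p complex.Re (Vhat q p * expi (p * t)) =
    \int[leb]_p (re q p * cos (p * t)) - \int[leb]_p (im q p * sin (p * t)).
  rewrite -RintegralB //; [|by apply: i1 => // p; exact: cos_max|by apply: i2 => // p; exact: sin_max].
  by apply: eq_Rintegral => p _; rewrite Re_mul.
have -> : \int[leb]_p complex.Im (Vhat q p * expi (p * t)) =
    \int[leb]_p (re q p * sin (p * t)) + \int[leb]_p (im q p * cos (p * t)).
  rewrite -RintegralD //; [|by apply: i1 => // p; exact: sin_max|by apply: i2 => // p; exact: cos_max].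
  by apply: eq_Rintegral => p _; rewrite Im_mul.
by ring.
Qed.

Local Notation X1 := (fourier_spectrum mre re_le).
Local Notation X2 := (fourier_spectrum mim im_le).

Lemma fourier_osc V t x : fourier_representation V Vhat ->
  V t x = osc X1 0 (t, x) + osc X2 (pi / 2) (t, x).
Proof.
move=> [_ /(_ t x) [+ _]] => /unordered_sum_cvg cV.
have /(_ eventually_filter) c12 := cvgD (@osc_fourier_cvg _ mre re_le 0 t x) (@osc_fourier_cvg _ mim im_le (pi / 2) t x).
have : V t x = limn (fun n => \sum_(0 <= k < n) oapp (fun q =>
    complex.Re (fourier_coef Vhat q t * expi (dot (zv q) x))) 0 (pickle_inv k)).
  by rewrite (cvg_lim (@Rhausdorff R) cV).
move=> ->; rewrite -[RHS](cvg_lim (@Rhausdorff R) c12); congr (lim (_ @ \oo)); apply/funext => n.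
rewrite addrfctE -[RHS]big_split; apply: eq_bigr => k _ /=; case: pickle_inv => [q|] /=; last by rewrite addr0.
exact: fourier_coef_Re.
Qed.

Lemma iter_dtime_add (h k : E -> R^o) j : in_span h -> in_span k ->
  iter j dtime (fun w => h w + k w) = fun w => iter j dtime h w + iter j dtime k w.
Proof.
move=> hh hk; elim: j => [//|j IH]; rewrite !iterS IH; apply/funext => w.
by have [_ dE] := diff_add (in_span_differentiable (in_span_iter j hh) w)
  (in_span_differentiable (in_span_iter j hk) w); rewrite [LHS]dE.
Qed.

(** The factor 2 comes from estimating the spectra of the real and the imaginary part separately,
    each by the full norm. *)
Lemma fourier_in_span V : fourier_representation V Vhat ->
  in_span (fun w : E => V w.1 w.2 : R^o) /\
  forall j w, `|taylor_coef (fun w : E => V w.1 w.2 : R^o) j w| <=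
    2 * fine (fnorm rho Vhat) * rho^-1 ^+ j.
Proof.
move=> rep; have -> : (fun w : E => V w.1 w.2 : R^o) = fun w => osc X1 0 w + osc X2 (pi / 2) w.
  by apply/funext => -[t x]; exact: fourier_osc.
have s1 := in_span_osc X1 0; have s2 := in_span_osc X2 (pi / 2).
split=> [|j w]; first exact: in_spanD.
rewrite /taylor_coef iter_dtime_add // normrM ger0_norm ?invr_ge0 ?ler0n //.
rewrite mulrC ler_pdivrMr ?ltr0n ?fact_gt0 //.
rewrite (le_trans (ler_normD _ _)) //.
have := le_trans (iter_dtime_osc_le j X1 0 w) (fourier_moment_le mre re_le j).
have := le_trans (iter_dtime_osc_le j X2 (pi / 2) w) (fourier_moment_le mim im_le j).
move: (`|_|) (`|_|) (fine _) (rho^-1 ^+ j) (j`!%:R) => a b c d e; lra.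
Qed.

End FourierSpectrum.

(** * Convergence *)

Section GeometricConvergence.
Context {R : realType} {T : choiceType}.
Variables (K : set T) (f : T -> R) (u : nat -> T -> R) (B q : R).
Hypotheses (q0 : 0 <= q) (q1 : q < 1) (u_le : forall k z, K z -> `|u k z| <= B * q ^+ k).

Lemma uniform_geometric :
  exists P : T -> R, {uniform K, (fun n z => f z + \sum_(0 <= k < n) u k z) @ \oo --> P}.
Proof.
pose s z n := \sum_(0 <= k < n) u k z.
have gap z n m : K z -> (n <= m)%N -> `|s z m - s z n| <= B / (1 - q) * q ^+ n.
  move=> Kz nm; rewrite /s (@big_cat_nat _ _ _ n) //= addrAC subrr add0r.
  have B0 : 0 <= B by have := le_trans (normr_ge0 _) (u_le 0 Kz); rewrite expr0 mulr1.
  have gs : (1 - q) * \sum_(n <= k < m) q ^+ k = q ^+ n - q ^+ m.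
    have tE : \sum_(n <= k < m) (q ^+ k.+1 - q ^+ k) = q ^+ m - q ^+ n := telescope_sumr _ nm.
    rewrite -[RHS]opprB -tE.
    by rewrite mulr_sumr -sumrN; apply: eq_bigr => k _; rewrite exprS mulrBl mul1r opprB.
  rewrite (@le_trans _ _ (B * \sum_(n <= k < m) q ^+ k)) //.
    by rewrite (le_trans (ler_norm_sum _ _ _)) // mulr_sumr ler_sum // => k _; exact: u_le.
  rewrite -mulrA ler_wpM2l // mulrC ler_pdivlMr ?subr_gt0 // mulrC gs gerBl exprn_ge0 //.
have gap0 : (fun n => B / (1 - q) * q ^+ n) @ \oo --> (0 : R).
  by apply: cvg_geometric; rewrite ger0_norm.
have cs z : K z -> cvgn (s z).
  move=> Kz; apply: (@normed_cvg R R^o (fun k => u k z)).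
  apply: (@series_le_cvg _ _ (geometric B q)) => [k|k|k|]; rewrite /=.
  - exact: normr_ge0.
  - exact: le_trans (normr_ge0 _) (u_le k Kz).
  - exact: u_le.
  - by apply: is_cvg_geometric_series; rewrite ger0_norm.
exists (fun z => f z + limn (s z)).
apply/uniform_restrict_cvg => /= U /=; rewrite !uniform_nbhsT.
case/nbhs_ex => del /= ballU; apply: filterS; first by move=> ?; exact: ballU.
have /cvgrPdist_lt/(_ _ (gt0 del)) := gap0; apply: filterS => n /= nd z.
(* Outside [K] both restricted functions take the same default value, so their distance is 0. *)
rewrite /patch; case: ifPn => [/set_mem Kz|_]; last exact: ballxx.
rewrite /ball /= opprD addrACA subrr add0r.
apply: le_lt_trans nd; rewrite sub0r normrN [leRHS]ger0_norm; last first.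
  by rewrite (le_trans _ (gap z n n Kz (leqnn n))).
have cn : (fun m => `|s z m - s z n|) @ \oo --> `|limn (s z) - s z n|.
  by apply: cvg_norm; apply: cvgB; [exact: cs|exact: cvg_cst].
rewrite -(cvg_lim (@Rhausdorff R) cn); apply: limr_le; first by apply: cvgP cn.
by exists n => // m /= nm; exact: gap.
Qed.

End GeometricConvergence.

(** * The diophantine condition and the threshold *)

Lemma enorm_le_freq_size {R : realType} {l : nat} (q : 'rV[int]_l) :
  enorm (@zvec R l q) <= freq_size 0 q.
Proof.
have s0 : 0 <= \sum_i `|@zvec R l q 0 i| by rewrite sumr_ge0.
apply: (@le_trans _ _ (\sum_i `|@zvec R l q 0 i|)); last by rewrite /freq_size normr0 addr0 lerDr.
rewrite -[leRHS]ger0_norm // -sqrtr_sqr ler_wsqrtr // expr2 {1}mulr_suml ler_sum // => i _.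
rewrite -expr2 -real_normK ?num_real // expr2 ler_wpM2l // (bigD1 i) //= lerDl sumr_ge0 //.
Qed.

(** The inverse of 0 in the extended reals is infinite, so the hypothesis contains the absence of
    resonances. Since [freq_size] is at least 1, the real exponent [tau] may be replaced by an
    integer above it, as the moments require. *)
Lemma small_divisor_bound {R : realType} {l : nat} (omega : 'rV[R]_l) (gamma tau : R) : 0 < gamma ->
  0 <= tau ->
  (forall q : 'rV[int]_l, q != 0 ->
     ((`|dot omega (zvec q)|%:E)^-1 <= (gamma * enorm (@zvec R l q) `^ tau)%R%:E)%E) ->
  forall q : 'rV[int]_l, q != 0 -> dot omega (@zvec R l q) != 0 /\
     `|dot omega (@zvec R l q)|^-1 <= gamma * freq_size 0 q ^+ (Num.bound tau).
Proof.
move=> g0 t0 dio q /dio; rewrite inver normr_eq0; case: eqP => // _; rewrite lee_fin => H.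
split=> //; apply: le_trans H _; rewrite ler_pM2l // -powR_mulrn ?freq_size_ge0 //.
apply: (@le_trans _ _ (freq_size 0 q `^ tau)).
  by rewrite ge0_ler_powR ?nnegrE ?freq_size_ge0 ?sqrtr_ge0 ?enorm_le_freq_size.
by apply: ler_powR; [exact: freq_size_ge1|exact: ltW (archi_boundP t0)].
Qed.

(** The witness [d = 1 / (c v)] exceeds [e]; the smallness condition of the majorant reads
    [16 v d <= rho], which follows from [c >= 16] and [rho >= 1]. *)
Lemma majorant_radius {R : realType} (c rho v e : R) : 16 <= c -> 1 <= rho -> 0 <= v -> 0 <= e ->
  (e%:E < (c%:E * v%:E)^-1)%E -> exists d, e < d /\ 8 * (2 * v) * d * rho^-1 <= 1.
Proof.
move=> c16 rho1 v0 e0; have rho0 : 0 < rho by apply: lt_le_trans rho1.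
have [->|vN0] := eqVneq v 0.
  (* For [v = 0] the threshold is infinite and every [d] is admissible. *)
  by move=> _; exists (e + 1); rewrite ltrDl ltr01 mulr0 !(mulr0, mul0r) ler01.
have vp : 0 < v by rewrite lt_neqAle eq_sym vN0.
have cv : 0 < c * v by rewrite mulr_gt0 //; lra.
rewrite -EFinM inver gt_eqF // lte_fin => ed; exists (c * v)^-1; split=> //.
rewrite ler_pdivrMr // mul1r (le_trans _ rho1) // ler_pdivrMr // mul1r mulrA.
by rewrite ler_wpM2r //; lra.
Qed.

Theorem corollary1p9 (R : realType) (l : nat) (omega : 'rV[R]_l)
    (V : R -> 'rV[R]_l -> R) (Vhat : 'rV[int]_l -> R -> R[i])
    (gamma tau rho : R)
    (hl : (2 <= l)%N)
    (V_torus : forall t, torus_function (V t))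
    (V_smooth : smooth setT (fun p : R^o * 'rV[R]_l => V p.1 p.2 : R^o))
    (V_fourier : fourier_representation V Vhat)
    (V_zero : forall t, fourier_coef Vhat 0 t = 0)
    (hgamma : 0 < gamma) (htau : l%:R <= tau)
    (diophantine : forall q : 'rV[int]_l, q != 0 ->
      ((`|dot omega (zvec q)|%:E)^-1 <=
         (gamma * enorm (@zvec R l q) `^ tau)%R%:E)%E)
    (hsmall : gamma * tau `^ tau * (tau + 2) `^ (4 * (tau + 2)) < 2^-1)
    (hrho : 2 < rho) (hnorm : (fnorm rho Vhat < +oo)%E) :
  let P0 := hamiltonian0 omega in
  let P1 := hamiltonian1 omega V in
  let eps_star :=
    (((2 `^ (2 * tau) * expR (24 * (2 + tau)))%R%:E * fnorm rho Vhat)^-1)%E in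
  (exists B : nat -> 'rV[R]_l -> R, birkhoff_normal_form P0 P1 B) /\
  (forall B : nat -> 'rV[R]_l -> R, birkhoff_normal_form P0 P1 B ->
     forall eps : R, (`|eps|%:E < eps_star)%E ->
     forall K : set (phase R l), compact K -> K `<=` phase_space ->
       exists P : phase R l -> R,
         {uniform K, (fun n => birkhoff_partial_sum P0 B eps n) @ \oo --> P}).
Proof.
move=> P0 P1 eps_star.
have rho1 : 1 <= rho by rewrite ltW // (lt_trans _ hrho) // ltr1n.
have [Vhat_meas _] := V_fourier.
have [V_span V_taylor] := fourier_in_span rho1 Vhat_meas hnorm V_fourier.
have tau0 : 0 <= tau by apply: le_trans htau.
have [b [S sol]] := formal_solution_exists (small_divisor_bound hgamma tau0 diophantine) V_span.
split; first by exists (fun k I => b k (dot omega I)); exact: normal_form_exists V_span sol.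
move=> B nf eps eps_lt K cK Kp.
have v0 : (0 <= fnorm rho Vhat)%E.
  apply: esum_ge0 => q _; apply: mule_ge0; first by rewrite lee_fin expR_ge0.
  by apply: integral_ge0 => p _; rewrite lee_fin mulr_ge0 ?expR_ge0 ?cmodulus_ge0.
have vE : fnorm rho Vhat = (fine (fnorm rho Vhat))%:E by rewrite fineK // ge0_fin_numE.
have fv0 : 0 <= fine (fnorm rho Vhat) by rewrite fine_ge0.
(* The power of 2 is at least 1, and [exp x >= 1 + x] at [x = 24 (2 + tau) >= 48] is already more
   than enough. *)
have c16 : 16 <= 2 `^ (2 * tau) * expR (24 * (2 + tau)).
  apply: (@le_trans _ _ (1 * expR (24 * (2 + tau)))); last first.
    rewrite ler_wpM2r ?expR_ge0 // -[leLHS](powRr0 2).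
    by apply: ler_powR; rewrite ?ler1n // mulr_ge0.
  by rewrite mul1r (le_trans _ (expR_ge1Dx _)) //; lra.
move: eps_lt; rewrite /eps_star vE => /(majorant_radius c16 rho1 fv0 (normr_ge0 _)) [d [ed Kd]].
have d0 : 0 < d by apply: le_lt_trans ed.
have rho_inv : 0 < rho^-1 by rewrite invr_gt0 (lt_le_trans ltr01).
(* Applied with [K = 2 ||V||] and [r = 1 / rho]. As [d] is larger than [|eps|], the coefficients at
   [eps] decay with the ratio [|eps| / d < 1]. *)
have [|M HM] := formal_bound sol _ rho_inv (ltW d0) Kd V_taylor; first by rewrite mulr_ge0.
have q1 : `|eps| / d < 1 by rewrite ltr_pdivrMr // mul1r.
have q0 : 0 <= `|eps| / d by rewrite divr_ge0 // ltW.
have [|P HP] := @uniform_geometric R (phase R l) K P0 (fun k z => B k.+1 (actions z) * eps ^+ k.+1)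
  (M * (`|eps| / d)) (`|eps| / d) q0 q1.
  move=> k z Kz; rewrite -mulrA -exprS expr_div_n mulrA mulrAC normrM normrX ler_wpM2r ?exprn_ge0 //.
  rewrite ler_pdivlMr ?exprn_gt0 // (normal_form_unique V_span sol nf) //; exact: Kp.
exists P; rewrite (_ : (fun n => _) = fun n z => P0 z +
    \sum_(0 <= k < n) B k.+1 (actions z) * eps ^+ k.+1) //.
apply/funext => n; apply/funext => z; rewrite /birkhoff_partial_sum big_add1 /=.
by [].
Qed.
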